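(* Let $n\ge2$, $\alpha\in(0,2)$ and $f,g,h,l\in C^1([0,+\infty)\times[0,+\infty),\mathbb{R})$. Let $(u,v)\in\left(L_\alpha\cap C^{1,\theta}_{loc}(\mathbb{R}^n)\right)^2$, for some $\theta>\max\{0,\alpha-1\}$, be a positive solution of the system $$\begin{cases}(-\Delta)^{\frac{\alpha}{2}}u(x)=f(u(x),v(x)), & x\in\mathbb{R}^n_+,\\ (-\Delta)^{\frac{\alpha}{2}}v(x)=g(u(x),v(x)), & x\in\mathbb{R}^n_+,\\ \mathcal{N}_{\frac{\alpha}{2}}u(x)=h(u(x),v(x)), & x\in\mathbb{R}^n\setminus\overline{\mathbb{R}^n_+},\\ \mathcal{N}_{\frac{\alpha}{2}}v(x)=l(u(x),v(x)), & x\in\mathbb{R}^n\setminus\overline{\mathbb{R}^n_+}.\end{cases}$$ Suppose that, for some constants $a,b>0$ and $p,q,r,s\ge1$: (i) $u(x)\le\frac{1}{|x|^a}$ and $v(x)\le\frac{1}{|x|^b}$ as $|x|\to\infty$ (i.e. for all sufficiently large $|x|$); (ii) $\frac{\partial f}{\partial u}\le u^{p-1}v^q$ and $\frac{\partial g}{\partial v}\le u^rv^{s-1}$ as $(u,v)\to(0^+,0^+)$ (i.e. for all sufficiently small $u,v>0$); (iii) $\frac{\partial f}{\partial v}\le u^pv^{q-1}$ and $\frac{\partial g}{\partial u}\le u^{r-1}v^s$ as $(u,v)\to(0^+,0^+)$ (same meaning); (iv) $\frac{\partial f}{\partial v}>0$ and $\frac{\partial g}{\partial u}>0$ for all $(u,v)\in\mathbb{R}^+\times\mathbb{R}^+$;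 (v) $\frac{\partial h}{\partial u}<0$, $\frac{\partial l}{\partial v}<0$, $\frac{\partial h}{\partial v}>0$, $\frac{\partial l}{\partial u}>0$ for all $(u,v)\in\mathbb{R}^+\times\mathbb{R}^+$; (vi) there exist $\mu,\nu>0$ with $\mu\nu>1$ such that $-\frac{\partial h}{\partial u}\ge\mu\frac{\partial h}{\partial v}$ and $-\frac{\partial l}{\partial v}\ge\nu\frac{\partial l}{\partial u}$ for all $(u,v)\in\mathbb{R}^+\times\mathbb{R}^+$; (vii) $\alpha<\min\{ap+bq-a,\ ap+bq-b,\ ar+bs-a,\ ar+bs-b\}$. Then $u$ and $v$ are axially symmetric about a line parallel to the $x_n$-axis: there exists $\bar x^0\in\mathbb{R}^{n-1}$ such that, writing $x=(\bar x,x_n)$ with $\bar x\in\mathbb{R}^{n-1}$, both $u(x)$ and $v(x)$ depend only on $|\bar x-\bar x^0|$ and $x_n$.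
   Context: $\mathbb{R}^n_+=\{x=(x_1,\dots,x_n)\in\mathbb{R}^n : x_n>0\}$ and $\mathbb{R}^+=(0,\infty)$. The fractional Laplacian is $$(-\Delta)^{\frac{\alpha}{2}}u(x)=C_{n,\alpha}\lim_{\epsilon\to0}\int_{\mathbb{R}^n\setminus B_\epsilon(x)}\frac{u(x)-u(y)}{|x-y|^{n+\alpha}}\,dy,$$ where $C_{n,\alpha}>0$ is the usual normalization constant. The nonlocal normal derivative is $$\mathcal{N}_{\frac{\alpha}{2}}u(x)=C_{n,\alpha}\int_{\mathbb{R}^n_+}\frac{u(x)-u(y)}{|x-y|^{n+\alpha}}\,dy,\qquad x\in\mathbb{R}^n\setminus\overline{\mathbb{R}^n_+}\ (\text{i.e. }x_n<0).$$ $L_\alpha=\left\{u:\mathbb{R}^n\to\mathbb{R} : \int_{\mathbb{R}^n}\frac{|u(x)|}{1+|x|^{n+\alpha}}dx<\infty\right\}$. A positive solution means $u>0$ and $v>0$ on $\mathbb{R}^n$; equations are understood pointwise. Partial derivatives of $f,g,h,l$ with respect to $u$ and $v$ denote derivatives in the first and second argument. *)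

(* Defs.v *)
From HB Require Import structures.
From mathcomp Require Import all_boot all_order all_algebra.
From mathcomp Require Import all_classical all_reals all_analysis.

Set Implicit Arguments.
Unset Strict Implicit.
Unset Printing Implicit Defensive.

Import Order.TTheory GRing.Theory Num.Theory.
Import numFieldNormedType.Exports.

Local Open Scope classical_set_scope.
Local Open Scope ring_scope.

(* The library equips n.-tuple with its product sigma-algebra but has no
   Lebesgue measure on R^n; it is built here by iterating the product measure. *)
Section lebesgue_tuple.
Variable R : realType.
Notation RR := (measurableTypeR R).

Definition tcons n (p : RR * n.-tuple RR) : n.+1.-tuple RR :=
  [the n.+1.-tuple RR of p.1 :: p.2].

Lemma measurable_tcons n : measurable_fun [set: RR * n.-tuple RR] (@tcons n).
Proof. exact: (measurable_cons measurable_fst measurable_snd). Qed.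

Definition tuncons n (t : n.+1.-tuple RR) : RR * n.-tuple RR :=
  (thead t, [tuple of behead t]).

Lemma tconsK n : cancel (@tcons n) (@tuncons n).
Proof. by case=> x t; congr pair; apply: val_inj. Qed.

Lemma measurable_tuncons n : measurable_fun [set: n.+1.-tuple RR] (@tuncons n).
Proof.
apply: measurable_fun_pair; first exact: measurable_tnth.
exact: measurable_behead.
Qed.

Section step.
Variables (n : nat) (m : {sigma_finite_measure set (n.-tuple RR) -> \bar R}).

Definition lebesgue_cons : set (n.+1.-tuple RR) -> \bar R :=
  pushforward (@lebesgue_measure R \x m)%E (@tcons n).

Let lebesgue_cons0 : lebesgue_cons set0 = 0%E.
Proof. by rewrite /lebesgue_cons /pushforward preimage_set0 measure0. Qed.

Let lebesgue_cons_ge0 A : (0 <= lebesgue_cons A)%E.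
Proof. by rewrite /lebesgue_cons /pushforward; exact: measure_ge0. Qed.

Let lebesgue_cons_sigma_additive : semi_sigma_additive lebesgue_cons.
Proof.
by apply: measure_semi_sigma_additive; exact: measurable_tcons.
Qed.

HB.instance Definition _ := isMeasure.Build _ _ _ lebesgue_cons
  lebesgue_cons0 lebesgue_cons_ge0 lebesgue_cons_sigma_additive.

(* The library's sigma-finite instance on m1 \x m2 is shadowed by the one for
   probabilities, so sigma-finiteness is proved by hand. *)
Lemma sigma_finite_lebesgue_cons : sigma_finite setT lebesgue_cons.
Proof.
have /sigma_finiteP[F [TF ndF Foo]] := sigma_finiteT (@lebesgue_measure R).
have /sigma_finiteP[G [TG ndG Goo]] := sigma_finiteT m.
exists (fun k => @tuncons n @^-1` (F k `*` G k)).
  rewrite -preimage_bigcup (_ : \bigcup_k _ = setT) ?preimage_setT//.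
  rewrite -setXTT TF TG predeqE => -[x y]; split.
    by move=> [k _ []]; split; exists k.
  move=> [/= [i _ Fix] [k _ Gky]]; exists (maxn i k) => //; split.
  - by move: x Fix; exact/subsetPset/ndF/leq_maxl.
  - by move: y Gky; exact/subsetPset/ndG/leq_maxr.
move=> k; have [mF Fk] := Foo k; have [mG Gk] := Goo k; split.
  rewrite -[X in measurable X]setTI; apply: measurable_tuncons => //.
  exact: measurableX.
rewrite /lebesgue_cons /pushforward -comp_preimage.
rewrite (_ : _ \o _ = id); last by apply/funext => p /=; rewrite tconsK.
by rewrite preimage_id product_measure1E// lte_mul_pinfty// ge0_fin_numE.
Qed.

HB.instance Definition _ := Measure_isSigmaFinite.Build _ _ _
  lebesgue_cons sigma_finite_lebesgue_cons.

End step.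

Fixpoint lebesgue_tuple n : {sigma_finite_measure set (n.-tuple RR) -> \bar R} :=
  if n is n'.+1 then lebesgue_cons (lebesgue_tuple n')
  else \d_([tuple] : 0.-tuple RR).

Lemma lebesgue_tuple_box n (A : 'I_n -> set RR) :
  (forall i, measurable (A i)) ->
  lebesgue_tuple n [set t | forall i, A i (tnth t i)] =
  (\prod_(i < n) @lebesgue_measure R (A i))%E.
Proof.
elim: n A => [|n IH] A mA.
  by rewrite big_ord0 /= diracE mem_set// => -[].
rewrite big_ord_recl -IH //= /lebesgue_cons /pushforward.
rewrite -product_measure1E //.
  congr (product_measure1 _ _ _); apply/seteqP; split => -[x t] /=.
    move=> H; split; first by have := H ord0.
    by move=> i; have /= := H (lift ord0 i); rewrite tnthS.
  by move=> [Hx Ht] i; have [j ->|->//] := unliftP ord0 i; rewrite tnthS.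
rewrite (_ : mkset _ = \bigcap_(i in [set: 'I_n])
    ((fun t : n.-tuple RR => tnth t i) @^-1` A (lift ord0 i))); last first.
  by apply/seteqP; split => t /= H i; [move=> _|]; exact: H.
apply: fin_bigcap_measurable => // i _.
by rewrite -[X in measurable X]setTI; exact: measurable_tnth.
Qed.

End lebesgue_tuple.

Section euclidean_space.
Variable R : realType.

(* The library norm on 'rV[R]_n is the sup norm; it induces the same topology
   and the same derivatives, but the kernels below need the Euclidean one. *)
Definition enorm n (x : 'rV[R]_n) : R := Num.sqrt (\sum_i x ord0 i ^+ 2).

Definition vec_of_tuple n (t : n.-tuple (measurableTypeR R)) : 'rV[R]_n :=
  \row_i tnth t i.

Definition integral_rV n (D : set 'rV[R]_n) (F : 'rV[R]_n -> \bar R) : \bar R :=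
  (\int[@lebesgue_tuple R n]_(t in @vec_of_tuple n @^-1` D) F (vec_of_tuple t))%E.

(* x = (xbar, x_n) in R^n x R; the dimension of the ambient space is n.+1. *)
Definition lastc n (x : 'rV[R]_n.+1) : R := x ord0 ord_max.
Definition xbar n (x : 'rV[R]_n.+1) : 'rV[R]_n := \row_i x ord0 (lift ord_max i).

Definition gradient n (u : 'rV[R]_n -> R) (x : 'rV[R]_n) : 'rV[R]_n :=
  \row_i 'D_(delta_mx ord0 i) u x.

(* Continuity of the gradient follows from the Hoelder bound, as theta > 0 in
   all uses. *)
Definition C1_loc_holder n (theta : R) (u : 'rV[R]_n -> R) : Prop :=
  (forall x : 'rV[R]_n, differentiable u x) /\
  (forall r : R, exists K : R, forall x y : 'rV[R]_n,
     enorm x <= r -> enorm y <= r ->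
     enorm (gradient u x - gradient u y) <= K * enorm (x - y) `^ theta).

Definition L_space n (alpha : R) (u : 'rV[R]_n -> R) : Prop :=
  measurable_fun setT (u \o @vec_of_tuple n) /\
  (integral_rV setT
     (fun x => (`|u x| / (1 + enorm x `^ (n%:R + alpha)))%:E) < +oo)%E.

Definition diff_kernel n (alpha : R) (u : 'rV[R]_n -> R) (x y : 'rV[R]_n) : R :=
  (u x - u y) / enorm (x - y) `^ (n%:R + alpha).

(* C_{n,alpha} is the inverse of the integral over R^n of
   (1 - cos z_1) / |z|^(n + alpha), for which the operator has Fourier symbol
   |xi|^alpha; the dimension is n.+1 so that z_1 makes sense. *)
Definition frac_const n (alpha : R) : R :=
  (fine (integral_rV setT (fun z : 'rV[R]_n.+1 =>
     ((1 - cos (z ord0 ord0)) / enorm z `^ (n.+1%:R + alpha))%:E)))^-1.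

(* (-Delta)^(alpha/2) u (x) = l: the principal value exists and equals l. *)
Definition frac_laplacian_eq n (alpha : R) (u : 'rV[R]_n.+1 -> R)
    (x : 'rV[R]_n.+1) (l : R) : Prop :=
  ((frac_const n alpha)%:E *
    integral_rV [set y | (eps <= enorm (x - y))%R]
      (fun y => (diff_kernel alpha u x y)%:E))%E @[eps --> 0^'+] --> l%:E.

Definition nonlocal_normal n (alpha : R) (u : 'rV[R]_n.+1 -> R)
    (x : 'rV[R]_n.+1) : \bar R :=
  ((frac_const n alpha)%:E *
    integral_rV [set y | (0 < lastc y)%R]
      (fun y => (diff_kernel alpha u x y)%:E))%E.

End euclidean_space.

Section plane_functions.
Variable R : realType.

Definition partial1 (f : R -> R -> R) (s t : R) : R := derive1 (f ^~ t) s.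
Definition partial2 (f : R -> R -> R) (s t : R) : R := derive1 (f s) t.

(* C^1([0,+oo) x [0,+oo)): C^1 in the open quadrant, f and its first partial
   derivatives extending continuously to the closed one.  Values of f off the
   closed quadrant are irrelevant. *)
Definition C1_quadrant (f : R -> R -> R) : Prop :=
  let Q : set (R * R) := [set z | 0 <= z.1 /\ 0 <= z.2] in
  {within Q, continuous (fun z : R * R => f z.1 z.2)} /\
  (forall s t : R, 0 < s -> 0 < t ->
     derivable (f ^~ t) s 1 /\ derivable (f s) t 1) /\
  (exists f1 f2 : R * R -> R,
     [/\ {within Q, continuous f1}, {within Q, continuous f2} &
      forall s t : R, 0 < s -> 0 < t ->
        f1 (s, t) = partial1 f s t /\ f2 (s, t) = partial2 f s t]).

Definition near_origin (P : R -> R -> Prop) : Prop :=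
  exists2 delta : R, 0 < delta &
    forall s t : R, 0 < s < delta -> 0 < t < delta -> P s t.

End plane_functions.

(* Main.v *)
Require Import Defs.
From HB Require Import structures.
From mathcomp Require Import all_boot all_order all_algebra.
From mathcomp Require Import all_classical all_reals all_analysis.
From mathcomp Require Import measurable_realfun ring lra.

(** The proof is the method of moving planes in a horizontal direction e.  With
    T the reflection in {x.e = lam}, U = u o T - u and V = v o T - v, a negative
    minimum of U on {x.e < lam} that dominates V up to a weight k < mu cannot lie
    in the lower half space (by the sign of the nonlocal normal derivative and
    h_u + mu h_v <= 0), and in the closed upper half space the antisymmetric
    maximum principle gives d^(-alpha) <~ k f_v + f_u at it, d being its distance
    to the plane.  Bounded partials keep d away from 0, their decay keeps the
    minimum in a bounded set, so no Hopf lemma or narrow region principle is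
    needed to start or to continue the procedure.  The equation is not available
    on {x_n = 0}; minima there are handled by evaluating it at x + delta e_n,
    where the singular part of the integral is small by C^{1,theta} regularity.
    Invariance of Lebesgue measure under reflections follows from translation
    invariance and Fubini.  Finally the planes for the coordinate directions
    determine a centre, all other planes pass through it since otherwise u would
    be periodic. *)

Set Implicit Arguments.
Unset Strict Implicit.
Unset Printing Implicit Defensive.

Import Order.TTheory GRing.Theory Num.Theory.
Import numFieldNormedType.Exports.

Local Open Scope classical_set_scope.
Local Open Scope ring_scope.

(** * Euclidean norm *)

(** The maximum principle used here carries a rate. At a minimum m <= 0 of U, pairing each y with
    its mirror image leaves 2 m times the kernel seen across the plane, minus a nonnegative term. A
    cube of size comparable to d, at distance comparable to d beyond the plane, already has kernel
    mass of order d^(-alpha). If the partials of f are at most A and B, dividing by the negative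
    minimum gives c <= (A + k B) d^alpha, an inequality in which the size of the minimum no longer
    occurs. It fails for small d when A and B are bounded. Far out, d <= 2 |x| while hypothesis
    (vii) bounds A and B by a power of |x| strictly below -alpha, so it fails there too. Both bounds
    are uniform over all planes with lam <= Lam. The coupling dictates the weight. If V is below k U
    at the minimum of U, one passes to the minimum of V, where U >= V / k holds instead. Each of the
    two minima has to be excluded from the lower half space by its own boundary condition, which
    asks for k < mu and 1 / k < nu; such a k exists exactly when mu nu > 1. *)

Section euclidean_norm.
Variables (R : realType) (n : nat).
Implicit Types x y z : 'rV[R]_n.

Definition dot x y : R := \sum_i x ord0 i * y ord0 i.

Lemma dotC x y : dot x y = dot y x.
Proof. by apply: eq_bigr => i _; rewrite mulrC. Qed.

Lemma dotDl x y z : dot (x + y) z = dot x z + dot y z.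
Proof. by rewrite -big_split; apply: eq_bigr => i _ /=; rewrite mxE mulrDl. Qed.

Lemma dotZl (a : R) x y : dot (a *: x) y = a * dot x y.
Proof. by rewrite mulr_sumr; apply: eq_bigr => i _ /=; rewrite mxE mulrA. Qed.

Lemma dotNl x y : dot (- x) y = - dot x y.
Proof. by rewrite -scaleN1r dotZl mulN1r. Qed.

Lemma dotDr x y z : dot x (y + z) = dot x y + dot x z.
Proof. by rewrite dotC dotDl !(dotC x). Qed.

Lemma dotZr (a : R) x y : dot x (a *: y) = a * dot x y.
Proof. by rewrite dotC dotZl dotC. Qed.

Lemma dotNr x y : dot x (- y) = - dot x y.
Proof. by rewrite dotC dotNl dotC. Qed.

Lemma dot0l x : dot 0 x = 0.
Proof. by rewrite -(scale0r x) dotZl mul0r. Qed.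

Lemma dotxx_ge0 x : 0 <= dot x x.
Proof. by apply: sumr_ge0 => i _; rewrite -expr2 sqr_ge0. Qed.

Lemma enorm_ge0 x : 0 <= enorm x.
Proof. exact: sqrtr_ge0. Qed.

Lemma enorm_sqr x : enorm x ^+ 2 = dot x x.
Proof.
rewrite /enorm sqr_sqrtr; first by apply: eq_bigr => i _; rewrite expr2.
by apply: sumr_ge0 => i _; exact: sqr_ge0.
Qed.

Lemma dotxx_eq0 x : dot x x = 0 -> x = 0.
Proof.
move=> /eqP; rewrite psumr_eq0; last by move=> i _; rewrite -expr2 sqr_ge0.
move=> /allP x0; apply/rowP => i; rewrite mxE.
have /(_ _) := x0 i; rewrite mem_index_enum => /(_ isT) /=.
by rewrite -expr2 sqrf_eq0 => /eqP.
Qed.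

Lemma enorm0 : enorm (0 : 'rV[R]_n) = 0.
Proof. by apply/eqP; rewrite -sqrf_eq0 enorm_sqr dot0l. Qed.

Lemma enorm_eq0 x : enorm x = 0 -> x = 0.
Proof. by move=> x0; apply: dotxx_eq0; rewrite -enorm_sqr x0 expr0n. Qed.

Lemma enorm_gt0 x : x != 0 -> 0 < enorm x.
Proof.
by move=> x0; rewrite lt_neqAle enorm_ge0 andbT eq_sym; apply: contra_neq x0 => /enorm_eq0.
Qed.

Lemma eq_enorm x y : dot x x = dot y y -> enorm x = enorm y.
Proof.
by move=> xy; apply/eqP; rewrite -(eqrXn2 (n := 2)) ?enorm_ge0 // !enorm_sqr xy.
Qed.

Lemma enormN x : enorm (- x) = enorm x.
Proof. by apply: eq_enorm; rewrite dotNl dotNr opprK. Qed.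

Lemma enormB x y : enorm (x - y) = enorm (y - x).
Proof. by rewrite -enormN opprB. Qed.

Lemma enormZ (a : R) x : enorm (a *: x) = `|a| * enorm x.
Proof.
apply/eqP; rewrite -(eqrXn2 (n := 2)) ?mulr_ge0 ?enorm_ge0 //.
by rewrite exprMn !enorm_sqr dotZl dotZr mulrA -expr2 real_normK // num_real.
Qed.

(** Cauchy-Schwarz, from the nonnegative square of |y| x - |x| y. *)
Lemma dot_le x y : dot x y <= enorm x * enorm y.
Proof.
have [x0|x0] := eqVneq x 0; first by rewrite x0 dot0l enorm0 mul0r.
have [y0|y0] := eqVneq y 0; first by rewrite y0 dotC dot0l enorm0 mulr0.
have a0 := enorm_gt0 x0; have b0 := enorm_gt0 y0.
have := dotxx_ge0 (enorm y *: x - enorm x *: y).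
rewrite !(dotDl, dotDr, dotNl, dotNr, dotZl, dotZr) -!enorm_sqr (dotC y x) => h.
rewrite -(ler_pM2l (mulr_gt0 a0 b0)); nra.
Qed.

Lemma normr_dot_le x y : `|dot x y| <= enorm x * enorm y.
Proof.
rewrite ler_norml dot_le andbT lerNl.
by rewrite -dotNl (le_trans (dot_le _ _)) // enormN.
Qed.

Lemma enormD x y : enorm (x + y) <= enorm x + enorm y.
Proof.
rewrite -(@ler_pXn2r _ 2) // ?nnegrE ?addr_ge0 ?enorm_ge0 //.
rewrite sqrrD !enorm_sqr !(dotDl, dotDr) (dotC y x).
by have := dot_le x y; lra.
Qed.

Lemma enorm_triB x y z : enorm (x - z) <= enorm (x - y) + enorm (y - z).
Proof. by rewrite (le_trans _ (enormD _ _)) // addrA subrK. Qed.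

Lemma ler_enormB x y : enorm x - enorm y <= enorm (x - y).
Proof. by rewrite lerBlDr (le_trans _ (enormD _ _)) // subrK. Qed.

Lemma coord_le_enorm x i : `|x ord0 i| <= enorm x.
Proof.
rewrite -(@ler_pXn2r _ 2) // ?nnegrE ?normr_ge0 ?enorm_ge0 // real_normK ?num_real //.
rewrite enorm_sqr /dot (bigD1 i) //= -expr2 lerDl.
by apply: sumr_ge0 => j _; rewrite -expr2 sqr_ge0.
Qed.

Lemma enorm_le_coord x r : (forall i, `|x ord0 i| <= r) -> enorm x <= n%:R * r.
Proof.
move=> xr; have [n0|n0] := posnP n.
  have -> : x = 0 by apply/rowP => i; have := leq_trans (ltn_ord i) (eq_leq n0).
  by rewrite enorm0 n0 mul0r.
have r0 : 0 <= r by apply: le_trans (xr (Ordinal n0)).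
rewrite -(@ler_pXn2r _ 2) // ?nnegrE ?mulr_ge0 ?enorm_ge0 //.
rewrite enorm_sqr exprMn.
have -> : n%:R ^+ 2 * r ^+ 2 = \sum_(i < n) (n%:R * r ^+ 2).
  by rewrite sumr_const card_ord -(mulr_natl (_ * _) n) mulrA expr2.
apply: ler_sum => i _; rewrite -expr2 -real_normK ?num_real //.
rewrite (le_trans (lerXn2r 2 _ _ (xr i))) ?nnegrE //.
by rewrite ler_peMl ?sqr_ge0 // ler1n.
Qed.

Lemma mx_norm_le_enorm x : `|x| <= enorm x.
Proof.
rewrite [`|x|]mx_normrE; apply: bigmax_le; first exact: enorm_ge0.
by move=> [i j] _ /=; rewrite (ord1 i) coord_le_enorm.
Qed.

Lemma enorm_le_mx_norm x : enorm x <= n%:R * `|x|.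
Proof.
apply: enorm_le_coord => i; rewrite [`|x|]mx_normrE.
exact: (le_bigmax _ (fun ij : 'I_1 * 'I_n => `|x ij.1 ij.2|) (ord0, i)).
Qed.

End euclidean_norm.

(** * Lebesgue measure on R^n *)

Section image_measure.
Context d d' (T1 : measurableType d) (T2 : measurableType d') (R : realType).
Variables (m : {measure set T1 -> \bar R}) (phi : T1 -> T2).
Hypothesis mphi : measurable_fun [set: T1] phi.

(** The proof of measurability is an argument, so that the measure structure declared below can be
    inferred from the term alone. *)
Definition image_measure of measurable_fun [set: T1] phi : set T2 -> \bar R :=
  pushforward m phi.
Local Notation im := (image_measure mphi).

Let im0 : im set0 = 0%E.
Proof. by rewrite /image_measure /pushforward preimage_set0 measure0. Qed.

Let im_ge0 A : (0 <= im A)%E.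
Proof. by rewrite /image_measure /pushforward; exact: measure_ge0. Qed.

Let im_sigma_additive : semi_sigma_additive im.
Proof. by apply: measure_semi_sigma_additive; exact: mphi. Qed.

HB.instance Definition _ := isMeasure.Build _ _ _ im im0 im_ge0 im_sigma_additive.
End image_measure.

(** * Translation invariance of Lebesgue measure *)

Section translation.
Variable R : realType.
Notation RR := (measurableTypeR R).
Notation leb := (@lebesgue_measure R).

(** The translated measure gives half-open intervals their length, which characterises Lebesgue
    measure. *)
Lemma lebesgue_measure_translate (b : R) (A : set RR) : measurable A ->
  leb ((fun x : RR => x + b) @^-1` A) = leb A.
Proof.
have mf : measurable_fun [set: RR] (fun x : RR => x + b : RR).
  exact: measurable_funD.
move=> mA; symmetry.
apply: (@lebesgue_measure_unique R (image_measure leb mf)) => //.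
move=> _ [[x y] _ <-] /=; rewrite /image_measure /pushforward.
rewrite (_ : _ @^-1` _ = [set` `]x - b, y - b]]); last first.
  by apply/seteqP; split => z /=; rewrite !in_itv /= ltrBlDr lerBrDr.
rewrite !lebesgue_measure_itv /= !lte_fin ltrD2r; case: ifPn => // _.
by rewrite -!EFinB; congr EFin; ring.
Qed.

Definition tshift n (b t : n.-tuple RR) : n.-tuple RR :=
  [tuple (tnth t i + tnth b i : RR) | i < n].

Lemma measurable_tshift n (b : n.-tuple RR) : measurable_fun setT (tshift b).
Proof.
apply/measurable_fun_tnthP => i.
rewrite (_ : _ \o _ = fun t => tnth t i + tnth b i : RR); last first.
  by apply/funext => t /=; rewrite tnth_mktuple.
apply: measurable_funD => //; exact: measurable_tnth.
Qed.

(** Induction on the dimension: seen through [tcons] the shift acts separately on the two factors,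
    so the image measure agrees with the product measure on rectangles. *)
Lemma lebesgue_tuple_translate n (b : n.-tuple RR) (A : set (n.-tuple RR)) :
  measurable A -> lebesgue_tuple R n (tshift b @^-1` A) = lebesgue_tuple R n A.
Proof.
elim: n b A => [|n IH] b A mA.
  rewrite (_ : tshift b = id) // funeqE => t.
  by rewrite (tuple0 t) [LHS]tuple0.
case/tupleP: b => b0 b.
rewrite /= /lebesgue_cons /pushforward.
pose sg (p : RR * n.-tuple RR) : RR * n.-tuple RR := (p.1 + b0, tshift b p.2).
have msg : measurable_fun setT sg.
  apply: measurable_fun_pair.
    by apply: measurable_funD => //.
  exact: (measurableT_comp (measurable_tshift b)).
have mB : measurable (@tcons R n @^-1` A).
  by rewrite -[X in measurable X]setTI; exact: measurable_tcons.
rewrite (_ : @tcons R n @^-1` _ = sg @^-1` (@tcons R n @^-1` A)); last first.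
  rewrite -[LHS]comp_preimage -[RHS]comp_preimage.
  congr (_ @^-1` A); apply/funext => -[x t] /=.
  apply: eq_from_tnth => i; rewrite tnth_mktuple.
  have [j ->|->] := unliftP ord0 i; last by rewrite /tcons !tnth0.
  by rewrite /tcons !tnthS tnth_mktuple.
symmetry.
pose im : {measure set _ -> \bar R} := image_measure (leb \x lebesgue_tuple R n)%E msg.
apply: (product_measure_unique _ (m' := im)) => // B C mB' mC.
rewrite /im /= /image_measure /pushforward.
rewrite (_ : sg @^-1` _ = ((fun x : RR => x + b0) @^-1` B) `*` (tshift b @^-1` C)) //.
have mf : measurable_fun [set: RR] (fun x : RR => x + b0 : RR).
  exact: measurable_funD.
rewrite product_measure1E ?IH //.
- by congr (_ * _)%E; exact: lebesgue_measure_translate.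
- by rewrite -[X in measurable X]setTI; exact: mf.
- by rewrite -[X in measurable X]setTI; exact: measurable_tshift.
Qed.

Lemma ge0_integral_tshift n (b : n.-tuple RR) (F : n.-tuple RR -> \bar R) :
  measurable_fun setT F -> (forall t, 0 <= F t)%E ->
  (\int[lebesgue_tuple R n]_t F (tshift b t) = \int[lebesgue_tuple R n]_t F t)%E.
Proof.
move=> mF F0.
have := @ge0_integral_pushforward _ _ _ _ _ _ (measurable_tshift b) (lebesgue_tuple R n) setT F measurableT mF.
rewrite preimage_setT => <-; last by move=> t _; exact: F0.
pose im : {measure set _ -> \bar R} :=
  image_measure (lebesgue_tuple R n) (measurable_tshift b).
apply: (eq_measure_integral (lebesgue_tuple R n) (m1 := im)) => A mA _.
by rewrite /im /= /image_measure /pushforward lebesgue_tuple_translate.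
Qed.

End translation.

Section measurability.
Variables (R : realType) (n : nat).
Notation RR := (measurableTypeR R).
Notation vec := (@vec_of_tuple R n).
Notation mu := (lebesgue_tuple R n).

Definition tuple_of_vec (x : 'rV[R]_n) : n.-tuple RR := [tuple x ord0 i : RR | i < n].

Lemma tuple_of_vecK : cancel tuple_of_vec vec.
Proof. by move=> x; apply/rowP => i; rewrite mxE tnth_mktuple. Qed.

(** The measure lives on tuples, so measurability of a map into row vectors is expressed
    coordinatewise. *)
Definition mfun_rV d (T : measurableType d) (L : T -> 'rV[R]_n) :=
  forall i, measurable_fun setT (fun t => L t ord0 i : RR).

Lemma mfun_vec : mfun_rV vec.
Proof.
move=> i; rewrite (_ : (fun t => _) = (fun t => tnth t i : RR)); last first.
  by apply/funext => t; rewrite mxE.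
exact: measurable_tnth.
Qed.

Section constructions.
Context d (T : measurableType d).
Implicit Types L M : T -> 'rV[R]_n.

Lemma mfun_rVD L M : mfun_rV L -> mfun_rV M -> mfun_rV (fun t => L t + M t).
Proof.
move=> mL mM i; rewrite (_ : (fun t => _) = (fun t => L t ord0 i : RR) \+ (fun t => M t ord0 i : RR)).
  exact: measurable_funD (mL i) (mM i).
by apply/funext => t; rewrite mxE.
Qed.

Lemma mfun_rVN L : mfun_rV L -> mfun_rV (fun t => - L t).
Proof.
move=> mL i; rewrite (_ : (fun t => _) = \- (fun t => L t ord0 i : RR)).
  exact: measurable_funN (mL i).
by apply/funext => t; rewrite mxE.
Qed.

Lemma mfun_rVB L M : mfun_rV L -> mfun_rV M -> mfun_rV (fun t => L t - M t).
Proof. by move=> mL mM; apply: mfun_rVD => //; exact: mfun_rVN. Qed.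

Lemma mfun_rV_cst x : mfun_rV (fun _ : T => x).
Proof. by move=> i; exact: measurable_cst. Qed.

Lemma mfun_rVZ (a : T -> RR) L :
  measurable_fun setT a -> mfun_rV L -> mfun_rV (fun t => a t *: L t).
Proof.
move=> ma mL i; rewrite (_ : (fun t => _) = a \* (fun t => L t ord0 i : RR)).
  exact: measurable_funM ma (mL i).
by apply/funext => t; rewrite mxE.
Qed.

Lemma measurable_dot L M : mfun_rV L -> mfun_rV M ->
  measurable_fun setT (fun t => dot (L t) (M t) : RR).
Proof.
by move=> mL mM; apply: measurable_sum => i; exact: measurable_funM (mL i) (mM i).
Qed.

Lemma measurable_enorm L : mfun_rV L -> measurable_fun setT (fun t => enorm (L t) : RR).
Proof.
move=> mL; rewrite (_ : (fun t => _) = (fun t => (dot (L t) (L t)) `^ 2^-1 : RR)).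
  by apply: (measurableT_comp (measurable_powR _)); exact: measurable_dot.
by apply/funext => t; rewrite powR12_sqrt ?dotxx_ge0 // /enorm; congr Num.sqrt;
  apply: eq_bigr => i _; rewrite expr2.
Qed.

Lemma measurable_tuple_of_vec L : mfun_rV L -> measurable_fun setT (tuple_of_vec \o L).
Proof.
move=> mL; apply/measurable_fun_tnthP => i.
rewrite (_ : _ \o _ = fun t => L t ord0 i : RR) //.
by apply/funext => t /=; rewrite tnth_mktuple.
Qed.

Lemma measurable_nat_of_bool (b : T -> bool) :
  measurable_fun setT b -> measurable_fun setT (fun t => (b t)%:R : RR).
Proof.
move=> mb; rewrite (_ : (fun t => _) = fun t => if b t then 1 : RR else 0).
  by apply: measurable_fun_ifT => //; exact: measurable_cst.
by apply/funext => t; case: (b t).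
Qed.

End constructions.

Definition mfun_on (F : 'rV[R]_n -> R) := measurable_fun [set: n.-tuple RR] (F \o vec).

Lemma mfun_on_comp d (T : measurableType d) (F : 'rV[R]_n -> R) (L : T -> 'rV[R]_n) :
  mfun_on F -> mfun_rV L -> measurable_fun setT (fun t => F (L t) : RR).
Proof.
move=> mF mL; rewrite (_ : (fun t => _) = (F \o vec) \o (tuple_of_vec \o L)).
  exact: measurableT_comp mF (measurable_tuple_of_vec mL).
by apply/funext => t /=; rewrite tuple_of_vecK.
Qed.

Lemma lebesgue_tuple_cube (c : 'rV[R]_n) (r : R) : 0 <= r ->
  mu [set t | forall i, `|vec t ord0 i - c ord0 i| <= r] = ((2 * r) ^+ n)%:E.
Proof.
move=> r0; rewrite (_ : [set t | _] = [set t : n.-tuple RR | forall i,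
    [set` `[c ord0 i - r, c ord0 i + r]] (tnth t i)]); last first.
  by apply/seteqP; split => t /= H i; have := H i; rewrite mxE /= in_itv /= ler_distl.
rewrite (@lebesgue_tuple_box R n (fun i => [set` `[c ord0 i - r, c ord0 i + r]])) //.
under eq_bigr => i _.
  rewrite lebesgue_measure_itv /= lte_fin.
  have -> : (if c ord0 i - r < c ord0 i + r then
     ((c ord0 i + r)%:E - (c ord0 i - r)%:E)%E else 0%E) = (2 * r)%:E.
    case: ifPn => [_|]; first by rewrite -EFinB; congr EFin; ring.
    by rewrite -leNgt => h; congr EFin; lra.
  over.
by rewrite prodEFin prodr_const card_ord.
Qed.

Lemma measurable_cube (c : 'rV[R]_n) (r : R) :
  measurable [set t : n.-tuple RR | forall i, `|vec t ord0 i - c ord0 i| <= r].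
Proof.
rewrite (_ : mkset _ = \bigcap_(i in [set: 'I_n])
    ((fun t : n.-tuple RR => vec t ord0 i - c ord0 i) @^-1` [set` `[-r, r]])); last first.
  apply/seteqP; split => t /= H i.
    by move=> _; rewrite /= in_itv /= -ler_norml; exact: H.
  by have := H i I; rewrite /= in_itv /= -ler_norml.
apply: fin_bigcap_measurable => // i _.
rewrite -[X in measurable X]setTI.
by apply: (measurable_funB (mfun_vec i) (measurable_cst _)).
Qed.

End measurability.

(** * Invariance of Lebesgue measure under additive isometric involutions *)

Section isometry_invariance.
Variables (R : realType) (n : nat).
Notation RR := (measurableTypeR R).
Notation vec := (@vec_of_tuple R n).
Notation mu := (lebesgue_tuple R n).
Notation tov := (@tuple_of_vec R n).

Lemma tshiftE (b t : n.-tuple RR) : tshift b t = tov (vec t + vec b).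
Proof. by apply: eq_from_tnth => i; rewrite !tnth_mktuple !mxE. Qed.

Variable L : 'rV[R]_n -> 'rV[R]_n.
Hypothesis LD : {morph L : x y / x + y}.
Hypothesis LK : involutive L.
Hypothesis Lnorm : forall x, enorm (L x) = enorm x.
Hypothesis mL : mfun_rV (L \o vec).

Let Lt (t : n.-tuple RR) : n.-tuple RR := tov (L (vec t)).
Let mLt : measurable_fun setT Lt.
Proof. exact: measurable_tuple_of_vec. Qed.

Lemma mfun_rV_isom d (T : measurableType d) (M : T -> 'rV[R]_n) :
  mfun_rV M -> mfun_rV (fun t => L (M t)).
Proof.
move=> mM i; rewrite (_ : (fun t => _) = (fun t => (L \o vec) t ord0 i : RR) \o (tov \o M)).
  exact: measurableT_comp (mL i) (measurable_tuple_of_vec mM).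
by apply/funext => t /=; rewrite tuple_of_vecK.
Qed.

Let B (x : 'rV[R]_n) : \bar R := ((enorm x <= 1)%R%:R)%:E.

Let B0 x : (0 <= B x)%E.
Proof. by rewrite /B lee_fin. Qed.

Let mB d (T : measurableType d) (M : T -> 'rV[R]_n) :
  mfun_rV M -> measurable_fun setT (fun t => B (M t)).
Proof.
move=> mM; apply/measurable_EFinP/measurable_nat_of_bool.
by apply: measurable_fun_ler; [exact: measurable_enorm | exact: measurable_cst].
Qed.

Let intB_fin : (\int[mu]_t B (vec t) < +oo)%E.
Proof.
apply: (@le_lt_trans _ _ (\int[mu]_t (\1_[set t : n.-tuple RR | forall i, `|vec t ord0 i - (0 : 'rV[R]_n) ord0 i| <= 1] t)%:E)%E).
  apply: ge0_le_integral => //.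
  - exact: mB (@mfun_vec R n).
  - by apply/measurable_EFinP/measurable_indic; exact: measurable_cube.
  - move=> t _; rewrite /B lee_fin indicE ler_nat; case: leP => // h.
    rewrite lt0b mem_set //= => i; rewrite [X in _ - X]mxE subr0.
    exact: le_trans (coord_le_enorm _ _) h.
rewrite integral_indic ?setIT //; last exact: measurable_cube.
by rewrite [X in (X < _)%E](lebesgue_tuple_cube (0 : 'rV[R]_n) ler01) ltry.
Qed.

(** The mass of the unit ball will be cancelled from an equation, so it has to be positive and
    finite; a cube inside the ball and a cube around it suffice. *)
Let intB_gt0 : (0 < \int[mu]_t B (vec t))%E.
Proof.
pose r : R := n.+1%:R^-1.
have r0 : 0 < r by rewrite invr_gt0.
apply: (@lt_le_trans _ _ (\int[mu]_t (\1_[set t : n.-tuple RR | forall i, `|vec t ord0 i - (0 : 'rV[R]_n) ord0 i| <= r] t)%:E)%E).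
  rewrite integral_indic ?setIT //; last exact: measurable_cube.
  rewrite [X in (_ < X)%E](lebesgue_tuple_cube (0 : 'rV[R]_n) (ltW r0)).
  by rewrite lte_fin; apply: exprn_gt0; exact: mulr_gt0.
apply: ge0_le_integral => //.
- by apply/measurable_EFinP/measurable_indic; exact: measurable_cube.
- exact: mB (@mfun_vec R n).
- move=> t _; rewrite /B lee_fin indicE ler_nat.
  case: (boolP (t \in _)) => //; rewrite inE /= => h.
  rewrite lt0b (le_trans (enorm_le_coord (r := r) _)) //.
    by move=> i; have := h i; rewrite [X in _ - X]mxE subr0.
  by rewrite /r ler_pdivrMr // mul1r ler_nat.
Qed.

Let shiftE (f : n.-tuple RR -> \bar R) (b : 'rV[R]_n) :
  measurable_fun setT f -> (forall t, 0 <= f t)%E ->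
  (\int[mu]_t f (tov (vec t + b)) = \int[mu]_t f t)%E.
Proof.
move=> mf f0; rewrite -(ge0_integral_tshift (tov b) mf f0).
by apply: eq_integral => t _; rewrite tshiftE tuple_of_vecK.
Qed.

(* Both sides are compared with an iterated integral over mu x mu; translation
   invariance and Fubini move L from f to the ball indicator B, which L fixes. *)
Lemma ge0_integral_isom (f : n.-tuple RR -> \bar R) :
  measurable_fun setT f -> (forall t, 0 <= f t)%E ->
  (\int[mu]_t f (tov (L (vec t))) = \int[mu]_t f t)%E.
Proof.
move=> mf f0.
have LN x : L (- x) = - L x.
  have L0 : L 0 = 0 by have /eqP := LD 0 0; rewrite addr0 addrC -subr_eq subrr eq_sym => /eqP.
  by apply/eqP; rewrite -subr_eq0 opprK -LD addNr L0.
have mvL : mfun_rV (fun t => L (vec t)) := mL.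
have mp1 : mfun_rV (fun p : n.-tuple RR * n.-tuple RR => vec p.1).
  by move=> i; exact: (measurableT_comp (@mfun_vec R n i) measurable_fst).
have mp2 : mfun_rV (fun p : n.-tuple RR * n.-tuple RR => vec p.2).
  by move=> i; exact: (measurableT_comp (@mfun_vec R n i) measurable_snd).
pose H1 (p : n.-tuple RR * n.-tuple RR) := (f (tov (L (vec p.1) + vec p.2)) * B (vec p.2))%E.
pose H2 (p : n.-tuple RR * n.-tuple RR) := (f p.2 * B (vec p.2 - L (vec p.1)))%E.
have mH1 : measurable_fun setT H1.
  apply: emeasurable_funM; last exact: mB.
  apply: (measurableT_comp mf (measurable_tuple_of_vec _)).
  by apply: mfun_rVD => //; exact: mfun_rV_isom.
have mH2 : measurable_fun setT H2.
  apply: emeasurable_funM; first exact: (measurableT_comp mf).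
  by apply: mB; apply: mfun_rVB => //; exact: mfun_rV_isom.
have H10 p : (0 <= H1 p)%E by rewrite mule_ge0.
have H20 p : (0 <= H2 p)%E by rewrite mule_ge0.
have mfL : measurable_fun setT (fun t => f (tov (L (vec t)))) by exact: (measurableT_comp mf mLt).
have mBv : measurable_fun setT (fun t => B (vec t)) by apply: mB; exact: mfun_vec.
have E : (\int[mu]_t f (tov (L (vec t))) * \int[mu]_t B (vec t) =
          \int[mu]_t f t * \int[mu]_t B (vec t))%E.
  transitivity (\int[mu]_y \int[mu]_x H1 (x, y))%E.
    rewrite -ge0_integralZl //; last exact: integral_ge0.
    apply: eq_integral => y _; rewrite /H1 /= ge0_integralZr //; last first.
      apply: (measurableT_comp mf (measurable_tuple_of_vec _)).
      by apply: mfun_rVD => //; exact: mfun_rV_cst.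
    congr (_ * _)%E.
    rewrite -(shiftE (L (vec y)) mfL); last by [].
    by apply: eq_integral => x _; rewrite tuple_of_vecK LD LK.
  rewrite -(fubini_tonelli H1) //.
  transitivity (\int[mu]_x \int[mu]_y H2 (x, y))%E.
    apply: eq_integral => x _.
    have mH2x : measurable_fun setT (fun y => H2 (x, y)).
      exact: (measurableT_comp mH2 (measurable_pair1 x)).
    rewrite -(shiftE (L (vec x)) mH2x (fun y => H20 (x, y))).
    apply: eq_integral => y _; rewrite /H1 /H2 /= tuple_of_vecK.
    by rewrite addrK addrC.
  rewrite (fubini_tonelli H2) // -ge0_integralZr //; last exact: integral_ge0.
  apply: eq_integral => y _.
  have mg : measurable_fun setT (fun x => B (vec y - L (vec x))).
    by apply: mB; apply: mfun_rVB => //; exact: mfun_rV_cst.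
  transitivity (f y * \int[mu]_x B (vec y - L (vec x)))%E.
    rewrite /H2 /=; apply: ge0_integralZl; [exact: measurableT|exact: mg| |exact: f0].
    by move=> x _; exact: B0.
  congr (_ * _)%E.
  (* Replacing x by x + L y turns y - L x into - L x, which has the norm of x; the inner integral is
     therefore the mass of the ball, whatever y is. *)
  rewrite -(shiftE (L (vec y)) mg); last by [].
  apply: eq_integral => x _; rewrite tuple_of_vecK LD LK opprD addrCA subrr addr0.
  by rewrite /B enormN Lnorm.
have Bfin : (\int[mu]_t B (vec t))%E \is a fin_num by rewrite ge0_fin_numE // ltW.
move: E intB_gt0; rewrite -(fineK Bfin) lte_fin => E b0.
have b0' : (fine (\int[mu]_t B (vec t)))%:E != 0%E by rewrite eqe gt_eqF.
move: E => /(congr1 (fun z => z * (fine (\int[mu]_t B (vec t)))^-1%:E)%E).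
by rewrite -!muleA -EFinM divff ?mule1 // gt_eqF.
Qed.

End isometry_invariance.

(** * Real-valued integrals on R^n *)

Section integral_rV_theory.
Variables (R : realType) (n : nat).
Notation RR := (measurableTypeR R).
Notation vec := (@vec_of_tuple R n).
Notation mu := (lebesgue_tuple R n).
Implicit Types F G : 'rV[R]_n -> R.

(* A record rather than a definition, so that unification never unfolds the integral. *)
Record integrable_rV F : Prop := IntegrableRV {
  integrable_rV_tuple : mu.-integrable setT (EFin \o (F \o vec)) }.
Definition int_rV F : R := \int[mu]_t F (vec t).

Lemma integrable_rV_mfun F : integrable_rV F -> mfun_on F.
Proof. by move=> [] /measurable_int /measurable_EFinP. Qed.

Lemma integrable_rV_le F G : mfun_on F -> integrable_rV G ->
  (forall x, `|F x| <= G x) -> integrable_rV F.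
Proof.
move=> mF [iG] FG; constructor; apply: (le_integrable _ _ _ iG) => //.
  exact/measurable_EFinP.
by move=> t _ /=; rewrite lee_fin (le_trans (FG _)) // ler_norm.
Qed.

Lemma integrable_rVD F G : integrable_rV F -> integrable_rV G ->
  integrable_rV (fun x => F x + G x).
Proof. by move=> [iF] [iG]; constructor; apply: (integrableD _ iF iG). Qed.

Lemma integrable_rVZ (k : R) F : integrable_rV F -> integrable_rV (fun x => k * F x).
Proof. by move=> [iF]; constructor; apply: (integrableZl _ k iF). Qed.

Lemma integrable_rVB F G : integrable_rV F -> integrable_rV G ->
  integrable_rV (fun x => F x - G x).
Proof. by move=> [iF] [iG]; constructor; apply: (integrableB _ iF iG). Qed.

Lemma int_rVD F G : integrable_rV F -> integrable_rV G ->
  int_rV (fun x => F x + G x) = int_rV F + int_rV G.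
Proof. by move=> [iF] [iG]; rewrite /int_rV RintegralD. Qed.

Lemma int_rVB F G : integrable_rV F -> integrable_rV G ->
  int_rV (fun x => F x - G x) = int_rV F - int_rV G.
Proof. by move=> [iF] [iG]; rewrite /int_rV RintegralB. Qed.

Lemma int_rVZ (k : R) F : integrable_rV F -> int_rV (fun x => k * F x) = k * int_rV F.
Proof. by move=> [iF]; rewrite /int_rV RintegralZl. Qed.

Lemma le_int_rV F G : integrable_rV F -> integrable_rV G ->
  (forall x, F x <= G x) -> int_rV F <= int_rV G.
Proof. by move=> [iF] [iG] FG; apply: le_Rintegral. Qed.

Lemma int_rV_ge0 F : (forall x, 0 <= F x) -> 0 <= int_rV F.
Proof. by move=> F0; apply: Rintegral_ge0. Qed.

Lemma norm_int_rV_le F G : integrable_rV F -> integrable_rV G ->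
  (forall x, `|F x| <= G x) -> `|int_rV F| <= int_rV G.
Proof.
move=> iF iG FG; rewrite ler_norml; apply/andP; split; last first.
  by apply: le_int_rV => // x; exact: le_trans (ler_norm _) (FG x).
rewrite -mulN1r -int_rVZ //; apply: le_int_rV => //; first exact: integrable_rVZ.
by move=> x; rewrite mulN1r; have := FG x; rewrite ler_norml => /andP[].
Qed.

Lemma int_rVE F : integrable_rV F ->
  (\int[mu]_t (F (vec t))%:E)%E = (int_rV F)%:E.
Proof. by move=> [iF]; rewrite /int_rV /Rintegral fineK //; exact: integrable_fin_num iF. Qed.

(** The bridge from the extended-valued integrals over subsets, in which the operators are defined,
    to real integrals over the whole space. *)
Lemma integral_rV_indic (D : set 'rV[R]_n) F G :
  (forall x, D x -> G x = F x) -> (forall x, ~ D x -> G x = 0) -> integrable_rV G ->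
  integral_rV D (fun x => (F x)%:E) = (int_rV G)%:E.
Proof.
move=> GF G0 iG; rewrite -int_rVE // /integral_rV integral_mkcond.
apply: eq_integral => t _; rewrite patchE; case: ifPn.
  by rewrite inE /= => /GF ->.
by rewrite notin_setE /= => /G0 ->.
Qed.

Definition cube (c : 'rV[R]_n) (r : R) (x : 'rV[R]_n) : bool :=
  `[< forall i, `|x ord0 i - c ord0 i| <= r >].

Lemma cubeE c r : (fun x => (cube c r x)%:R) \o vec =
  \1_[set t : n.-tuple RR | forall i, `|vec t ord0 i - c ord0 i| <= r] :> (_ -> R).
Proof.
apply/funext => t /=; rewrite indicE /cube; congr (nat_of_bool _)%:R.
Qed.

Lemma integrable_cube c r : 0 <= r -> integrable_rV (fun x => (cube c r x)%:R).
Proof.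
move=> r0; constructor; rewrite cubeE.
have mC := measurable_cube c r; apply/integrableP; split.
  exact/measurable_EFinP/measurable_indic.
under eq_integral => t _ do rewrite /= ger0_norm ?indicE //.
have := integral_indic mu measurableT mC; rewrite setIT [X in _ = X](lebesgue_tuple_cube c r0).
by under eq_integral => t _ do rewrite indicE; move=> ->; rewrite ltry.
Qed.

Lemma int_cube c r : 0 <= r -> int_rV (fun x => (cube c r x)%:R) = (2 * r) ^+ n.
Proof.
move=> r0; apply: EFin_inj; rewrite -int_rVE; last exact: integrable_cube.
have -> : (fun t => ((cube c r (vec t))%:R)%:E) =
    EFin \o \1_[set t : n.-tuple RR | forall i, `|vec t ord0 i - c ord0 i| <= r] :> (_ -> \bar R).
  by rewrite -cubeE.
rewrite integral_indic ?setIT //; last exact: measurable_cube.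
exact: lebesgue_tuple_cube.
Qed.

Section change_of_variables.
Variables (L : 'rV[R]_n -> 'rV[R]_n) (b : 'rV[R]_n).
Hypothesis LD : {morph L : x y / x + y}.
Hypothesis LK : involutive L.
Hypothesis Lnorm : forall x, enorm (L x) = enorm x.
Hypothesis mL : mfun_rV (L \o vec).

Let A (t : n.-tuple RR) : n.-tuple RR := tuple_of_vec (L (vec t) + b).

Let mA : measurable_fun setT A.
Proof.
apply: (measurable_tuple_of_vec (L := fun t => L (vec t) + b)).
exact: (mfun_rVD mL (mfun_rV_cst b)).
Qed.

Let ge0_A (f : n.-tuple RR -> \bar R) :
  measurable_fun setT f -> (forall t, 0 <= f t)%E ->
  (\int[mu]_t f (A t) = \int[mu]_t f t)%E.
Proof.
move=> mf f0; rewrite -(ge0_integral_tshift (tuple_of_vec b) mf f0).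
have mfs : measurable_fun setT (fun t => f (tshift (tuple_of_vec b) t)).
  exact: (measurableT_comp mf (measurable_tshift _)).
rewrite -(ge0_integral_isom LD LK Lnorm mL mfs); last by move=> t; exact: f0.
by apply: eq_integral => t _; rewrite tshiftE !tuple_of_vecK.
Qed.

Lemma integrable_rV_affine F : integrable_rV F -> integrable_rV (fun x => F (L x + b)).
Proof.
move=> iF; have mF := integrable_rV_mfun iF; constructor; apply/integrableP; split.
  apply/measurable_EFinP.
  exact: (mfun_on_comp mF (mfun_rVD mL (mfun_rV_cst b))).
have mF' : measurable_fun setT (fun t => `|(F (vec t))%:E|)%E.
  apply: measurableT_comp => //; exact/measurable_EFinP.
have [/integrableP[_]] := iF; rewrite -(ge0_A mF') //=.
by under eq_integral do rewrite /A tuple_of_vecK.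
Qed.

Lemma int_rV_affine F : integrable_rV F -> int_rV (fun x => F (L x + b)) = int_rV F.
Proof.
move=> iF; have mF : measurable_fun setT (EFin \o (F \o vec)).
  by apply/measurable_EFinP; exact: integrable_rV_mfun iF.
rewrite /int_rV /Rintegral; congr fine; rewrite [LHS]integralE [RHS]integralE.
congr (_ - _)%E.
  rewrite -(ge0_A (f := (EFin \o (F \o vec))^\+%E)) //; last exact: measurable_funepos.
  by apply: eq_integral => t _; rewrite !funeposE /= tuple_of_vecK.
rewrite -(ge0_A (f := (EFin \o (F \o vec))^\-%E)) //; last exact: measurable_funeneg.
by apply: eq_integral => t _; rewrite !funenegE /= tuple_of_vecK.
Qed.

End change_of_variables.

(* F is dominated by the sum over k of c k times the indicator of a cube of
   half side rad k, whose integral is a geometric series. *)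
Lemma dyadic_integral F (rad c : nat -> R) (q M : R) :
  mfun_on F -> (forall x, 0 <= F x) -> 0 <= q < 1 -> 0 <= M ->
  (forall k, 0 <= rad k) -> (forall k, 0 <= c k) ->
  (forall k, c k * (2 * rad k) ^+ n <= M * q ^+ k) ->
  (forall x, F x != 0 -> exists2 k, enorm x <= rad k & F x <= c k) ->
  integrable_rV F /\ int_rV F <= M / (1 - q).
Proof.
move=> mF F0 /andP[q0 q1] M0 r0 c0 cr Fc.
have mc k : measurable_fun setT (fun t => (c k * (cube 0 (rad k) (vec t))%:R)%:E).
  apply/measurable_EFinP; apply: measurable_funM => //.
  exact: integrable_rV_mfun (integrable_cube _ _).
have g0 k t : (0 <= (c k * (cube 0 (rad k) (vec t))%:R)%:E)%E.
  by rewrite lee_fin mulr_ge0.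
have bnd : (\int[mu]_t (F (vec t))%:E <= (M / (1 - q))%:E)%E.
  apply: (@le_trans _ _ (\int[mu]_t (\sum_(k <oo) (c k * (cube 0 (rad k) (vec t))%:R)%:E))%E).
    apply: ge0_le_integral => //.
    - by move=> t _; rewrite lee_fin.
    - exact/measurable_EFinP.
    - by apply: ge0_emeasurable_sum => // k t _ _; exact: g0.
    - move=> t _; have [F00|/Fc[k xk Fk]] := eqVneq (F (vec t)) 0.
        by rewrite F00; apply: nneseries_ge0 => k _ _; exact: g0.
      apply: (@le_trans _ _ (\sum_(0 <= i < k.+1) (c i * (cube 0 (rad i) (vec t))%:R)%:E)%E).
        rewrite big_nat_recr //=; apply: (@le_trans _ _ (c k * (cube 0 (rad k) (vec t))%:R)%:E).
          rewrite lee_fin (_ : cube _ _ _ = true) ?mulr1 //.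
          apply/asboolP => i; rewrite [X in _ - X]mxE subr0.
          exact: le_trans (coord_le_enorm _ _) xk.
        by rewrite leeDr // sume_ge0.
      by apply: nneseries_lim_ge => i _ _; exact: g0.
  rewrite integral_nneseries //.
  apply: lime_le.
    by apply: is_cvg_nneseries => k _ _; apply: integral_ge0.
  apply: nearW => m.
  apply: (@le_trans _ _ (\sum_(0 <= k < m) (M * q ^+ k)%:E)%E).
    apply: lee_sum => k _.
    have iC : integrable_rV (fun x => c k * (cube 0 (rad k) x)%:R).
      by apply: integrable_rVZ; exact: integrable_cube.
    rewrite [X in (X <= _)%E](_ : _ = (int_rV (fun x => c k * (cube 0 (rad k) x)%:R))%:E).
      by rewrite (int_rVZ _ (integrable_cube _ (r0 k))) int_cube // lee_fin.
    exact: (int_rVE iC).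
  rewrite sumEFin lee_fin -mulr_sumr ler_wpM2l //.
  have q10 : 0 < 1 - q by rewrite subr_gt0.
  rewrite -(ler_pM2r q10) mulVf ?gt_eqF // big_mkord mulrC.
  have -> : (1 - q) * (\sum_(i < m) q ^+ i) = 1 - q ^+ m.
    by rewrite -opprB mulNr -subrX1 opprB.
  by rewrite gerBl exprn_ge0.
have iF : integrable_rV F.
  constructor; apply/integrableP; split; first exact/measurable_EFinP.
  under eq_integral => t _ do rewrite /= ger0_norm //.
  exact: le_lt_trans bnd (ltry _).
by split => //; rewrite -lee_fin -int_rVE.
Qed.

End integral_rV_theory.

#[global] Opaque int_rV.

(** * Radial integrals *)

Section radial_integrals.
Variables (R : realType) (n : nat).

Lemma dyadic_ge1 (y : R) : 1 <= y -> exists k : nat, 2 ^+ k <= y <= 2 ^+ k.+1.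
Proof.
move=> y1.
have H : exists m : nat, y <= 2 ^+ m.
  exists (Num.truncn y).+1; apply: (@le_trans _ _ (Num.truncn y).+1%:R).
    exact/ltW/truncnS_gt.
  by rewrite -natrX ler_nat ltnW // ltn_expl.
case: (ex_minnP H) => -[|m] ym mmin.
  by exists 0%N; rewrite expr0 y1 (le_trans ym) // expr0 expr1 ler1n.
exists m; rewrite ym andbT leNgt; apply/negP => h.
by have := mmin m (ltW h); rewrite ltnn.
Qed.

Lemma powR_lt1 (s : R) : 0 < s -> 0 <= (2 `^ s)^-1 < 1.
Proof.
move=> s0; rewrite invr_ge0 powR_ge0 /= invf_lt1 ?powR_gt0 //.
by rewrite -[ltLHS](congr1 (@^~ s) (@powR1 R)) gt0_ltr_powR ?nnegrE // ltr1n.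
Qed.

Lemma measurable_radial (g : R -> R) : measurable_fun setT (g : measurableTypeR R -> measurableTypeR R) ->
  mfun_on (fun z : 'rV[R]_n => g (enorm z)).
Proof. by move=> mg; exact: (measurableT_comp mg (measurable_enorm (@mfun_vec R n))). Qed.

Definition far_kernel (p rho : R) (z : 'rV[R]_n) : R :=
  (rho <= enorm z)%R%:R / enorm z `^ p.

(** This is |z|^(beta - n) on a punctured ball; beta measures how far the singularity is from the
    critical one. *)
Definition near_kernel (beta rho : R) (z : 'rV[R]_n) : R :=
  (0 < enorm z < rho)%R%:R * (enorm z `^ beta / enorm z `^ n%:R).

Lemma far_kernel_ge0 p rho z : 0 <= far_kernel p rho z.
Proof. by rewrite /far_kernel mulr_ge0 // invr_ge0 powR_ge0. Qed.

Lemma measurable_inv_powR p : measurable_fun setT (fun x : measurableTypeR R => (x `^ p)^-1 : measurableTypeR R).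
Proof.
rewrite (_ : (fun x => _) = fun x : measurableTypeR R => (x `^ (- p))); first exact: measurable_powR.
by apply/funext => x; rewrite powRN.
Qed.

Lemma mfun_far_kernel p rho : mfun_on (far_kernel p rho).
Proof.
apply: (@measurable_radial (fun x => (rho <= x)%R%:R / x `^ p)).
apply: measurable_funM; last exact: measurable_inv_powR.
by apply: measurable_nat_of_bool; apply: measurable_fun_ler => //; exact: measurable_cst.
Qed.

Lemma mfun_near_kernel beta rho : mfun_on (near_kernel beta rho).
Proof.
apply: (@measurable_radial (fun x => (0 < x < rho)%R%:R * (x `^ beta / x `^ n%:R))).
apply: measurable_funM.
  apply: measurable_nat_of_bool; apply: measurable_and.
    by apply: measurable_fun_ltr => //; exact: measurable_cst.
  by apply: measurable_fun_ltr => //; exact: measurable_cst.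
apply: measurable_funM; first exact: measurable_powR.
exact: measurable_inv_powR.
Qed.

Lemma near_kernel_ge0 beta rho z : 0 <= near_kernel beta rho z.
Proof. by rewrite /near_kernel !mulr_ge0 ?invr_ge0 ?powR_ge0. Qed.

Lemma ler_powRl (x y p : R) : 0 <= p -> 0 <= x -> x <= y -> x `^ p <= y `^ p.
Proof. by move=> p0 x0 xy; apply: ge0_ler_powR => //; rewrite nnegrE // (le_trans x0). Qed.

Lemma powRXn (x p : R) k : 0 <= x -> (x ^+ k) `^ p = (x `^ p) ^+ k.
Proof. by move=> x0; rewrite -(powR_mulrn k x0) -(powR_mulrn k (powR_ge0 x p)) -!powRrM mulrC. Qed.

Lemma integrable_far_kernel (s rho : R) : 0 < s -> 0 < rho ->
  integrable_rV (far_kernel (n%:R + s) rho).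
Proof.
move=> s0 r0.
(* Shells rho 2^k <= |z| <= rho 2^(k+1): the kernel is largest on the inner sphere, the volume is
   that of the outer cube, and their product decays like 2^(- s k). *)
pose rad k : R := rho * 2 ^+ k.+1.
pose c k : R := ((rho * 2 ^+ k) `^ (n%:R + s))^-1.
have r2 k : 0 < rho * 2 ^+ k by rewrite mulr_gt0 // exprn_gt0.
have := @dyadic_integral R n (far_kernel (n%:R + s) rho) rad c (2 `^ s)^-1 (4 ^+ n * (rho `^ s)^-1).
case=> //.
- exact: mfun_far_kernel.
- exact: far_kernel_ge0.
- exact: powR_lt1.
- by rewrite mulr_ge0 ?exprn_ge0 ?invr_ge0 ?powR_ge0.
- by move=> k; exact/ltW/r2.
- by move=> k; rewrite invr_ge0 powR_ge0.
- move=> k; rewrite /c /rad powRD; last by rewrite (gt_eqF (r2 k)) implybT.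
  rewrite powR_mulrn ?(ltW (r2 _)) //.
  have -> : 2 * (rho * 2 ^+ k.+1) = 4 * (rho * 2 ^+ k) by rewrite exprS; ring.
  rewrite [X in _ * X]exprMn powRM ?(ltW r0) ?exprn_ge0 // powRXn // exprVn.
  have A : (rho * 2 ^+ k) ^+ n != 0 by rewrite expf_neq0 // gt_eqF.
  have B : rho `^ s != 0 by rewrite gt_eqF // powR_gt0.
  have C : (2 `^ s) ^+ k != 0 by rewrite expf_neq0 // gt_eqF // powR_gt0.
  rewrite le_eqVlt; apply/orP; left; apply/eqP; move: A B C.
  move: ((rho * 2 ^+ k) ^+ n) (rho `^ s) ((2 `^ s) ^+ k) (4 ^+ n) => x y z w A B C.
  by field; rewrite A B C.
- move=> x; rewrite /far_kernel; case: (leP rho (enorm x)); last by rewrite mul0r eqxx.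
  move=> rx _.
  have [k /andP[k1 k2]] : exists k : nat, 2 ^+ k <= enorm x / rho <= 2 ^+ k.+1.
    by apply: dyadic_ge1; rewrite ler_pdivlMr // mul1r.
  exists k; first by rewrite /rad mulrC -ler_pdivrMr.
  rewrite mul1r /c lef_pV2 ?posrE ?powR_gt0 //; last exact: lt_le_trans rx.
  apply: ler_powRl; [by rewrite addr_ge0 // ltW|exact/ltW|].
  by rewrite mulrC -ler_pdivlMr.
Qed.

(** The explicit factor rho^beta is what later makes the singular part of the principal value small
    uniformly in the centre. *)
Lemma integrable_near_kernel (beta rho : R) : 0 < beta -> 0 < rho ->
  integrable_rV (near_kernel beta rho) /\
  int_rV (near_kernel beta rho) <= 4 ^+ n / (1 - (2 `^ beta)^-1) * rho `^ beta.
Proof.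
move=> b0 r0.
(* Shells rho / 2^(k+1) <= |z| <= rho / 2^k; the factor 2^n in [c] accounts for |z|^(-n) on the
   inner sphere. *)
pose rad k : R := rho / 2 ^+ k.
pose c k : R := 2 ^+ n * (rad k `^ beta / rad k ^+ n).
have r2 k : 0 < rad k by rewrite divr_gt0 // exprn_gt0.
have := @dyadic_integral R n (near_kernel beta rho) rad c (2 `^ beta)^-1 (4 ^+ n * rho `^ beta).
case=> //.
- exact: mfun_near_kernel.
- exact: near_kernel_ge0.
- exact: powR_lt1.
- by rewrite mulr_ge0 ?exprn_ge0 ?powR_ge0.
- by move=> k; exact/ltW/r2.
- by move=> k; rewrite !mulr_ge0 ?invr_ge0 ?powR_ge0 ?exprn_ge0 ?(ltW (r2 k)).
- move=> k; rewrite /c [(2 * rad k) ^+ n]exprMn (_ : 4 = 2 * 2 :> R); last by ring.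
  rewrite [(2 * 2) ^+ n]exprMn.
  have -> : rad k `^ beta = rho `^ beta * ((2 `^ beta)^-1) ^+ k.
    rewrite /rad powRM ?(ltW r0) ?invr_ge0 ?exprn_ge0 // exprVn; congr (_ * _).
    rewrite -(powRXn _ _ (ler0n R 2)) -[in LHS](powR_inv1 (exprn_ge0 k (ler0n R 2))).
    by rewrite powRAC powR_inv1 ?powR_ge0.
  have A : rad k ^+ n != 0 by rewrite expf_neq0 // gt_eqF.
  rewrite le_eqVlt; apply/orP; left; apply/eqP; move: A.
  move: (rad k ^+ n) (rho `^ beta) (((2 `^ beta)^-1) ^+ k) (2 ^+ n) => x y z w A.
  by field.
- move=> x; rewrite /near_kernel; case: (boolP (_ && _)); last by rewrite mul0r eqxx.
  move=> /andP[x0 xr] _.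
  have [k /andP[k1 k2]] : exists k : nat, 2 ^+ k <= rho / enorm x <= 2 ^+ k.+1.
    by apply: dyadic_ge1; rewrite ler_pdivlMr // mul1r ltW.
  have xrad : enorm x <= rad k.
    by rewrite /rad ler_pdivlMr ?exprn_gt0 // mulrC -ler_pdivlMr.
  exists k => //; rewrite mul1r /c powR_mulrn ?enorm_ge0 // mulrCA.
  apply: ler_pM; rewrite ?powR_ge0 ?invr_ge0 ?exprn_ge0 ?enorm_ge0 //.
    by apply: ler_powRl; rewrite ?enorm_ge0 // ltW.
  rewrite -[leRHS]invrK invfM invrK lef_pV2 ?posrE ?exprn_gt0 //; last first.
    by rewrite mulr_gt0 ?invr_gt0 ?exprn_gt0.
  rewrite mulrC -expr_div_n.
  apply: lerXn2r; rewrite ?nnegrE ?enorm_ge0 ?(divr_ge0 (ltW (r2 k)) (ler0n R 2)) //.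
  rewrite ler_pdivrMr // /rad ler_pdivrMr ?exprn_gt0 //.
  by rewrite -mulrA -exprS -ler_pdivrMl // mulrC.
by move=> ? h; split => //; apply: le_trans h _; rewrite mulrAC.
Qed.

End radial_integrals.

(** * Regularity and functions on the quadrant *)

Section gradient_estimates.
Variables (R : realType) (n : nat).
Implicit Types (x y z : 'rV[R]_n) (u : 'rV[R]_n -> R).

Lemma dot_gradient u x z : differentiable u x -> 'D_z u x = dot (gradient u x) z.
Proof.
move=> du; rewrite deriveE // {1}(row_sum_delta z) linear_sum.
apply: eq_bigr => i _; rewrite linearZ /= mxE -deriveE // mulrC.
by [].
Qed.

Lemma is_derive_segment u x z (t : R) : differentiable u (x + t *: z) ->
  is_derive t (1 : R) (fun t => u (x + t *: z)) (dot (gradient u (x + t *: z)) z).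
Proof.
move=> du.
have E : (fun h : R => h^-1 *: (((fun t => u (x + t *: z)) \o shift t) (h *: (1 : R)) - u (x + t *: z))) =
         (fun h : R => h^-1 *: ((u \o shift (x + t *: z)) (h *: z) - u (x + t *: z))).
  apply/funext => h /=; congr (_ *: (u _ - _)).
  by rewrite [h *: 1]mulr1 scalerDl addrCA.
apply: DeriveDef.
  by rewrite /derivable E; exact: diff_derivable.
by rewrite /derive E -dot_gradient.
Qed.

Lemma mvt_segment u x z : (forall y, differentiable u y) ->
  exists2 c : R, 0 <= c <= 1 & u (x + z) - u x = dot (gradient u (x + c *: z)) z.
Proof.
move=> du.
have [|c] := @MVT_segment R (fun t => u (x + t *: z))
   (fun t => dot (gradient u (x + t *: z)) z) 0 1 ler01 (fun t _ => is_derive_segment (du _)).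
  apply: derivable_within_continuous => t _.
  by have [] := is_derive_segment (du (x + t *: z)).
rewrite in_itv /= scale1r scale0r addr0 subr0 mulr1 => c01 E.
by exists c.
Qed.

(** One mean value theorem for t |-> u (x + t z) + u (x - t z) gives the same c on both sides, so
    two gradients at distance 2 c |z| are compared and Hoelder continuity adds theta to the
    exponent. *)
Lemma second_difference u x z : (forall y, differentiable u y) ->
  exists2 c : R, 0 <= c <= 1 &
    u (x + z) + u (x - z) - 2 * u x =
    dot (gradient u (x + c *: z) - gradient u (x - c *: z)) z.
Proof.
move=> du.
have dphi t : is_derive t (1 : R) ((fun t => u (x + t *: z)) + (fun t => u (x + t *: - z)))
    (dot (gradient u (x + t *: z)) z + dot (gradient u (x + t *: - z)) (- z)).
  by apply: is_deriveD; exact: is_derive_segment.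
have [|c] := @MVT_segment R _ _ 0 1 ler01 (fun t _ => dphi t).
  by apply: derivable_within_continuous => t _; have [] := dphi t.
rewrite in_itv /= => c01 E; exists c => //.
rewrite dotDl dotNl -dotNr -(scalerN c) -[RHS]mulr1 -{2}(subr0 1) -E.
by rewrite /= !fctE !scale1r !scale0r !addr0; ring.
Qed.

Lemma enorm_segment x y (c r : R) : 0 <= c <= 1 -> enorm x <= r -> enorm y <= r ->
  enorm (x + c *: (y - x)) <= r.
Proof.
move=> /andP[c0 c1] xr yr.
have -> : x + c *: (y - x) = (1 - c) *: x + c *: y.
  by apply/rowP => i; rewrite !mxE; ring.
rewrite (le_trans (enormD _ _)) // !enormZ !ger0_norm ?subr_ge0 //.
have := enorm_ge0 x; nra.
Qed.

Lemma holder_lipschitz (theta : R) u : 0 < theta -> C1_loc_holder theta u ->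
  forall r : R, exists2 L : R, 0 <= L & forall x y, enorm x <= r -> enorm y <= r ->
    `|u x - u y| <= L * enorm (x - y).
Proof.
move=> t0 [du hu] r; have [r0|r0] := leP 0 r; last first.
  by exists 0 => // x y xr; have := le_lt_trans xr r0; rewrite ltNge enorm_ge0.
have [K hK] := hu r.
exists (enorm (gradient u 0) + `|K| * r `^ theta).
  by rewrite addr_ge0 ?enorm_ge0 // mulr_ge0 ?powR_ge0.
move=> x y xr yr; have [c c01] := mvt_segment y (x - y) du.
rewrite [y + (x - y)]addrC subrK => ->; rewrite (le_trans (normr_dot_le _ _)) //.
apply: ler_wpM2r; first exact: enorm_ge0.
set p := y + _; have pr : enorm p <= r by exact: enorm_segment.
rewrite -{1}(subrK (gradient u 0) (gradient u p)) (le_trans (enormD _ _)) //.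
rewrite addrC lerD2l (le_trans (hK _ _ pr _)) ?enorm0 // subr0.
apply: (@le_trans _ _ (`|K| * enorm p `^ theta)).
  by apply: ler_wpM2r; [exact: powR_ge0|exact: ler_norm].
by apply: ler_wpM2l => //; apply: ge0_ler_powR; rewrite ?nnegrE ?enorm_ge0 // ltW.
Qed.

Lemma holder_second_difference (theta : R) u : 0 < theta -> C1_loc_holder theta u ->
  forall r : R, exists2 M : R, 0 <= M & forall x z, enorm x <= r -> enorm z <= 1 ->
    `|u (x + z) + u (x - z) - 2 * u x| <= M * enorm z `^ (1 + theta).
Proof.
move=> t0 [du hu] r; have [K hK] := hu (r + 1).
exists (`|K| * 2 `^ theta); first by rewrite mulr_ge0 ?powR_ge0.
move=> x z xr z1; have [c /andP[c0 c1] ->] := second_difference x z du.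
have cz : enorm (c *: z) <= 1.
  by rewrite enormZ ger0_norm // mulr_ile1 ?enorm_ge0.
have h1 : enorm (x + c *: z) <= r + 1 by rewrite (le_trans (enormD _ _)) // lerD.
have h2 : enorm (x - c *: z) <= r + 1 by rewrite (le_trans (enormD _ _)) // enormN lerD.
rewrite (le_trans (normr_dot_le _ _)) //.
rewrite powRD; last by rewrite (gt_eqF (addr_gt0 ltr01 t0)).
rewrite powRr1 ?enorm_ge0 // [enorm z * _]mulrC mulrA.
apply: ler_wpM2r; first exact: enorm_ge0.
rewrite (le_trans (hK _ _ h1 h2)) //.
apply: (@le_trans _ _ (`|K| * enorm (x + c *: z - (x - c *: z)) `^ theta)).
  by apply: ler_wpM2r; [exact: powR_ge0|exact: ler_norm].
rewrite -mulrA; apply: ler_wpM2l => //.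
rewrite -powRM ?enorm_ge0 //.
apply: ge0_ler_powR; rewrite ?nnegrE ?mulr_ge0 ?enorm_ge0 ?(ltW t0) //.
have -> : x + c *: z - (x - c *: z) = (2 * c) *: z.
  by apply/rowP => i; rewrite !mxE; ring.
rewrite enormZ ger0_norm ?mulr_ge0 //; apply: ler_wpM2r; first exact: enorm_ge0.
by rewrite ler_piMr.
Qed.

End gradient_estimates.

(** * C^1 functions on the quadrant *)

Section plane_functions.
Variable R : realType.
Implicit Types (f h : R -> R -> R) (s t : R).

Notation quadrant := [set z : R * R | 0 <= z.1 /\ 0 <= z.2].

Lemma within_quadrant_continuous (F : R * R -> R) (s t : R) :
  {within quadrant, continuous F} -> 0 < s -> 0 < t ->
  forall e, 0 < e -> exists2 d, 0 < d &
    forall s' t', `|s' - s| < d -> `|t' - t| < d -> `|F (s', t') - F (s, t)| < e.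
Proof.
move=> cF s0 t0 e e0.
have : {for (s, t), continuous F}.
  have Qn : quadrant° (s, t).
    exists ([set s' | 0 < s'], [set t' | 0 < t']); first by split; exact: lt_nbhsr.
    by move=> [s' t'] /= [s'0 t'0]; split; exact/ltW.
  by have /(_ (s, t)) := cF; rewrite /continuous_at -(nbhs_subspace_interior Qn).
move=> /cvgrPdist_lt /(_ e e0) /nbhs_ballP[d d0 H]; exists d => // s' t' s's t't.
rewrite distrC; apply: H; split => /=; rewrite /ball /= distrC //.
Qed.

Lemma C1_quadrant_continuous f s t : C1_quadrant f -> 0 < s -> 0 < t ->
  forall e, 0 < e -> exists2 d, 0 < d &
    forall s' t', `|s' - s| < d -> `|t' - t| < d -> `|f s' t' - f s t| < e.
Proof. by move=> [cf _]; exact: (within_quadrant_continuous cf). Qed.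

Lemma C1_quadrant_mvt1 f s1 s2 t : C1_quadrant f -> 0 < s1 -> s1 <= s2 -> 0 < t ->
  exists2 c, s1 <= c <= s2 & f s2 t - f s1 t = partial1 f c t * (s2 - s1).
Proof.
move=> [_ [df _]] s10 s12 t0.
have D c : c \in `[s1, s2] -> is_derive c 1 (f ^~ t) (partial1 f c t).
  rewrite in_itv /= => /andP[s1c _]; apply: DeriveDef; last by rewrite /partial1 derive1E.
  exact: (df c t (lt_le_trans s10 s1c) t0).1.
have cw : {within `[s1, s2], continuous (f ^~ t)}.
  by apply: derivable_within_continuous => c /D[].
have [c] := MVT_segment s12 (fun c cs => D c (subset_itv_oo_cc cs)) cw.
by rewrite in_itv /= => cs E; exists c.
Qed.

Lemma C1_quadrant_mvt2 f s t1 t2 : C1_quadrant f -> 0 < t1 -> t1 <= t2 -> 0 < s ->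
  exists2 c, t1 <= c <= t2 & f s t2 - f s t1 = partial2 f s c * (t2 - t1).
Proof.
move=> [_ [df _]] t10 t12 s0.
have D c : c \in `[t1, t2] -> is_derive c 1 (f s) (partial2 f s c).
  rewrite in_itv /= => /andP[t1c _]; apply: DeriveDef; last by rewrite /partial2 derive1E.
  exact: (df s c s0 (lt_le_trans t10 t1c)).2.
have cw : {within `[t1, t2], continuous (f s)}.
  by apply: derivable_within_continuous => c /D[].
have [c] := MVT_segment t12 (fun c cs => D c (subset_itv_oo_cc cs)) cw.
by rewrite in_itv /= => cs E; exists c.
Qed.

Lemma within_quadrant_bounded (F : R * R -> R) (A B : R) :
  {within quadrant, continuous F} ->
  exists2 M, 0 <= M & forall s t, 0 <= s <= A -> 0 <= t <= B -> F (s, t) <= M.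
Proof.
move=> cF; pose K : set (R * R) := [set` `[0, A]] `*` [set` `[0, B]].
have cK : compact K by apply: compact_setX; exact: segment_compact.
have [[z Kz]|K0] := pselect (K !=set0); last first.
  exists 0 => // s t sA tB; exfalso; apply: K0; exists (s, t).
  by split => /=; rewrite in_itv.
have [||c _ cmax] := @compact_EVT_max _ R F K _ cK.
- by exists z.
- apply: continuous_subspaceW cF => -[s t] [] /=; rewrite !in_itv /=.
  by move=> /andP[? _] /andP[].
exists `|F c| => // s t sA tB; apply: le_trans (ler_norm _); apply: cmax.
by rewrite inE; split => /=; rewrite in_itv.
Qed.

(** The rectangles reach the axes, as they must for solutions that decay to 0; the continuous
    extensions to the closed quadrant supply compactness. *)
Lemma C1_quadrant_partials_bounded f (A B : R) : C1_quadrant f ->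
  exists2 M, 0 <= M & forall s t, 0 < s <= A -> 0 < t <= B ->
    partial1 f s t <= M /\ partial2 f s t <= M.
Proof.
move=> [_ [_ [f1 [f2 [c1 c2 fE]]]]].
have [M1 M10 h1] := within_quadrant_bounded A B c1.
have [M2 M20 h2] := within_quadrant_bounded A B c2.
exists (M1 + M2); first exact: addr_ge0.
move=> s t /andP[s0 sA] /andP[t0 tB]; have [<- <-] := fE s t s0 t0.
split; first by rewrite (le_trans (h1 s t _ _)) ?(ltW s0) ?(ltW t0) // lerDl.
by rewrite (le_trans (h2 s t _ _)) ?(ltW s0) ?(ltW t0) // lerDr.
Qed.

Lemma C1_quadrant_partials_continuous f s t : C1_quadrant f -> 0 < s -> 0 < t ->
  forall e, 0 < e -> exists2 d, 0 < d & forall s' t', 0 < s' -> 0 < t' ->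
    `|s' - s| < d -> `|t' - t| < d ->
    `|partial1 f s' t' - partial1 f s t| < e /\ `|partial2 f s' t' - partial2 f s t| < e.
Proof.
move=> [_ [_ [f1 [f2 [c1 c2 fE]]]]] s0 t0 e e0.
have [d1 d10 h1] := within_quadrant_continuous c1 s0 t0 e0.
have [d2 d20 h2] := within_quadrant_continuous c2 s0 t0 e0.
exists (Num.min d1 d2) => [|s' t' s'0 t'0]; first by rewrite lt_min d10.
rewrite !lt_min => /andP[? ?] /andP[? ?].
by have [<- <-] := fE s t s0 t0; have [<- <-] := fE s' t' s'0 t'0; split; [exact: h1|exact: h2].
Qed.

(** The intermediate points are located by distance only, which covers increments of either sign at
    once. *)
Lemma C1_quadrant_increment f s1 s2 t1 t2 : C1_quadrant f ->
  0 < s1 -> 0 < s2 -> 0 < t1 -> 0 < t2 ->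
  exists c d, [/\ 0 < c /\ `|c - s1| <= `|s2 - s1|, 0 < d /\ `|d - t1| <= `|t2 - t1| &
    f s2 t2 - f s1 t1 = partial1 f c t2 * (s2 - s1) + partial2 f s1 d * (t2 - t1)].
Proof.
move=> Cf s10 s20 t10 t20.
have [c [c0 cs Ec]] : exists c, [/\ 0 < c, `|c - s1| <= `|s2 - s1| &
    f s2 t2 - f s1 t2 = partial1 f c t2 * (s2 - s1)].
  have [s12|/ltW s21] := leP s1 s2.
    have [c /andP[c1 c2] E] := C1_quadrant_mvt1 Cf s10 s12 t20.
    by exists c; split => //; [exact: lt_le_trans c1|rewrite !ger0_norm ?subr_ge0 // lerD2r].
  have [c /andP[c1 c2] E] := C1_quadrant_mvt1 Cf s20 s21 t20.
  exists c; split; [exact: lt_le_trans c1| |lra].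
  by rewrite !ler0_norm ?subr_le0 // lerN2 lerD2r.
have [d [d0 dt Ed]] : exists d, [/\ 0 < d, `|d - t1| <= `|t2 - t1| &
    f s1 t2 - f s1 t1 = partial2 f s1 d * (t2 - t1)].
  have [t12|/ltW t21] := leP t1 t2.
    have [d /andP[d1 d2] E] := C1_quadrant_mvt2 Cf t10 t12 s10.
    by exists d; split => //; [exact: lt_le_trans d1|rewrite !ger0_norm ?subr_ge0 // lerD2r].
  have [d /andP[d1 d2] E] := C1_quadrant_mvt2 Cf t20 t21 s10.
  exists d; split; [exact: lt_le_trans d1| |lra].
  by rewrite !ler0_norm ?subr_le0 // lerN2 lerD2r.
by exists c, d; split => //; rewrite -Ec -Ed; ring.
Qed.

(** The chain rule along a segment; continuity of the partial derivatives replaces total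
    differentiability. *)
Lemma C1_quadrant_is_derive f s t U V (k : R) : C1_quadrant f ->
  0 < s + k * U -> 0 < t + k * V ->
  is_derive k (1 : R) (fun k => f (s + k * U) (t + k * V))
    (partial1 f (s + k * U) (t + k * V) * U + partial2 f (s + k * U) (t + k * V) * V).
Proof.
move=> Cf; set s0 := s + _; set t0 := t + _ => s00 t00.
set l := partial1 _ _ _ * _ + _.
have cv : h^-1 *: (((fun k => f (s + k * U) (t + k * V)) \o shift k) (h *: (1 : R)) -
    f s0 t0) @[h --> 0^'] --> l.
  apply/cvgrPdist_lt => e e0; pose N := `|U| + `|V| + 1.
  have N0 : 0 < N by rewrite ltr_wpDl // addr_ge0.
  have [d d0 H] := C1_quadrant_partials_continuous Cf s00 t00 (divr_gt0 e0 N0).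
  pose m := Num.min d (Num.min s0 t0).
  have m0 : 0 < m by rewrite !lt_min d0 s00.
  near=> h.
  have h0 : h != 0 by near: h; exact: nbhs_dnbhs_neq.
  have hN : `|h| * N < m.
    by rewrite -ltr_pdivlMr //; near: h; apply: dnbhs0_lt; exact: divr_gt0.
  have hU : `|h * U| < m.
    by rewrite normrM (le_lt_trans _ hN) // ler_wpM2l // /N -addrA lerDl addr_ge0.
  have hV : `|h * V| < m.
    by rewrite normrM (le_lt_trans _ hN) // ler_wpM2l // /N addrAC lerDr addr_ge0.
  rewrite /= [h *: 1]mulr1.
  have -> : s + (h + k) * U = s0 + h * U by rewrite /s0; ring.
  have -> : t + (h + k) * V = t0 + h * V by rewrite /t0; ring.
  move: hU hV; rewrite !lt_min => /and3P[Ud Us _] /and3P[Vd _ Vt].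
  have sp : 0 < s0 + h * U by move: Us; rewrite ltr_norml => /andP[]; lra.
  have tp : 0 < t0 + h * V by move: Vt; rewrite ltr_norml => /andP[]; lra.
  have [c [c' [[c0 cs] [c'0 c's] E]]] := C1_quadrant_increment Cf s00 sp t00 tp.
  rewrite E (addrAC s0) subrr add0r (addrAC t0) subrr add0r.
  have sU : s0 + h * U - s0 = h * U by ring.
  have tV : t0 + h * V - t0 = h * V by ring.
  rewrite sU in cs; rewrite tV in c's.
  have [A1 _] := H c (t0 + h * V) c0 tp (le_lt_trans cs Ud) ltac:(by rewrite tV).
  have [_ A2] := H s0 c' s00 c'0 ltac:(by rewrite subrr normr0) (le_lt_trans c's Vd).
  have -> : l - h^-1 *: (partial1 f c (t0 + h * V) * (h * U) + partial2 f s0 c' * (h * V)) =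
     - ((partial1 f c (t0 + h * V) - partial1 f s0 t0) * U + (partial2 f s0 c' - partial2 f s0 t0) * V).
    by rewrite /l /GRing.scale /=; field.
  rewrite normrN (le_lt_trans (ler_normD _ _)) // !normrM.
  apply: (@le_lt_trans _ _ (e / N * (`|U| + `|V|))).
    by rewrite mulrDr; apply: lerD; (apply: ler_wpM2r; [exact: normr_ge0|exact/ltW]).
  by rewrite mulrAC -mulrA -[ltRHS]mulr1 ltr_pM2l // ltr_pdivrMr // mul1r /N ltrDl.
apply: DeriveDef; first by apply/cvg_ex; exists l.
exact: cvg_lim cv.
Unshelve. all: by end_near.
Qed.

(** Along the segment the derivative is h_1 U + h_2 V > (h_1 + mu h_2) U >= 0. Both partials have to
    be taken at the same point for this, so the increment cannot be split into one step per
    variable. *)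
Lemma C1_quadrant_increasing h (mu : R) s t U V : C1_quadrant h -> 0 < mu ->
  (forall y z : R, 0 < y -> 0 < z -> partial1 h y z < 0 /\ 0 < partial2 h y z) ->
  (forall y z : R, 0 < y -> 0 < z -> mu * partial2 h y z <= - partial1 h y z) ->
  0 < s -> 0 < t -> 0 < s + U -> 0 < t + V -> U < 0 -> mu * U < V ->
  h s t < h (s + U) (t + V).
Proof.
move=> Ch mu0 hs hmu s0 t0 sU tV U0 UV.
have pos (x y c : R) : 0 < x -> 0 < x + y -> 0 <= c <= 1 -> 0 < x + c * y.
  move=> x0 xy /andP[c0 c1]; have -> : x + c * y = (1 - c) * x + c * (x + y) by ring.
  have [->|c1'] := eqVneq c 1; first by rewrite subrr mul0r add0r mul1r.
  rewrite ltr_wpDr ?mulr_ge0 ?(ltW xy) // mulr_gt0 // subr_gt0 lt_neqAle c1'.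
  by [].
have D (k : R) : k \in `[0, 1] -> is_derive k (1 : R) (fun k => h (s + k * U) (t + k * V))
    (partial1 h (s + k * U) (t + k * V) * U + partial2 h (s + k * U) (t + k * V) * V).
  by rewrite in_itv /= => k01; apply: C1_quadrant_is_derive => //; exact: pos.
have cw : {within `[0, 1], continuous (fun k : R => h (s + k * U) (t + k * V))}.
  by apply: derivable_within_continuous => c /D[].
have [c] := MVT ltr01 (fun k k01 => D k (subset_itv_oo_cc k01)) cw.
rewrite in_itv /= => /andP[c0 c1].
have c01 : 0 <= c <= 1 by rewrite !ltW.
have [h1 h2] := hs _ _ (pos _ _ _ s0 sU c01) (pos _ _ _ t0 tV c01).
have h3 := hmu _ _ (pos _ _ _ s0 sU c01) (pos _ _ _ t0 tV c01).
rewrite subr0 mulr1 !mul1r !mul0r !addr0 => /eqP; rewrite subr_eq => /eqP ->.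
rewrite ltrDr; move: h1 h2 h3.
move: (partial1 h _ _) (partial2 h _ _) => x y h1 h2 h3; nra.
Qed.

End plane_functions.

(** * The fractional Laplacian and the nonlocal normal derivative *)

Section fractional_operators.
Variables (R : realType) (n : nat).
Implicit Types (x y z : 'rV[R]_n.+1) (u : 'rV[R]_n.+1 -> R).

Lemma one_sub_cos_le (t : R) : 1 - cos t <= t ^+ 2.
Proof.
wlog t0 : t / 0 <= t => [H|].
  have [/H //|/ltW t0] := leP 0 t.
  by rewrite -cosN -sqrrN; apply: H; rewrite oppr_ge0.
have cc : {within `[0, t], continuous (@cos R)}.
  by apply: continuous_subspaceT => s; exact: continuous_cos.
have [c] := MVT_segment t0 (fun (s : R) _ => is_derive_cos s) cc.
rewrite in_itv /= cos0 subr0 => /andP[c0 ct] E.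
have cs : {within `[0, c], continuous (@sin R)}.
  by apply: continuous_subspaceT => s; exact: continuous_sin.
have [d _] := MVT_segment c0 (fun (s : R) _ => is_derive_sin s) cs.
rewrite sin0 !subr0 => E'.
have -> : 1 - cos t = cos d * (c * t) by rewrite -opprB E E'; ring.
rewrite (@le_trans _ _ (c * t)) ?ler_piMl ?mulr_ge0 ?cos_le1 //.
by rewrite expr2 ler_wpM2r.
Qed.

Lemma lastc_le_enorm x : `|lastc x| <= enorm x.
Proof. exact: coord_le_enorm. Qed.

(** Serves twice: b = x centres a radial kernel at x, and b = x + x is the point reflection through
    x. *)
Lemma integrable_rV_opp_affine (b : 'rV[R]_n.+1) F : integrable_rV F ->
  integrable_rV (fun x => F (b - x)) /\ int_rV (fun x => F (b - x)) = int_rV F.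
Proof.
move=> iF.
have LD : {morph (fun x => - x) : x y / x + y : 'rV[R]_n.+1} by move=> x y; exact: opprD.
have mL : mfun_rV ((fun x => - x) \o @vec_of_tuple R n.+1).
  exact: mfun_rVN (@mfun_vec R n.+1).
have E : (fun x => F (b - x)) = (fun x => F (- x + b)) by apply/funext => x; rewrite addrC.
rewrite E; split.
  exact: (integrable_rV_affine b LD (@opprK _) (@enormN _ _) mL iF).
exact: (int_rV_affine b LD (@opprK _) (@enormN _ _) mL iF).
Qed.

Variable alpha : R.
Hypothesis alpha02 : 0 < alpha < 2.

Let alpha_gt0 : 0 < alpha. Proof. by case/andP: alpha02. Qed.
Let p : R := n.+1%:R + alpha.
Let p_gt0 : 0 < p. Proof. by rewrite addr_gt0. Qed.

Let cos_kernel (z : 'rV[R]_n.+1) : R := (1 - cos (z ord0 ord0)) / enorm z `^ p.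

Let cos_kernel_ge0 z : 0 <= cos_kernel z.
Proof. by rewrite /cos_kernel divr_ge0 ?powR_ge0 // subr_ge0 cos_le1. Qed.

Lemma powR_ratio (t r s : R) : 0 < t -> t `^ r / t `^ s = t `^ (r - s).
Proof. by move=> t0; rewrite powRB // (gt_eqF t0) implybT. Qed.

(** Near 0 the numerator is at most |z|^2, which leaves the order 2 - alpha > 0; at infinity it is
    at most 2. *)
Let integrable_cos_kernel : integrable_rV cos_kernel.
Proof.
have mG : mfun_on cos_kernel.
  apply: measurable_funM.
    apply: measurable_funB; first exact: measurable_cst.
    have mc : measurable_fun setT (@cos R).
      by apply: continuous_measurable_fun; exact: continuous_cos.
    exact: (measurableT_comp mc (@mfun_vec R n.+1 ord0)).
  exact: (@measurable_radial R n.+1 (fun t => (t `^ p)^-1) (measurable_inv_powR _)).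
have b0 : 0 < 2 - alpha by rewrite subr_gt0; case/andP: alpha02.
have [iN _] := @integrable_near_kernel R n.+1 (2 - alpha) 1 b0 ltr01.
have iF := @integrable_far_kernel R n.+1 alpha 1 alpha_gt0 ltr01.
apply: (integrable_rV_le mG (integrable_rVD iN (integrable_rVZ 2 iF))) => z.
rewrite ger0_norm ?cos_kernel_ge0 // /cos_kernel /near_kernel /far_kernel.
have [z0|z0] := leP (enorm z) 0.
  have -> : enorm z = 0 by apply/eqP; rewrite eq_le z0 enorm_ge0.
  by rewrite powR0 ?gt_eqF // invr0 !mulr0 /= mul0r addr0.
have [z1|z1] := leP 1 (enorm z).
  rewrite andbF mul0r add0r mul1r; apply: ler_wpM2r; first by rewrite invr_ge0 powR_ge0.
  by have := cos_geN1 (z ord0 ord0); lra.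
rewrite mul1r mul0r mulr0 addr0 powR_ratio //.
have -> : 2 - alpha - n.+1%:R = 2 - p by rewrite /p; ring.
rewrite -powR_ratio //; apply: ler_wpM2r; first by rewrite invr_ge0 powR_ge0.
rewrite powR_mulrn ?enorm_ge0 // (le_trans (one_sub_cos_le _)) //.
rewrite -real_normK ?num_real // lerXn2r ?nnegrE ?enorm_ge0 //.
exact: coord_le_enorm.
Qed.

(** On the cube [1, 2]^(n+1) the first coordinate stays between 1 and 2 <= pi, where cos is at most
    cos 1, and |z| is at most 2 (n + 1). *)
Let int_cos_kernel_gt0 : 0 < int_rV cos_kernel.
Proof.
pose c : 'rV[R]_n.+1 := const_mx (3 / 2).
pose k : R := (1 - cos 1) / (n.+1%:R * 2) `^ p.
have h0 : (0 : R) <= 2^-1 by rewrite invr_ge0.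
have pi1 : (2 : R) <= pi by exact: pi_ge2.
have k0 : 0 < k.
  rewrite divr_gt0 ?powR_gt0 ?mulr_gt0 // subr_gt0 -[ltRHS]cos0.
  by rewrite ltr_cos ?in_itv /= ?lexx ?ler01 /= ?pi_ge0 //; lra.
apply: (@lt_le_trans _ _ (k * (2 * 2^-1) ^+ n.+1)).
  by rewrite mulr_gt0 // exprn_gt0 // divff.
rewrite -(int_cube c h0) -int_rVZ; last exact: integrable_cube.
apply: le_int_rV => //; first by apply: integrable_rVZ; exact: integrable_cube.
move=> z; case: (boolP (cube _ _ _)); last by rewrite mulr0.
move=> /asboolP zc; rewrite mulr1.
have z12 i : 1 <= z ord0 i <= 2.
  by have := zc i; rewrite /c mxE ler_distl => /andP[]; lra.
have /andP[z1 z2] := z12 ord0.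
apply: ler_pM.
- by rewrite subr_ge0 cos_le1.
- by rewrite invr_ge0 powR_ge0.
- rewrite lerD2l lerN2 leNgt; apply/negP.
  rewrite ltr_cos ?in_itv /= ?ler01 /=; [lra|lra|lra].
have zn : 0 < enorm z by rewrite (lt_le_trans ltr01) // (le_trans z1) // (le_trans (ler_norm _)) ?coord_le_enorm.
rewrite lef_pV2 ?posrE ?powR_gt0 ?mulr_gt0 //.
apply: ler_powRl; [exact/ltW|exact: enorm_ge0|].
apply: enorm_le_coord => i; have /andP[i1 i2] := z12 i.
by rewrite ger0_norm // (le_trans ler01).
Qed.

(** Finiteness matters as much as positivity: [fine] sends an infinite integral to 0, and the
    inverse of 0 is 0. *)
Lemma frac_const_gt0 : 0 < frac_const n alpha.
Proof.
rewrite /frac_const (@integral_rV_indic R n.+1 setT _ cos_kernel) //=.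
by rewrite invr_gt0.
Qed.

Lemma shifted_far_kernel x (rho : R) : 0 < rho ->
  integrable_rV (fun y => far_kernel p rho (x - y)).
Proof.
move=> r0; exact: (integrable_rV_opp_affine x (integrable_far_kernel n.+1 alpha_gt0 r0)).1.
Qed.

Section bounded_function.
Variables (u : 'rV[R]_n.+1 -> R) (M : R).
Hypothesis uM : forall x, `|u x| <= M.
Hypothesis mu : mfun_on u.

Definition trunc_diff (rho : R) x y : R :=
  (rho <= enorm (x - y))%R%:R * diff_kernel alpha u x y.

Definition trunc_int (rho : R) x : R := int_rV (trunc_diff rho x).

Lemma mfun_diff_kernel x : mfun_on (diff_kernel alpha u x).
Proof.
apply: measurable_funM.
  by apply: measurable_funB; [exact: measurable_cst|exact: mu].
apply: (measurableT_comp (measurable_inv_powR _)); apply: measurable_enorm.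
by apply: mfun_rVB; [exact: mfun_rV_cst|exact: mfun_vec].
Qed.

Lemma norm_diff_kernel x y : `|diff_kernel alpha u x y| <= 2 * M / enorm (x - y) `^ p.
Proof.
rewrite normrM normfV (ger0_norm (powR_ge0 _ _)); apply: ler_wpM2r.
  by rewrite invr_ge0 powR_ge0.
by rewrite (le_trans (ler_normB _ _)) // mulr_natl mulr2n lerD.
Qed.

Lemma integrable_trunc_diff x (rho : R) : 0 < rho -> integrable_rV (trunc_diff rho x).
Proof.
move=> r0; apply: (integrable_rV_le _ (integrable_rVZ (2 * M) (shifted_far_kernel x r0))).
  apply: measurable_funM; last exact: mfun_diff_kernel.
  apply: measurable_nat_of_bool; apply: measurable_fun_ler; first exact: measurable_cst.
  by apply: measurable_enorm; apply: mfun_rVB; [exact: mfun_rV_cst|exact: mfun_vec].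
move=> y; rewrite /trunc_diff /far_kernel normrM.
case: (leP rho (enorm (x - y))) => _; last by rewrite /= mulr0n normr0 !mul0r mulr0.
by rewrite /= mulr1n normr1 !mul1r norm_diff_kernel.
Qed.

Lemma frac_laplacian_eq_trunc x (l : R) : frac_laplacian_eq alpha u x l ->
  forall e, 0 < e -> exists2 d, 0 < d & forall rho, 0 < rho < d ->
    `|frac_const n alpha * trunc_int rho x - l| < e.
Proof.
move=> H e e0.
have [d /= d0 Hd] : \forall rho \near 0^'+, `|frac_const n alpha * trunc_int rho x - l| < e.
  have E : \forall rho \near (0 : R)^'+, ((frac_const n alpha)%:E *
    integral_rV [set y | (rho <= enorm (x - y))%R]
      (fun y => (diff_kernel alpha u x y)%:E))%E = (frac_const n alpha * trunc_int rho x)%:E.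
    near=> rho; have r0 : 0 < rho by near: rho; exact: nbhs_right_gt.
    rewrite (@integral_rV_indic R n.+1 _ _ (trunc_diff rho x)) ?EFinM //.
    - by move=> y /= h; rewrite /trunc_diff h /= mulr1n mul1r.
    - by move=> y /= /negP /negbTE h; rewrite /trunc_diff h /= mulr0n mul0r.
    - exact: integrable_trunc_diff.
  have : (frac_const n alpha * trunc_int rho x)%:E @[rho --> 0^'+] --> l%:E.
    by apply: cvg_trans H; apply: near_eq_cvg; apply: filterS E => rho ->.
  move=> /fine_cvg /= /cvgrPdist_lt /(_ e e0); apply: filterS => rho.
  by rewrite distrC.
exists d => // rho /andP[r0 rd]; apply: (Hd rho) => //=.
by rewrite sub0r normrN gtr0_norm.
Unshelve. all: by end_near.
Qed.

(** From a point of the lower half space the upper one is at distance at least - x_n, so the kernel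
    is never singular. *)
Lemma integrable_normal x : lastc x < 0 ->
  integrable_rV (fun y => (0 < lastc y)%R%:R * diff_kernel alpha u x y).
Proof.
move=> x0; have r0 : 0 < - lastc x by rewrite oppr_gt0.
apply: (integrable_rV_le _ (integrable_rVZ (2 * M) (shifted_far_kernel x r0))).
  apply: measurable_funM; last exact: mfun_diff_kernel.
  apply: measurable_nat_of_bool; apply: measurable_fun_ltr; first exact: measurable_cst.
  exact: mfun_vec.
move=> y; rewrite /far_kernel normrM.
have [y0|y0] := ltP 0 (lastc y); last first.
  rewrite /= mulr0n normr0 mul0r mulr_ge0 ?far_kernel_ge0 //.
  by rewrite mulr_ge0 // (le_trans _ (uM x)).
have -> : (- lastc x <= enorm (x - y)) = true.
  rewrite (le_trans _ (lastc_le_enorm _)) //.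
  rewrite (_ : lastc (x - y) = lastc x - lastc y); last by rewrite /lastc !mxE.
  by rewrite ler0_norm; lra.
by rewrite /= mulr1n normr1 !mul1r norm_diff_kernel.
Qed.

Lemma nonlocal_normal_int x (l : R) : lastc x < 0 -> nonlocal_normal alpha u x = l%:E ->
  frac_const n alpha * int_rV (fun y => (0 < lastc y)%R%:R * diff_kernel alpha u x y) = l.
Proof.
move=> x0; rewrite /nonlocal_normal (@integral_rV_indic R n.+1 _ _
  (fun y => (0 < lastc y)%R%:R * diff_kernel alpha u x y)).
- by rewrite -EFinM => -[].
- by move=> y /= ->; rewrite /= mulr1n mul1r.
- by move=> y /= /negP /negbTE ->; rewrite /= mulr0n mul0r.
- exact: integrable_normal.
Qed.

End bounded_function.
End fractional_operators.

(** * Reflections and the maximum principle *)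

Section reflections.
Variables (R : realType) (n : nat) (e : 'rV[R]_n).
Hypothesis e1 : dot e e = 1.
Implicit Types (x y : 'rV[R]_n) (lam : R).

Definition refl lam x : 'rV[R]_n := x + (2 * (lam - dot x e)) *: e.

Let lin x : 'rV[R]_n := refl 0 x.

Lemma dot_refl lam x : dot (refl lam x) e = 2 * lam - dot x e.
Proof. by rewrite /refl dotDl dotZl e1; ring. Qed.

Lemma reflK lam : involutive (refl lam).
Proof.
move=> x; rewrite {1}/refl dot_refl /refl -addrA -scalerDl.
by rewrite [X in X *: e](_ : _ = 0) ?scale0r ?addr0 //; ring.
Qed.

Lemma reflE lam x : refl lam x = lin x + (2 * lam) *: e.
Proof. by rewrite /lin /refl -addrA -scalerDl; congr (_ + _ *: _); ring. Qed.

Lemma enorm_reflB lam x y : enorm (refl lam x - refl lam y) = enorm (x - y).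
Proof.
have -> : refl lam x - refl lam y = x - y + (- 2 * dot (x - y) e) *: e.
  by rewrite dotDl dotNl; apply/rowP => i; rewrite !mxE; ring.
apply: eq_enorm; move: (x - y) => z.
by rewrite !(dotDl, dotDr, dotZl, dotZr) e1 (dotC e z); ring.
Qed.

(** The identity behind every kernel comparison: on one side of the plane the reflected point is
    farther, by an amount governed by both distances to the plane. *)
Lemma enorm_refl_sqr lam x y : enorm (x - refl lam y) ^+ 2 =
  enorm (x - y) ^+ 2 + 4 * (lam - dot x e) * (lam - dot y e).
Proof.
rewrite !enorm_sqr /refl !(dotDl, dotDr, dotNl, dotNr, dotZl, dotZr) e1.
rewrite (dotC e x) (dotC e y) (dotC y x); ring.
Qed.

Lemma refl_fixed lam x : dot x e = lam -> refl lam x = x.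
Proof. by move=> h; rewrite /refl h subrr mulr0 scale0r addr0. Qed.

Let linD : {morph lin : x y / x + y}.
Proof.
by move=> x y; rewrite /lin /refl dotDl; apply/rowP => i; rewrite !mxE; ring.
Qed.

Let linN x : enorm (lin x) = enorm x.
Proof.
apply: eq_enorm; rewrite /lin /refl !(dotDl, dotDr, dotZl, dotZr) e1 (dotC e x); ring.
Qed.

Let mlin : mfun_rV (lin \o @vec_of_tuple R n).
Proof.
apply: (mfun_rVD (@mfun_vec R n)); apply: mfun_rVZ; last exact: mfun_rV_cst.
apply: measurable_funM; first exact: measurable_cst.
apply: measurable_funB; first exact: measurable_cst.
by apply: measurable_dot; [exact: mfun_vec|exact: mfun_rV_cst].
Qed.

Lemma integrable_refl lam F : integrable_rV F -> integrable_rV (fun x => F (refl lam x)).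
Proof.
move=> iF; rewrite (_ : (fun x => _) = (fun x => F (lin x + (2 * lam) *: e))).
  exact: (integrable_rV_affine _ linD (reflK 0) linN mlin iF).
by apply/funext => x; rewrite reflE.
Qed.

Lemma int_refl lam F : integrable_rV F -> int_rV (fun x => F (refl lam x)) = int_rV F.
Proof.
move=> iF; rewrite -(int_rV_affine ((2 * lam) *: e) linD (reflK 0) linN mlin iF).
by congr int_rV; apply/funext => x; rewrite reflE.
Qed.

Lemma enorm_unit : enorm e = 1.
Proof. by apply/eqP; rewrite -(@eqrXn2 _ 2) ?enorm_ge0 // enorm_sqr e1 expr1n. Qed.

Lemma dot_unit_le x : `|dot x e| <= enorm x.
Proof. by have := normr_dot_le x e; rewrite enorm_unit mulr1. Qed.

Lemma enorm_refl_ge lam x y : dot x e <= lam -> dot y e <= lam ->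
  enorm (x - y) <= enorm (x - refl lam y).
Proof.
move=> xl yl; rewrite -(@ler_pXn2r _ 2) ?nnegrE ?enorm_ge0 //.
rewrite enorm_refl_sqr lerDl; apply: mulr_ge0; last by rewrite subr_ge0.
by apply: mulr_ge0; rewrite ?subr_ge0.
Qed.

Lemma enorm_refl_ge_dist lam x y : dot y e <= lam ->
  lam - dot x e <= enorm (x - refl lam y).
Proof.
move=> yl; rewrite enormB; apply: le_trans (dot_unit_le _).
apply: le_trans (ler_norm _); rewrite dotDl dotNl dot_refl; lra.
Qed.

(* The cube is centred at distance 2 d beyond the plane, so that it misses it. *)
Lemma cube_beyond lam x d z : (0 < n)%N -> 0 < d -> d = lam - dot x e ->
  cube (x + (3 * d) *: e) (d / n%:R) z -> lam < dot z e /\ enorm (x - z) <= 4 * d.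
Proof.
move=> n0 d0 dE /asboolP zc; set c := x + _ in zc.
have zd : enorm (z - c) <= d.
  have h i : `|(z - c) ord0 i| <= d / n%:R by rewrite mxE [X in _ + X]mxE; exact: zc.
  by rewrite (le_trans (enorm_le_coord h)) // mulrC divfK // pnatr_eq0 -lt0n.
have zE : z - x = (z - c) + (3 * d) *: e.
  by apply/rowP => i; rewrite /c !mxE; ring.
split.
  have := le_trans (dot_unit_le (z - c)) zd.
  rewrite ler_norml => /andP[h _].
  have : dot (z - x) e = dot (z - c) e + 3 * d by rewrite zE dotDl dotZl e1 mulr1.
  by rewrite dotDl dotNl; lra.
rewrite enormB zE (le_trans (enormD _ _)) // enormZ enorm_unit mulr1.
rewrite gtr0_norm ?mulr_gt0 //; lra.
Qed.

Lemma int_refl_sym lam F : integrable_rV F ->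
  integrable_rV (fun x => F x + F (refl lam x)) /\
  int_rV (fun x => F x + F (refl lam x)) = 2 * int_rV F.
Proof.
move=> iF; have iFr := integrable_refl lam iF; split; first exact: integrable_rVD.
by rewrite (int_rVD iF iFr) (int_refl lam iF) mulr_natl mulr2n.
Qed.

End reflections.

(** * Uniform convergence of the principal value *)

Section principal_value.
Variables (R : realType) (n : nat) (alpha theta : R).
Hypothesis alpha02 : 0 < alpha < 2.
Hypothesis theta_gt0 : 0 < theta.
Hypothesis theta_alpha : alpha - 1 < theta.
Variables (u : 'rV[R]_n.+1 -> R) (M : R).
Hypothesis uM : forall x, `|u x| <= M.
Hypothesis mu : mfun_on u.
Hypothesis Hu : C1_loc_holder theta u.

Let alpha_gt0 : 0 < alpha. Proof. by case/andP: alpha02. Qed.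
Let p : R := n.+1%:R + alpha.
Let beta : R := 1 + theta - alpha.
Let beta_gt0 : 0 < beta. Proof. by rewrite /beta subr_gt0 -ltrBlDl. Qed.

(** First differences only give |z|^(1 - n - alpha), not integrable for alpha >= 1. Symmetrising
    about x produces second differences and the kernel |z|^(beta - n), and beta > 0 is the
    hypothesis theta > alpha - 1. *)
Lemma trunc_int_near (r : R) : exists2 N : R, 0 <= N & forall x eps rho,
  enorm x <= r -> 0 < eps < rho -> rho <= 1 ->
  `|trunc_int alpha u eps x - trunc_int alpha u rho x| <= N * rho `^ beta.
Proof.
have [N1 N10 HN] := holder_second_difference theta_gt0 Hu r.
pose c : R := 4 ^+ n.+1 / (1 - (2 `^ beta)^-1).
have c0 : 0 <= c.
  rewrite divr_ge0 ?exprn_ge0 // subr_ge0.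
  by have /andP[_ /ltW] := powR_lt1 beta_gt0.
exists (2^-1 * (N1 * c)); first by apply: mulr_ge0 => //; exact: mulr_ge0.
move=> x eps rho xr /andP[eps0 epsrho] rho1.
have rho0 : 0 < rho by exact: lt_trans epsrho.
have ieps := integrable_trunc_diff alpha02 uM mu x eps0.
have irho := integrable_trunc_diff alpha02 uM mu x rho0.
pose D y := trunc_diff alpha u eps x y - trunc_diff alpha u rho x y.
have iD : integrable_rV D by exact: integrable_rVB.
have [iD' ID'] := integrable_rV_opp_affine (x + x) iD.
have [iK IK] := @integrable_near_kernel R n.+1 beta rho beta_gt0 rho0.
have [iK' IK'] := integrable_rV_opp_affine x iK.
have -> : trunc_int alpha u eps x - trunc_int alpha u rho x = int_rV D.
  exact: esym (int_rVB ieps irho).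
have -> : int_rV D = 2^-1 * int_rV (fun y => D y + D (x + x - y)).
  rewrite [X in _ * X](_ : _ = int_rV D + int_rV D); last first.
    by rewrite -[X in _ = _ + X]ID'; exact: int_rVD iD iD'.
  by move: (int_rV D) => v; field.
have h2 : (0 : R) < 2^-1 by rewrite invr_gt0.
rewrite normrM (gtr0_norm h2) -mulrA (ler_pM2l h2) -mulrA.
apply: (@le_trans _ _ (int_rV (fun y => N1 * near_kernel beta rho (x - y)))); last first.
  by rewrite (int_rVZ N1 iK') IK'; exact: ler_wpM2l.
apply: (norm_int_rV_le (integrable_rVD iD iD') (integrable_rVZ N1 iK')) => y.
rewrite /D /trunc_diff /diff_kernel /near_kernel.
have -> : x - (x + x - y) = - (x - y) by apply/rowP => i; rewrite !mxE; ring.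
rewrite enormN.
have [e1|e1] := leP eps (enorm (x - y)); last first.
  have -> : (rho <= enorm (x - y)) = false by apply/negbTE; rewrite -ltNge (lt_trans e1).
  by rewrite /= !mulr0n !mul0r !subr0 addr0 normr0 !mulr_ge0 ?invr_ge0 ?powR_ge0.
have s0 : 0 < enorm (x - y) by exact: lt_le_trans e1.
have [r1|r1] := leP rho (enorm (x - y)).
  by rewrite !subrr addr0 normr0 !mulr_ge0 ?invr_ge0 ?powR_ge0.
rewrite s0 /= mulr1n mulr0n !mul1r !mul0r !subr0 -mulrDl normrM.
rewrite normfV (ger0_norm (powR_ge0 _ _)).
have h := HN x (y - x) xr _.
have zr : enorm (y - x) <= 1 by rewrite enormB (le_trans (ltW r1)).
have := h zr; rewrite (_ : x + (y - x) = y); last by apply/rowP => i; rewrite !mxE; ring.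
rewrite (_ : x - (y - x) = x + x - y); last by apply/rowP => i; rewrite !mxE; ring.
rewrite enormB => {}h.
have -> : u x - u y + (u x - u (x + x - y)) = - (u y + u (x + x - y) - 2 * u x) by ring.
rewrite normrN (powR_ratio beta n.+1%:R s0).
rewrite (_ : beta - n.+1%:R = 1 + theta - p); last by rewrite /p /beta; ring.
rewrite -(powR_ratio _ _ s0) mulrA; apply: ler_wpM2r; last exact: h.
by rewrite invr_ge0 powR_ge0.
Qed.

(** The rate is uniform on bounded sets, so the point where the equation is evaluated may still move
    after rho has been fixed. *)
Lemma frac_laplacian_eq_near (r : R) : exists2 N : R, 0 <= N & forall x l rho,
  enorm x <= r -> 0 < rho <= 1 -> frac_laplacian_eq alpha u x l ->
  `|frac_const n alpha * trunc_int alpha u rho x - l| <= N * rho `^ beta.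
Proof.
have C0 := frac_const_gt0 n alpha02.
have [N N0 HN] := trunc_int_near r; exists (frac_const n alpha * N).
  by rewrite mulr_ge0 // ltW.
move=> x l rho xr /andP[rho0 rho1] Hl; apply/ler_addgt0Pr => d d0.
have [b b0 Hb] := frac_laplacian_eq_trunc alpha02 uM mu Hl d0.
pose eps := Num.min b rho / 2.
have m0 : 0 < Num.min b rho by rewrite lt_min b0.
have e0 : 0 < eps by rewrite divr_gt0.
have em : eps < Num.min b rho by rewrite /eps ltr_pdivrMr // ltr_pMr // ltr1n.
have [eb er] : eps < b /\ eps < rho by move: em; rewrite lt_min => /andP.
have h1 := Hb eps ltac:(by rewrite e0).
have h2 := HN x eps rho xr ltac:(by rewrite e0) rho1.
have -> : frac_const n alpha * trunc_int alpha u rho x - l =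
  (frac_const n alpha * trunc_int alpha u eps x - l) -
  frac_const n alpha * (trunc_int alpha u eps x - trunc_int alpha u rho x) by ring.
rewrite (le_trans (ler_normB _ _)) // addrC lerD ?(ltW h1) //.
by rewrite normrM gtr0_norm // -mulrA ler_pM2l.
Qed.

End principal_value.

(** * The truncated operator on an antisymmetric difference *)

Section reflected_difference.
Variables (R : realType) (n : nat) (alpha : R).
Hypothesis alpha02 : 0 < alpha < 2.
Variables (u : 'rV[R]_n.+1 -> R) (M : R).
Hypothesis uM : forall x, `|u x| <= M.
Hypothesis mu : mfun_on u.
Variables (e : 'rV[R]_n.+1) (lam : R).
Hypothesis e1 : dot e e = 1.

Let alpha_gt0 : 0 < alpha. Proof. by case/andP: alpha02. Qed.
Let p : R := n.+1%:R + alpha.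
Let p_gt0 : 0 < p. Proof. by rewrite addr_gt0. Qed.
Notation T := (refl e lam).
Let w y := u (T y) - u y.
Let K (s : R) : R := (s `^ p)^-1.

Let K_ge0 s : 0 <= K s.
Proof. by rewrite /K invr_ge0 powR_ge0. Qed.

Let K_le s t : 0 < s -> s <= t -> K t <= K s.
Proof.
move=> s0 st; have t0 := lt_le_trans s0 st.
by rewrite /K lef_pV2 ?posrE ?powR_gt0 // ler_powRl // ltW.
Qed.

Let far_in (rho : R) (z : 'rV[R]_n.+1) : rho <= enorm z -> far_kernel p rho z = K (enorm z).
Proof. by move=> h; rewrite /far_kernel h /= mulr1n mul1r. Qed.

Let far_out (rho : R) (z : 'rV[R]_n.+1) : enorm z < rho -> far_kernel p rho z = 0.
Proof. by move=> h; rewrite /far_kernel leNgt h /= mulr0n mul0r. Qed.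

(** A lower bound for the kernel mass beyond a plane at distance d: the kernel at distance 4 d times
    the volume of the cube of half side d / (n + 1) placed there. *)
Definition reflection_const (d : R) : R :=
  ((4 * d) `^ p)^-1 * (2 * (d / n.+1%:R)) ^+ n.+1.

Lemma reflection_constE d : 0 < d -> reflection_const d = reflection_const 1 / d `^ alpha.
Proof.
move=> d0; rewrite /reflection_const mulr1 mul1r.
have -> : (4 * d) `^ p = 4 `^ p * (d ^+ n.+1 * d `^ alpha).
  rewrite powRM ?(ltW d0) //; congr (_ * _).
  rewrite /p powRD; last by rewrite (gt_eqF d0) implybT.
  by rewrite powR_mulrn // ltW.
have -> : 2 * (d / n.+1%:R) = d * (2 / n.+1%:R) by rewrite mulrCA.
rewrite exprMn.
have A : d ^+ n.+1 != 0 by rewrite expf_neq0 // gt_eqF.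
have B : d `^ alpha != 0 by rewrite gt_eqF // powR_gt0.
have C : 4 `^ p != 0 :> R by rewrite gt_eqF // powR_gt0.
move: A B C; move: (d ^+ n.+1) (d `^ alpha) (4 `^ p) ((2 / n.+1%:R) ^+ n.+1) => X Y Z W A B C.
by field; rewrite A B C.
Qed.

Lemma reflection_const1_gt0 : 0 < reflection_const 1.
Proof. by rewrite mulr_gt0 ?invr_gt0 ?powR_gt0 ?exprn_gt0 ?mulr_gt0 ?divr_gt0 // !mulr_gt0. Qed.

Lemma refl_antisym y : w (T y) = - w y.
Proof. by rewrite /w reflK // opprB. Qed.

Let refl_beyond y : dot y e <= lam -> lam <= dot (T y) e.
Proof. by move=> yl; rewrite dot_refl //; lra. Qed.

Let refl_below y : lam < dot y e -> dot (T y) e <= lam.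
Proof. by move=> yl; rewrite dot_refl //; lra. Qed.

Let gE_le_closed (gE : 'rV[R]_n.+1 -> R) rho x m y :
  (forall y, lam <= dot y e -> gE y = 0) ->
  (forall y, dot y e < lam -> gE y <= (rho <= enorm (x - y))%R%:R *
     ((w y - m) * ((enorm (x - y) `^ p)^-1 - (enorm (x - T y) `^ p)^-1))) ->
  dot y e <= lam ->
  gE y <= (rho <= enorm (x - y))%R%:R *
     ((w y - m) * (K (enorm (x - y)) - K (enorm (x - T y)))).
Proof.
move=> g0 gle ylam; have [yl|yl] := ltP (dot y e) lam; first exact: gle.
have ye : dot y e = lam by apply/eqP; rewrite eq_le ylam yl.
by rewrite (g0 y yl) (refl_fixed ye) subrr !mulr0.
Qed.

(** As m <= 0, the term 2 m K may be dropped off the cube and is bounded on it by the smallest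
    kernel value. *)
Let cube_kernel_le (b : bool) (m d t : R) : m <= 0 -> 0 < d -> d <= t ->
  (b -> t <= 4 * d) -> 2 * m * K t <= 2 * m * ((4 * d) `^ p)^-1 * b%:R.
Proof.
move=> m0 d0 dt bt; have m20 : 2 * m <= 0 by rewrite pmulr_rle0.
case: b bt => [/(_ isT) t4|_] /=.
  by rewrite mulr1n mulr1; apply: ler_wnM2l => //; apply: K_le => //; exact: lt_le_trans dt.
by rewrite mulr0n mulr0 mulr_le0_ge0.
Qed.

(** Outside the ball this is the identity (wx - wy) Ks + (wx + wy) Kt = (wx - m) (Ks + Kt) - (wy -
    m) (Ks - Kt) + 2 m Kt, with g below the middle term. Inside the ball only the reflected point
    contributes, and osc replaces the missing kernel. *)
Let pointwise_bound (rho s t wx wy m osc fr fd kb g : R) :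
  0 <= osc -> 0 <= fd -> 2 * m * K t <= kb ->
  (rho <= s -> fr = K s) -> (s < rho -> fr = 0) -> (s < rho -> wy <= m + osc) ->
  g <= (rho <= s)%R%:R * ((wy - m) * (K s - K t)) ->
  (rho <= s)%R%:R * ((wx - wy) * K s) + (wx + wy) * K t <=
    (wx - m) * (fr + K t) + osc * (fd + K t) + kb - g.
Proof.
move=> osc0 fd0 hk hfr hfr0 hosc hg.
have ofd : 0 <= osc * fd by exact: mulr_ge0.
have oKt : 0 <= osc * K t by apply: mulr_ge0.
move: hfr hfr0 hosc hg; have [rs|rs] := leP rho s.
  move=> /(_ isT) -> _ _ /=; rewrite mulr1n !mul1r => hg.
  move: hk hg ofd oKt; move: (K s) (K t) => X Y; rewrite !mulrDr !mulrDl !mulNr !mulrN; lra.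
move=> _ /(_ isT) -> /(_ isT) h /=; rewrite mulr0n !mul0r add0r => hg.
have h2 : (wx + wy) * K t <= (wx - m + 2 * m + osc) * K t.
  by apply: ler_wpM2r => //; lra.
move: hk ofd oKt h2; move: (K t) => Y; rewrite !mulrDr !mulrDl !mulNr; lra.
Qed.

(* The integrand is paired at y and T y; gE is a quantitative gain, which yields
   the strict maximum principle. *)
Lemma reflected_trunc_le x d m osc rho (gE : 'rV[R]_n.+1 -> R) :
  d = lam - dot x e -> 0 < rho <= d -> m <= 0 -> 0 <= osc -> m <= w x ->
  (forall y, dot y e <= lam -> m <= w y) ->
  (forall y, enorm (x - y) < rho -> w y <= m + osc) ->
  integrable_rV gE -> (forall y, lam <= dot y e -> gE y = 0) ->
  (forall y, dot y e < lam -> gE y <= (rho <= enorm (x - y))%R%:R *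
     ((w y - m) * ((enorm (x - y) `^ p)^-1 - (enorm (x - T y) `^ p)^-1))) ->
  trunc_int alpha u rho (T x) - trunc_int alpha u rho x <=
    (w x - m) * int_rV (@far_kernel R n.+1 p rho) + osc * int_rV (@far_kernel R n.+1 p d) +
    2 * m * reflection_const d - int_rV gE.
Proof.
move=> dE /andP[rho0 rhod] m0 osc0 mwx mw wosc igE gE0 gEle.
have d0 : 0 < d := lt_le_trans rho0 rhod.
have iT := integrable_trunc_diff alpha02 uM mu (T x) rho0.
have iTT := integrable_refl e1 lam iT.
have ix := integrable_trunc_diff alpha02 uM mu x rho0.
pose G y := trunc_diff alpha u rho (T x) (T y) - trunc_diff alpha u rho x y.
have iG : integrable_rV G := integrable_rVB iTT ix.
have [iGT IGT] := int_refl_sym e1 lam iG.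
have ET : int_rV (fun y => trunc_diff alpha u rho (T x) (T y)) =
    trunc_int alpha u rho (T x) := int_refl e1 lam iT.
have EG : trunc_int alpha u rho (T x) - trunc_int alpha u rho x = int_rV G :=
  esym (etrans (int_rVB iTT ix) (f_equal2 (fun a b : R => a - b) ET (erefl _))).
pose c := x + (3 * d) *: e.
have r0 : 0 <= d / n.+1%:R := divr_ge0 (ltW d0) (ler0n R n.+1).
have iQ := integrable_cube c r0.
have iFr := shifted_far_kernel alpha02 x rho0.
have iFd := shifted_far_kernel alpha02 x d0.
pose b1 y := far_kernel p rho (x - y) + far_kernel p rho (x - T y).
pose b2 y := far_kernel p d (x - y) + far_kernel p d (x - T y).
pose b3 y : R := (cube c (d / n.+1%:R) y)%:R + (cube c (d / n.+1%:R) (T y))%:R.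
pose b4 y := gE y + gE (T y).
have ib1 : integrable_rV b1 := (int_refl_sym e1 lam iFr).1.
have ib2 : integrable_rV b2 := (int_refl_sym e1 lam iFd).1.
have ib3 : integrable_rV b3 := (int_refl_sym e1 lam iQ).1.
have ib4 : integrable_rV b4 := (int_refl_sym e1 lam igE).1.
have I1 : int_rV b1 = 2 * int_rV (@far_kernel R n.+1 p rho) :=
  etrans (int_refl_sym e1 lam iFr).2 (congr1 (fun z => 2 * z)
   (integrable_rV_opp_affine x (integrable_far_kernel n.+1 alpha_gt0 rho0)).2).
have I2 : int_rV b2 = 2 * int_rV (@far_kernel R n.+1 p d) :=
  etrans (int_refl_sym e1 lam iFd).2 (congr1 (fun z => 2 * z)
   (integrable_rV_opp_affine x (integrable_far_kernel n.+1 alpha_gt0 d0)).2).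
have I3 : int_rV b3 = 2 * (2 * (d / n.+1%:R)) ^+ n.+1 :=
  etrans (int_refl_sym e1 lam iQ).2 (congr1 (fun z => 2 * z) (int_cube c r0)).
have I4 : int_rV b4 = 2 * int_rV gE := (int_refl_sym e1 lam igE).2.
pose k := 2 * m * ((4 * d) `^ p)^-1.
pose B y := (w x - m) * b1 y + osc * b2 y + k * b3 y - b4 y.
have i1 := integrable_rVZ (w x - m) ib1.
have i2 := integrable_rVZ osc ib2.
have i3 := integrable_rVZ k ib3.
have i12 := integrable_rVD i1 i2.
have i123 := integrable_rVD i12 i3.
have iB : integrable_rV B := integrable_rVB i123 ib4.
have IB : int_rV B = 2 * ((w x - m) * int_rV (@far_kernel R n.+1 p rho) +
    osc * int_rV (@far_kernel R n.+1 p d) + 2 * m * reflection_const d - int_rV gE).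
  transitivity ((w x - m) * int_rV b1 + osc * int_rV b2 + k * int_rV b3 - int_rV b4).
    rewrite -(int_rVZ _ ib1) -(int_rVZ _ ib2) -(int_rVZ _ ib3).
    by rewrite -(int_rVD i1 i2) -(int_rVD i12 i3) -(int_rVB i123 ib4).
  rewrite I1 I2 I3 I4 /k /reflection_const; ring.
have TT y : T (T y) = y by exact: reflK.
have sy (F : 'rV[R]_n.+1 -> R) y : F (T y) + F (T (T y)) = F y + F (T y).
  by rewrite TT addrC.
(* Both sides of the pointwise bound are invariant under the reflection, so it is enough to prove it
   on one side of the plane. *)
have symB y : B (T y) = B y.
  have s1 : b1 (T y) = b1 y := sy (fun y => far_kernel p rho (x - y)) y.
  have s2 : b2 (T y) = b2 y := sy (fun y => far_kernel p d (x - y)) y.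
  have s3 : b3 (T y) = b3 y := sy (fun y => (cube c (d / n.+1%:R) y)%:R) y.
  have s4 : b4 (T y) = b4 y := sy gE y.
  by rewrite /B s1 s2 s3 s4.
have half y : dot y e <= lam -> G y + G (T y) <= B y.
  move=> ylam; pose s := enorm (x - y); pose t := enorm (x - T y).
  have GE z : G z = (rho <= enorm (x - z))%R%:R * ((w x - w z) * K (enorm (x - z))).
    rewrite /G /trunc_diff /diff_kernel (enorm_reflB e1) -mulrBr -mulrBl.
    congr (_ * (_ * _)); rewrite /w; ring.
  have gT0 : gE (T y) = 0 := gE0 _ (refl_beyond ylam).
  have gy := gE_le_closed gE0 gEle ylam.
  have b3y : (cube c (d / n.+1%:R) y) = false.
    by apply/negbTE/negP => /(cube_beyond e1 (ltn0Sn n) d0 dE)[]; rewrite ltNge ylam.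
  have dt : d <= t by rewrite dE; exact: enorm_refl_ge_dist.
  have kt : 2 * m * K t <= k * b3 y.
    have -> : b3 y = (cube c (d / n.+1%:R) (T y))%:R by rewrite /b3 b3y add0r.
    exact: cube_kernel_le m0 d0 dt (fun h => (cube_beyond e1 (ltn0Sn n) d0 dE h).2).
  have b1y : b1 y = far_kernel p rho (x - y) + K t.
    by congr (_ + _); exact: far_in (le_trans rhod dt).
  have b2y : b2 y = far_kernel p d (x - y) + K t.
    by congr (_ + _); exact: far_in dt.
  have GTy : G (T y) = (w x + w y) * K t.
    by rewrite GE refl_antisym opprK -/t (le_trans rhod dt) /= mulr1n mul1r.
  rewrite GTy GE /B b1y b2y /b4 gT0 addr0 -/s.
  exact: pointwise_bound osc0 (far_kernel_ge0 p d (x - y)) kt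
    (@far_in rho (x - y)) (@far_out rho (x - y)) (wosc y) gy.
have full y : G y + G (T y) <= B y.
  have [ylam|ylam] := leP (dot y e) lam; first exact: (half y ylam).
  by rewrite -(sy G y) -(symB y); exact: (half (T y) (refl_below ylam)).
have := le_int_rV iGT iB full.
have h2 : (0 : R) < 2 by exact: ltr0n.
by rewrite IGT IB EG (ler_pM2l h2).
Qed.

End reflected_difference.

(** * Weak and strong maximum principles up to the boundary *)

Section maximum_principle.
Variables (R : realType) (n : nat) (alpha theta : R).
Hypothesis alpha02 : 0 < alpha < 2.
Hypothesis theta_gt0 : 0 < theta.
Hypothesis theta_alpha : alpha - 1 < theta.
Variables (u F : 'rV[R]_n.+1 -> R) (M : R).
Hypothesis uM : forall x, `|u x| <= M.
Hypothesis mu : mfun_on u.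
Hypothesis Hu : C1_loc_holder theta u.
Hypothesis equ : forall x, 0 < lastc x -> frac_laplacian_eq alpha u x (F x).
Hypothesis cF : forall x eta, 0 < eta -> exists2 d, 0 < d &
  forall y, enorm (y - x) < d -> `|F y - F x| < eta.
Variables (e : 'rV[R]_n.+1) (lam : R).
Hypothesis e1 : dot e e = 1.
Hypothesis e_last : lastc e = 0.

Let p : R := n.+1%:R + alpha.
Notation T := (refl e lam).
Let w y := u (T y) - u y.

Let up (x : 'rV[R]_n.+1) (d : R) : 'rV[R]_n.+1 := x + d *: delta_mx ord0 ord_max.

Let dot_up x d : dot (up x d) e = dot x e.
Proof.
rewrite /up dotDl dotZl [X in _ * X](_ : _ = lastc e); last first.
  rewrite /dot (bigD1 ord_max) //= mxE !eqxx mul1r big1 ?addr0 // => i im.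
  by rewrite mxE (negbTE im) andbF mul0r.
by rewrite e_last mulr0 addr0.
Qed.

Let lastc_up x d : lastc (up x d) = lastc x + d.
Proof. by rewrite /lastc /up !mxE !eqxx mulr1. Qed.

Let enorm_up x d : 0 <= d -> enorm (up x d - x) = d.
Proof.
move=> d0; rewrite /up addrC addKr enormZ ger0_norm // [enorm _](_ : _ = 1) ?mulr1 //.
apply/eqP; rewrite -(@eqrXn2 _ 2) ?enorm_ge0 // enorm_sqr expr1n.
rewrite /dot (bigD1 ord_max) //= mxE !eqxx mul1r big1 ?addr0 // => i im.
by rewrite mxE (negbTE im) andbF mul0r.
Qed.

Lemma lastc_refl x : lastc (T x) = lastc x.
Proof. by rewrite /lastc /refl !mxE [e _ _]e_last mulr0 addr0. Qed.

Let refl_up x d : T (up x d) = up (T x) d.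
Proof. by rewrite /refl dot_up /up addrAC. Qed.

Lemma small_linear (A eta : R) : 0 <= A -> 0 < eta ->
  exists2 r, 0 < r & forall t, 0 < t -> t <= r -> A * t <= eta.
Proof.
move=> A0 eta0; have A1 : 0 < A + 1 by rewrite ltr_wpDl.
exists (eta / (A + 1)); first exact: divr_gt0.
move=> t t0; rewrite ler_pdivlMr // => h; apply: le_trans h.
by rewrite mulrC ler_pM2l // lerDl.
Qed.

Lemma small_powR (A b eta : R) : 0 <= A -> 0 < b -> 0 < eta ->
  exists2 r, 0 < r & forall t, 0 < t -> t <= r -> A * t `^ b <= eta.
Proof.
move=> A0 b0 eta0; have [r r0 h] := small_linear A0 eta0.
exists (r `^ b^-1); first exact: powR_gt0.
move=> t t0 tr; apply: h; first exact: powR_gt0.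
have := ler_powRl (ltW b0) (ltW t0) tr.
by rewrite -powRrM mulVf ?gt_eqF // powRr1 // ltW.
Qed.

Let w_lipschitz x0 : exists2 L, 0 <= L & forall y z,
  enorm (y - x0) <= 2 -> enorm (z - x0) <= 2 -> `|w y - w z| <= L * enorm (y - z).
Proof.
have [L L0 HL] := holder_lipschitz theta_gt0 Hu (enorm x0 + enorm (T x0) + 2).
exists (2 * L); first by rewrite mulr_ge0.
move=> y z yx zx.
have b v : enorm (v - x0) <= 2 -> enorm v <= enorm x0 + enorm (T x0) + 2.
  move=> h; have := enormD (v - x0) x0; rewrite subrK; have := enorm_ge0 (T x0); lra.
have bT v : enorm (v - x0) <= 2 -> enorm (T v) <= enorm x0 + enorm (T x0) + 2.
  rewrite -(enorm_reflB e1 lam) => h; have := enormD (T v - T x0) (T x0); rewrite subrK.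
  by have := enorm_ge0 x0; lra.
rewrite /w (_ : _ - _ = (u (T y) - u (T z)) - (u y - u z)); last by ring.
rewrite (le_trans (ler_normB _ _)) // mulr_natl mulr2n mulrDl lerD ?HL //; try exact: b; try exact: bT.
by rewrite -(enorm_reflB e1 lam); apply: HL; exact: bT.
Qed.

Let C := frac_const n alpha.

Let norm_aux (a b c t : R) : a <= t + b -> t <= 1 -> 0 <= c -> a <= b + c + 2.
Proof. by lra. Qed.

(** The five eta: one for each of the two moved right-hand sides, one for both principal values
    together, one for the rise of w at the moved point and one for its oscillation in the small
    ball. *)
Let combine (FT Fx FT' Fx' JT J CN eta r eps1 Ir osc Id mrc Ig : R) : 0 < r ->
  `|FT' - FT| < eta -> `|Fx' - Fx| < eta ->
  `|r * JT - FT'| <= CN -> `|r * J - Fx'| <= CN -> 2 * CN <= eta ->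
  JT - J <= eps1 * Ir + osc * Id + mrc - Ig ->
  r * (eps1 * Ir) <= eta -> r * (osc * Id) <= eta ->
  FT - Fx <= r * (mrc - Ig) + 5 * eta.
Proof.
move=> r0; rewrite !ltr_norml !ler_norml => /andP[a1 _] /andP[_ a2] /andP[a3 _] /andP[_ a4] a5.
move=> h b1 b2; have := ler_wpM2l (ltW r0) h; rewrite !mulrDr !mulrN; lra.
Qed.

(* The equation is used at x0 + delta e_n with delta > 0, so that x0 may lie on
   {x_n = 0}; rho is chosen first, then delta. *)
Lemma maximum_principle_gain x0 (gE : 'rV[R]_n.+1 -> R) r0 :
  dot x0 e < lam -> 0 <= lastc x0 -> w x0 <= 0 ->
  (forall y, dot y e < lam -> w x0 <= w y) ->
  integrable_rV gE -> (forall y, lam <= dot y e -> gE y = 0) -> 0 < r0 ->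
  (forall x rho, dot x e = dot x0 e -> enorm (x - x0) <= r0 -> 0 < rho <= r0 ->
     forall y, dot y e < lam -> gE y <= (rho <= enorm (x - y))%R%:R *
       ((w y - w x0) * ((enorm (x - y) `^ p)^-1 - (enorm (x - T y) `^ p)^-1))) ->
  F (T x0) - F x0 <= C * (2 * w x0 * reflection_const n alpha (lam - dot x0 e) - int_rV gE).
Proof.
move=> x0l x0N m0 mw igE gE0 r00 gEle.
set d := lam - dot x0 e.
have d0 : 0 < d by rewrite subr_gt0.
have C0 : 0 < C := frac_const_gt0 n alpha02.
have [L L0 HL] := w_lipschitz x0.
have [N N0 HN] := frac_laplacian_eq_near alpha02 theta_gt0 theta_alpha uM mu Hu
  (enorm x0 + enorm (T x0) + 2).
have b0 : 0 < 1 + theta - alpha by rewrite subr_gt0 -ltrBlDl.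
have Ifar rho : 0 <= int_rV (@far_kernel R n.+1 p rho).
  by apply: int_rV_ge0 => z; exact: far_kernel_ge0.
have mw' y : dot y e <= lam -> w x0 <= w y.
  rewrite le_eqVlt => /predU1P[ye|/mw //].
  by rewrite {2}/w (refl_fixed ye) subrr.
apply/ler_addgt0Pr => eta' eta'0; pose eta := eta' / 5.
have eta0 : 0 < eta by rewrite divr_gt0.
have -> : eta' = 5 * eta by rewrite /eta mulrC divfK.
clearbody eta.
have [r1 r10 H1] := small_linear (A := C * (2 * L) * int_rV (@far_kernel R n.+1 p d))
  (mulr_ge0 (mulr_ge0 (ltW C0) (mulr_ge0 (ler0n R 2) L0)) (Ifar d)) eta0.
have [r2 r20 H2] := small_powR (mulr_ge0 (ler0n R 2) N0) b0 eta0.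
pose rho := Num.min (Num.min 1 d) (Num.min r0 (Num.min r1 r2)).
have rho0 : 0 < rho by rewrite !lt_min ltr01 d0 r00 r10 r20.
have : rho <= rho by exact: lexx.
rewrite {2}/rho !le_min => /andP[/andP[rho1 rhod] /and3P[rhor0 rhor1 rhor2]].
clearbody rho.
(* The rise of w from x0 to the moved point is multiplied by the kernel mass outside the rho-ball,
   which blows up as rho tends to 0; hence delta depends on rho. *)
have [r3 r30 H3] := small_linear (A := C * L * int_rV (@far_kernel R n.+1 p rho))
  (mulr_ge0 (mulr_ge0 (ltW C0) L0) (Ifar rho)) eta0.
have [d1 d10 HF1] := cF x0 eta0.
have [d2 d20 HF2] := cF (T x0) eta0.
pose del := Num.min (Num.min rho r3) (Num.min d1 d2) / 2.
have mi0 : 0 < Num.min (Num.min rho r3) (Num.min d1 d2) by rewrite !lt_min rho0 r30 d10 d20.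
have del0 : 0 < del by rewrite divr_gt0.
have : del < Num.min (Num.min rho r3) (Num.min d1 d2).
  by rewrite /del ltr_pdivrMr // ltr_pMr // ltr1n.
rewrite !lt_min => /andP[/andP[delrho /ltW delr3] /andP[deld1 deld2]].
clearbody del.
pose x := up x0 del.
have xx0 : enorm (x - x0) = del by exact: enorm_up (ltW del0).
have TxE : T x = up (T x0) del := refl_up x0 del.
have Txx0 : enorm (T x - T x0) = del by rewrite TxE; exact: enorm_up (ltW del0).
have xe : dot x e = dot x0 e := dot_up x0 del.
have del1 : del <= 1 := ltW (lt_le_trans delrho rho1).
have lx : 0 < lastc x by rewrite lastc_up; exact: ltr_wpDl.
have lTx : 0 < lastc (T x) by rewrite lastc_refl.
have xr : enorm x <= enorm x0 + enorm (T x0) + 2.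
  have := enormD (x - x0) x0; rewrite subrK xx0 => h.
  exact: norm_aux h del1 (enorm_ge0 _).
have Txr : enorm (T x) <= enorm x0 + enorm (T x0) + 2.
  have := enormD (T x - T x0) (T x0); rewrite subrK Txx0 => h.
  by rewrite [X in X + 2]addrC; exact: norm_aux h del1 (enorm_ge0 _).
have rho01 : 0 < rho <= 1 by rewrite rho0 rho1.
have AT := HN _ _ rho Txr rho01 (equ lTx).
have A := HN _ _ rho xr rho01 (equ lx).
have x2 : enorm (x - x0) <= 2 by rewrite xx0; apply: le_trans del1 _; rewrite ler1n.
have x02 : enorm (x0 - x0) <= 2 by rewrite subrr enorm0.
have wx : w x - w x0 <= L * del.
  by have := HL x x0 x2 x02; rewrite xx0; exact: le_trans (ler_norm _).
have wosc y : enorm (x - y) < rho -> w y <= w x0 + 2 * L * rho.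
  move=> xy; have yx : enorm (y - x0) <= 2 * rho.
    apply: le_trans (enorm_triB y x x0) _; rewrite enormB xx0 mulr_natl mulr2n.
    by apply: lerD; exact: ltW.
  have y2 : enorm (y - x0) <= 2.
    apply: le_trans yx _; rewrite -[leRHS]mulr1; apply: ler_wpM2l => //.
  have := HL y x0 y2 x02 => h.
  rewrite -lerBlDl; apply: le_trans (ler_norm _) _; apply: le_trans h _.
  by rewrite (mulrC 2 L) -mulrA; exact: ler_wpM2l.
have dE : d = lam - dot x e by rewrite xe.
have core := reflected_trunc_le alpha02 uM mu e1 dE (introT andP (conj rho0 rhod)) m0
  (mulr_ge0 (mulr_ge0 (ler0n R 2) L0) (ltW rho0)) (mw x (eq_ind_r (fun z => z < lam) x0l xe))
  mw' wosc igE gE0 (gEle x rho xe (eq_ind_r (fun z => z <= r0) (ltW (lt_le_trans delrho rhor0)) xx0)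
    (introT andP (conj rho0 rhor0))).
have c1 : `|F (T x) - F (T x0)| < eta by apply: HF2; rewrite Txx0.
have c2 : `|F x - F x0| < eta by apply: HF1; rewrite xx0.
apply: (combine C0 c1 c2 AT A _ core _ _).
- by rewrite mulrA; exact: H2.
- apply: le_trans (H3 del del0 delr3).
  have -> : C * L * int_rV (@far_kernel R n.+1 p rho) * del =
    C * (L * del * int_rV (@far_kernel R n.+1 p rho)) by ring.
  rewrite (ler_pM2l C0); exact: (ler_wpM2r (Ifar rho) wx).
- apply: le_trans (H1 rho rho0 rhor1).
  by rewrite le_eqVlt; apply/orP; left; apply/eqP; ring.
Qed.

Let K_le s t : 0 < s -> s <= t -> (t `^ p)^-1 <= (s `^ p)^-1.
Proof.
move=> s0 st; have t0 := lt_le_trans s0 st.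
by rewrite lef_pV2 ?posrE ?powR_gt0 // ler_powRl ?(ltW s0) // ltW // addr_gt0 //; case/andP: alpha02.
Qed.

Lemma maximum_principle x0 :
  dot x0 e < lam -> 0 <= lastc x0 -> w x0 <= 0 ->
  (forall y, dot y e < lam -> w x0 <= w y) ->
  F (T x0) - F x0 <= C * (2 * w x0 * reflection_const n alpha (lam - dot x0 e)).
Proof.
(* The gain is taken to be zero, written as 0 times an indicator known to be integrable. *)
move=> x0l x0N m0 mw; pose c : 'rV[R]_n.+1 -> R := fun y => (cube 0 0 y)%:R.
have ic : integrable_rV c := integrable_cube 0 (lexx 0).
have i0 := integrable_rVZ 0 ic.
have := maximum_principle_gain x0l x0N m0 mw i0 (fun y _ => mul0r (c y)) ltr01 _.
rewrite (int_rVZ 0 ic) mul0r subr0; apply => x rho xe _ /andP[rho0 _] y yl.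
rewrite mul0r; case: (leP rho (enorm (x - y))) => [rs|_]; last by rewrite /= mulr0n mul0r.
rewrite /= mulr1n mul1r; apply: mulr_ge0; rewrite subr_ge0; first exact: mw.
apply: K_le; first exact: lt_le_trans rs.
by apply: (enorm_refl_ge e1); rewrite ?xe ltW.
Qed.

(** Since s^2 <= B, the additive gap c is a multiplicative one, t^2 >= (1 + c / B) s^2, and negative
    powers turn a ratio into a difference bounded below. No lower bound on s is needed. *)
Lemma kernel_gap (c B : R) : 0 < c -> 0 < B -> exists2 k, 0 < k & forall s t : R,
  0 < s -> 0 <= t -> s ^+ 2 + c <= t ^+ 2 -> t ^+ 2 <= B -> k <= (s `^ p)^-1 - (t `^ p)^-1.
Proof.
move=> c0 B0; pose q := p / 2.
have p0 : 0 < p by rewrite addr_gt0 //; case/andP: alpha02.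
have q0 : 0 < q by rewrite divr_gt0.
have sq t : 0 <= t -> t `^ p = (t ^+ 2) `^ q.
  by move=> t0; rewrite -(powR_mulrn 2 t0) -powRrM /q mulrCA divff // mulr1.
pose th := 1 + c / B.
have th1 : 1 < th by rewrite ltrDl divr_gt0.
have th0 : 0 < th := lt_trans ltr01 th1.
have thq : 1 < th `^ q.
  by rewrite -[ltLHS](congr1 (@^~ q) (@powR1 R)) gt0_ltr_powR ?nnegrE // ltW.
exists ((B `^ q)^-1 * (th `^ q - 1)); first by rewrite mulr_gt0 ?invr_gt0 ?powR_gt0 // subr_gt0.
move=> s t s0 t0 st tB; rewrite (sq s (ltW s0)) (sq t t0).
move: st tB; have a0 : 0 < s ^+ 2 by rewrite exprn_gt0.
move: (s ^+ 2) (t ^+ 2) a0 => a b a0 ab bB.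
have b0 : 0 < b by apply: lt_le_trans ab; rewrite addr_gt0.
have thb : a * th <= b.
  apply: (le_trans _ ab); rewrite /th mulrDr mulr1 lerD2l mulrCA ler_piMr ?(ltW c0) //.
  rewrite ler_pdivrMr // mul1r; apply: (le_trans _ bB); apply: (le_trans _ ab).
  by rewrite lerDl ltW.
have h : a `^ q * th `^ q <= b `^ q.
  by rewrite -powRM ?(ltW a0) ?(ltW th0) //; apply: ler_powRl; rewrite ?(ltW q0) // mulr_ge0 // ltW.
have aq : 0 < a `^ q by exact: powR_gt0.
have bq : 0 < b `^ q by exact: powR_gt0.
have Bq : 0 < B `^ q by exact: powR_gt0.
have h1 : (b `^ q)^-1 * th `^ q <= (a `^ q)^-1.
  by rewrite -(ler_pM2l aq) mulrA mulrAC divff ?gt_eqF // -ler_pdivlMr ?invr_gt0 // invrK mul1r.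
have h2 : (B `^ q)^-1 <= (b `^ q)^-1.
  by rewrite lef_pV2 ?posrE // ler_powRl // ltW.
apply: le_trans (_ : (b `^ q)^-1 * (th `^ q - 1) <= _).
  by apply: ler_wpM2r => //; rewrite subr_ge0 ltW.
by rewrite mulrBr mulr1 lerD2r.
Qed.

Let gap_bounds (s D A B d1 d2 : R) : D / 2 <= s -> s <= 2 * D -> 0 < D ->
  0 < A -> d1 / 2 <= B -> B <= 2 * d1 -> d2 = s ^+ 2 + 4 * A * B -> 0 < d1 ->
  [/\ 0 < s, s ^+ 2 + 2 * A * d1 <= d2 & d2 <= 4 * D ^+ 2 + 8 * A * d1].
Proof.
move=> s1 s2 D0 A0 B1 B2 -> d10.
have s0 : 0 < s by apply: lt_le_trans s1; rewrite divr_gt0.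
have h1 : A * (d1 / 2) <= A * B by rewrite ler_pM2l.
have h2 : A * B <= A * (2 * d1) by rewrite ler_pM2l.
have h3 : s ^+ 2 <= (2 * D) ^+ 2 by rewrite lerXn2r ?nnegrE ?(ltW s0) // mulr_ge0 // ltW.
split => //; first by lra.
by move: h3; rewrite exprMn; lra.
Qed.

Let lipschitz_half (wy w1 m a b : R) : `|wy - w1| <= a -> a <= b -> b <= (w1 - m) / 2 ->
  (w1 - m) / 2 <= wy - m.
Proof. by rewrite ler_norml => /andP[h1 _] h2 h3; lra. Qed.

(** The strict excess at y1 persists on a small cube by Lipschitz continuity and meets there a
    kernel gap bounded below; half the excess times the gap, on that cube, is the gain. *)
Lemma strong_maximum_principle x0 y1 :
  dot x0 e < lam -> 0 <= lastc x0 -> w x0 <= 0 ->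
  (forall y, dot y e < lam -> w x0 <= w y) ->
  dot y1 e < lam -> w x0 < w y1 ->
  F (T x0) - F x0 < C * (2 * w x0 * reflection_const n alpha (lam - dot x0 e)).
Proof.
move=> x0l x0N m0 mw y1l wy1.
have C0 : 0 < C := frac_const_gt0 n alpha02.
have D0 : 0 < enorm (y1 - x0).
  rewrite enorm_gt0 // subr_eq0; apply: contraTneq wy1 => ->; by rewrite ltxx.
have d0 : 0 < lam - dot x0 e by rewrite subr_gt0.
have d10 : 0 < lam - dot y1 e by rewrite subr_gt0.
have g0 : 0 < w y1 - w x0 by rewrite subr_gt0.
have [L L0 HL] := w_lipschitz y1.
have [r1 r10 H1] := small_linear L0 (divr_gt0 g0 (ltr0n R 2)).
have [k k0 Hk] := @kernel_gap (2 * (lam - dot x0 e) * (lam - dot y1 e))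
   (4 * enorm (y1 - x0) ^+ 2 + 8 * (lam - dot x0 e) * (lam - dot y1 e))
   ltac:(by rewrite !mulr_gt0) ltac:(by rewrite addr_gt0 ?mulr_gt0 // exprn_gt0).
(* In turn: stay where w is Lipschitz, stay at distance |y1 - x0| / 2 from all points near x0, stay
   strictly below the plane, and keep half of the excess of w. *)
have [r [r0 r2 rD rd rr1]] : exists r, [/\ 0 < r, r <= 2, r <= enorm (y1 - x0) / 4,
    r <= (lam - dot y1 e) / 2 & r <= r1].
  exists (Num.min (Num.min 2 (enorm (y1 - x0) / 4)) (Num.min ((lam - dot y1 e) / 2) r1)).
  split; last first; [by rewrite !ge_min lexx ?orbT..|].
  by rewrite !lt_min r10 ltr0n !divr_gt0.
pose c : 'rV[R]_n.+1 -> R := fun y => (cube y1 (r / n.+1%:R) y)%:R.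
have rn0 : 0 <= r / n.+1%:R := divr_ge0 (ltW r0) (ler0n R n.+1).
have rn0' : 0 < r / n.+1%:R := divr_gt0 r0 (ltr0Sn R n).
have ic : integrable_rV c := integrable_cube y1 rn0.
pose A := (w y1 - w x0) / 2 * k.
have A0 : 0 < A by rewrite mulr_gt0 // divr_gt0.
have iA := integrable_rVZ A ic.
have near y : cube y1 (r / n.+1%:R) y -> enorm (y - y1) <= r.
  move=> /asboolP h; have h' i : `|(y - y1) ord0 i| <= r / n.+1%:R by rewrite !mxE; exact: h.
  by apply: le_trans (enorm_le_coord h') _; rewrite mulrC divfK.
have dnear y : cube y1 (r / n.+1%:R) y -> `|dot y e - dot y1 e| <= r.
  by move=> /near; apply: le_trans; rewrite -dotNl -dotDl; exact: dot_unit_le.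
have rD0 : 0 < enorm (y1 - x0) / 4 by rewrite divr_gt0.
have gain := maximum_principle_gain x0l x0N m0 mw iA _ rD0 _.
apply: le_lt_trans (gain _ _) _; last first.
- rewrite ltr_pM2l // ltrBlDr ltrDl (int_rVZ A ic) (int_cube y1 rn0).
  by rewrite mulr_gt0 // exprn_gt0 // mulr_gt0.
- move=> x rho xe xx0 /andP[rho0 rhoD] y yl.
  rewrite /c; case: (boolP (cube _ _ y)) => [yc|_]; last first.
    rewrite /= mulr0n mulr0; case: (leP rho (enorm (x - y))) => [rs|_]; last by rewrite /= mulr0n mul0r.
    rewrite /= mulr1n mul1r; apply: mulr_ge0; rewrite subr_ge0; first exact: mw.
    apply: K_le; first exact: lt_le_trans rs.
    by apply: (enorm_refl_ge e1); rewrite ?xe ltW.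
  have yy1 := near y yc.
  have s2 : enorm (x - y) <= 2 * enorm (y1 - x0).
    have := enorm_triB x x0 y; have := enorm_triB x0 y1 y.
    rewrite (enormB x0 y1) (enormB y1 y); move: xx0 yy1 rD D0; lra.
  have s1 : enorm (y1 - x0) / 2 <= enorm (x - y).
    have := enorm_triB y1 y x0; have := enorm_triB y x x0.
    rewrite (enormB y1 y) (enormB y x); move: xx0 yy1 rD D0; lra.
  have dy := dnear y yc.
  have [B1 B2] : (lam - dot y1 e) / 2 <= lam - dot y e /\ lam - dot y e <= 2 * (lam - dot y1 e).
    by move: dy; rewrite ler_norml => /andP[]; move: rd d10; lra.
  have [s0 t1 t2] := gap_bounds s1 s2 D0 d0 B1 B2 (erefl _) d10.
  have Et := enorm_refl_sqr e1 lam x y; rewrite xe in Et; rewrite -Et in t1 t2.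
  have hk := Hk _ _ s0 (enorm_ge0 _) t1 t2.
  rewrite (le_trans rhoD _) /=; last by apply: le_trans s1; rewrite ler_pM2l // lef_pV2 ?posrE // ler_nat.
  rewrite mulr1n mul1r mulr1.
  have hw : (w y1 - w x0) / 2 <= w y - w x0.
    have h0 : enorm (y1 - y1) <= 2 by rewrite subrr enorm0.
    exact: lipschitz_half (HL y y1 (le_trans yy1 r2) h0) (ler_wpM2l L0 yy1) (H1 r r0 rr1).
  by apply: ler_pM => //; apply: ltW => //; rewrite divr_gt0.
- move=> y yl; rewrite /c; case: (boolP (cube _ _ y)) => [yc|_]; last by rewrite /= mulr0n mulr0.
  by have := dnear y yc; rewrite ler_norml => /andP[]; move: rd d10 yl; lra.
Qed.

End maximum_principle.

Lemma int_rV_le0 (R : realType) n (F : 'rV[R]_n -> R) : integrable_rV F ->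
  (forall x, F x <= 0) -> int_rV F <= 0.
Proof.
move=> iF F0; have : 0 <= int_rV (fun x => -1 * F x).
  by apply: int_rV_ge0 => x; rewrite mulN1r oppr_ge0.
by rewrite (int_rVZ _ iF) mulN1r oppr_ge0.
Qed.

(** * Comparison of nonlocal normal derivatives *)

Section normal_derivative.
Variables (R : realType) (n : nat) (alpha : R).
Hypothesis alpha02 : 0 < alpha < 2.
Variables (u : 'rV[R]_n.+1 -> R) (M : R).
Hypothesis uM : forall x, `|u x| <= M.
Hypothesis mu : mfun_on u.
Variables (e : 'rV[R]_n.+1) (lam : R).
Hypothesis e1 : dot e e = 1.
Hypothesis e_last : lastc e = 0.

Let p : R := n.+1%:R + alpha.
Notation T := (refl e lam).
Let w y := u (T y) - u y.

(** The left side equals 2 m Kt - (Y - m) (Ks - Kt). *)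
Let pair_le0 (X Y m Ks Kt : R) : m <= 0 -> m <= Y -> 0 <= Kt -> Kt <= Ks ->
  (m - Y) * Ks + (m + Y) * Kt <= 0.
Proof.
move=> m0 mY K0 KK.
have h1 : m * Kt <= 0 by rewrite mulr_le0_ge0.
have h2 : 0 <= (Y - m) * (Ks - Kt) by rewrite mulr_ge0 // subr_ge0.
by move: h1 h2; rewrite mulrBr !mulrBl !mulrDl; lra.
Qed.

Let inv_powR_le (s t : R) : 0 < s -> s <= t -> (t `^ p)^-1 <= (s `^ p)^-1.
Proof.
move=> s0 st; have p0 : 0 <= p by rewrite addr_ge0 //; case/andP: alpha02 => /ltW.
by rewrite lef_pV2 ?posrE ?powR_gt0 ?(lt_le_trans s0 st) // ler_powRl // ltW.
Qed.

Let refl_below y : lam < dot y e -> dot (T y) e <= lam.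
Proof. by move=> yl; rewrite dot_refl //; lra. Qed.

Let across (x y : 'rV[R]_n.+1) : lastc x < 0 -> 0 < lastc y -> 0 < enorm (x - y).
Proof.
move=> xN yN; apply: lt_le_trans (lastc_le_enorm _); rewrite normr_gt0.
rewrite (_ : lastc (x - y) = lastc x - lastc y); last by rewrite /lastc !mxE.
by rewrite subr_eq0 lt_eqF // (lt_trans xN).
Qed.

(** A horizontal direction leaves the half space of integration invariant, so y can again be paired
    with its image. The inequality is weak; the contradiction comes from strict monotonicity of
    h. *)
Lemma normal_derivative_min x (l lT : R) : dot x e < lam -> lastc x < 0 -> w x <= 0 ->
  (forall y, dot y e < lam -> w x <= w y) ->
  nonlocal_normal alpha u x = l%:E -> nonlocal_normal alpha u (T x) = lT%:E ->
  lT <= l.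
Proof.
move=> xl xN m0 mw El ElT.
have C0 : 0 < frac_const n alpha := frac_const_gt0 n alpha02.
have TxN : lastc (T x) < 0 by rewrite (lastc_refl lam e_last).
have <- := nonlocal_normal_int alpha02 uM mu xN El.
have <- := nonlocal_normal_int alpha02 uM mu TxN ElT.
rewrite (ler_pM2l C0) -subr_le0.
have ix := integrable_normal alpha02 uM mu xN.
have iTx := integrable_normal alpha02 uM mu TxN.
have iT := integrable_refl e1 lam iTx.
pose G y := (0 < lastc (T y))%R%:R * diff_kernel alpha u (T x) (T y) -
  (0 < lastc y)%R%:R * diff_kernel alpha u x y.
have iG : integrable_rV G := integrable_rVB iT ix.
have ET : int_rV (fun y => (0 < lastc (T y))%R%:R * diff_kernel alpha u (T x) (T y)) =
  int_rV (fun y => (0 < lastc y)%R%:R * diff_kernel alpha u (T x) y) := int_refl e1 lam iTx.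
have EG : int_rV G = _ := etrans (int_rVB iT ix) (f_equal2 (fun a b : R => a - b) ET (erefl _)).
rewrite -EG.
have [iS IS] := int_refl_sym e1 lam iG.
have h2 : (0 : R) < 2 by exact: ltr0n.
rewrite -(pmulr_rle0 _ h2) -IS; apply: (int_rV_le0 iS).
have TT y : T (T y) = y by exact: reflK.
have GE y : G y = (0 < lastc y)%R%:R * ((w x - w y) / enorm (x - y) `^ p).
  rewrite /G /diff_kernel (enorm_reflB e1) (lastc_refl lam e_last) -mulrBr -mulrBl.
  congr (_ * (_ * _)); rewrite /w; ring.
have half y : dot y e <= lam -> G y + G (T y) <= 0.
  have wT : w (T y) = - w y := refl_antisym u lam e1 y.
  move=> yl; rewrite !GE (lastc_refl lam e_last) -mulrDr wT opprK.
  case: (ltP 0 (lastc y)) => [yN|_]; last by rewrite /= mulr0n mul0r.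
  rewrite /= mulr1n mul1r.
  have a1 : w x <= w y.
    move: yl; rewrite le_eqVlt => /predU1P[ye|/mw h]; last exact: h.
    by rewrite {2}/w (refl_fixed ye) subrr.
  have a2 : 0 <= (enorm (x - T y) `^ p)^-1 by rewrite invr_ge0 powR_ge0.
  have s0 : 0 < enorm (x - y) := across xN yN.
  have st := enorm_refl_ge e1 (ltW xl) yl.
  exact: pair_le0 m0 a1 a2 (inv_powR_le s0 st).
move=> y; have [yl|yl] := leP (dot y e) lam; first exact: (half y yl).
by rewrite addrC -{2}(TT y); exact: (half _ (refl_below yl)).
Qed.

End normal_derivative.

(** * Cooperative systems and moving planes *)

Lemma far_bound (R : realType) (c K g : R) : 0 < c -> 0 <= K -> 0 < g ->
  exists N : R, forall s, 0 < s -> c * s `^ g <= K -> s <= N.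
Proof.
move=> c0 K0 g0; exists ((K / c) `^ g^-1) => s s0 sK.
have gi : 0 < g^-1 by rewrite invr_gt0.
have h : s `^ g <= K / c by rewrite ler_pdivlMr // mulrC.
have := ler_powRl (ltW gi) (powR_ge0 s g) h.
by rewrite -powRrM mulfV ?gt_eqF // powRr1 // ltW.
Qed.

(** Everything used about one equation and its boundary condition. The other equation is the same
    record with the unknowns, a and b, and the arguments of the nonlinearities exchanged, and s, r
    in place of p, q, so each estimate is proved once. *)
Record half_system (R : realType) (n : nat) (alpha theta mu M a b p q : R)
    (f h : R -> R -> R) (u v : 'rV[R]_n.+1 -> R) : Prop := HalfSystem {
  hs_alpha : 0 < alpha < 2;
  hs_theta : 0 < theta;
  hs_theta_alpha : alpha - 1 < theta;
  hs_f : C1_quadrant f;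
  hs_h : C1_quadrant h;
  hs_u : C1_loc_holder theta u;
  hs_v : C1_loc_holder theta v;
  hs_mfun : mfun_on u;
  hs_u0 : forall x, 0 < u x;
  hs_v0 : forall x, 0 < v x;
  hs_uM : forall x, u x <= M;
  hs_vM : forall x, v x <= M;
  hs_eq : forall x, 0 < lastc x -> frac_laplacian_eq alpha u x (f (u x) (v x));
  hs_bc : forall x, lastc x < 0 -> nonlocal_normal alpha u x = (h (u x) (v x))%:E;
  hs_a : 0 < a;
  hs_b : 0 < b;
  hs_p : 1 <= p;
  hs_q : 1 <= q;
  hs_decay : exists N : R, forall x, N < enorm x ->
    u x <= 1 / enorm x `^ a /\ v x <= 1 / enorm x `^ b;
  hs_small : near_origin (fun y z => partial1 f y z <= y `^ (p - 1) * z `^ q /\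
    partial2 f y z <= y `^ p * z `^ (q - 1));
  hs_expa : alpha < a * p + b * q - a;
  hs_expb : alpha < a * p + b * q - b;
  hs_f2 : forall y z : R, 0 < y -> 0 < z -> 0 < partial2 f y z;
  hs_h12 : forall y z : R, 0 < y -> 0 < z -> partial1 h y z < 0 /\ 0 < partial2 h y z;
  hs_mu : 0 < mu;
  hs_hmu : forall y z : R, 0 < y -> 0 < z -> mu * partial2 h y z <= - partial1 h y z }.

Lemma holder_continuous (R : realType) n (theta : R) (u : 'rV[R]_n -> R) :
  0 < theta -> C1_loc_holder theta u -> forall x eta, 0 < eta -> exists2 d, 0 < d &
    forall y, enorm (y - x) < d -> `|u y - u x| < eta.
Proof.
move=> t0 Hu x eta eta0; have [L L0 HL] := holder_lipschitz t0 Hu (enorm x + 1).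
exists (Num.min 1 (eta / (L + 1))).
  by rewrite lt_min ltr01 divr_gt0 // ltr_wpDl.
move=> y; rewrite lt_min => /andP[y1 yL].
have yx : enorm y <= enorm x + 1.
  by have := enormD (y - x) x; rewrite subrK; move: y1; lra.
have xx : enorm x <= enorm x + 1 by rewrite lerDl.
apply: le_lt_trans (HL y x yx xx) _.
move: yL; rewrite ltr_pdivlMr ?ltr_wpDl // => h; apply: le_lt_trans h.
by rewrite mulrC ler_wpM2l ?enorm_ge0 // lerDl.
Qed.

Section half_system_theory.
Variables (R : realType) (n : nat) (alpha theta mu M a b p q : R).
Variables (f h : R -> R -> R) (u v : 'rV[R]_n.+1 -> R).
Hypothesis HS : half_system alpha theta mu M a b p q f h u v.

Let F x := f (u x) (v x).
Let C := frac_const n alpha.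
Let C_gt0 : 0 < C := frac_const_gt0 n (hs_alpha HS).

Let norm_u x : `|u x| <= M.
Proof. by rewrite gtr0_norm ?(hs_u0 HS) // (hs_uM HS). Qed.

Let continuous_F x eta : 0 < eta -> exists2 d, 0 < d &
  forall y, enorm (y - x) < d -> `|F y - F x| < eta.
Proof.
move=> eta0.
have [d1 d10 H1] := C1_quadrant_continuous (hs_f HS) (hs_u0 HS x) (hs_v0 HS x) eta0.
have [d2 d20 H2] := holder_continuous (hs_theta HS) (hs_u HS) x d10.
have [d3 d30 H3] := holder_continuous (hs_theta HS) (hs_v HS) x d10.
exists (Num.min d2 d3); first by rewrite lt_min d20.
by move=> y; rewrite lt_min => /andP[h2 h3]; apply: H1; [exact: H2|exact: H3].
Qed.

Section direction.
Variables (e : 'rV[R]_n.+1) (lam : R).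
Hypothesis e1 : dot e e = 1.
Hypothesis e_last : lastc e = 0.
Notation T := (refl e lam).
Notation U y := (u (T y) - u y).
Notation V y := (v (T y) - v y).

Lemma minimum_upper_half x k : k < mu -> dot x e < lam -> U x < 0 ->
  (forall y, dot y e < lam -> U x <= U y) -> k * U x <= V x -> 0 <= lastc x.
Proof.
move=> kmu xl U0 mU kV; rewrite leNgt; apply/negP => xN.
have TxN : lastc (T x) < 0 by rewrite (lastc_refl lam e_last).
have := normal_derivative_min (hs_alpha HS) norm_u (hs_mfun HS) e1 e_last xl xN (ltW U0) mU
  (hs_bc HS xN) (hs_bc HS TxN).
apply/negP; rewrite -ltNge.
have muV : mu * U x < V x by apply: lt_le_trans kV; rewrite ltr_nM2r.
have := C1_quadrant_increasing (U := U x) (V := V x) (hs_h HS) (hs_mu HS) (hs_h12 HS) (hs_hmu HS)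
  (hs_u0 HS x) (hs_v0 HS x).
have -> : u x + U x = u (T x) by ring.
have -> : v x + V x = v (T x) by ring.
by apply => //; [exact: (hs_u0 HS)|exact: (hs_v0 HS)].
Qed.

(** The first argument is moved at v x and the second at u (T x): wherever the upper bounds are
    invoked the point lies below (u x, v x), so only decay at x matters. If V x > 0, cooperativity
    makes the second increment nonnegative. *)
Lemma nonlinearity_difference x k A B : 0 <= k -> U x < 0 -> k * U x <= V x -> 0 <= B ->
  (forall s t, 0 < s <= u x -> 0 < t <= v x -> partial1 f s t <= A /\ partial2 f s t <= B) ->
  (A + k * B) * U x <= F (T x) - F x.
Proof.
move=> k0 U0 kV B0 AB.
have uT0 := hs_u0 HS (T x); have vT0 := hs_v0 HS (T x).
have u0 := hs_u0 HS x; have v0 := hs_v0 HS x.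
have uu : u (T x) <= u x by rewrite -subr_le0 ltW.
have [c /andP[c1 c2] E1] := C1_quadrant_mvt1 (hs_f HS) uT0 uu v0.
have h1 : A * U x <= f (u (T x)) (v x) - f (u x) (v x).
  have [hA _] := AB c (v x) ltac:(by rewrite (lt_le_trans uT0 c1)) ltac:(by rewrite v0 lexx).
  rewrite -[f (u (T x)) _ - _]opprB E1 -[U x]opprB mulrN lerN2.
  by apply: ler_wpM2r => //; rewrite subr_ge0.
have h2 : k * B * U x <= f (u (T x)) (v (T x)) - f (u (T x)) (v x).
  have [vv|/ltW vv] := leP (v x) (v (T x)).
    have [d /andP[d1 d2] ->] := C1_quadrant_mvt2 (hs_f HS) v0 vv uT0.
    apply: (@le_trans _ _ 0); first by rewrite mulr_ge0_le0 ?mulr_ge0 // ltW.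
    by rewrite mulr_ge0 ?subr_ge0 // ltW // (hs_f2 HS) // (lt_le_trans v0).
  have [d /andP[d1 d2] E2] := C1_quadrant_mvt2 (hs_f HS) vT0 vv uT0.
  have [_ hB] := AB (u (T x)) d ltac:(by rewrite uT0) ltac:(by rewrite (lt_le_trans vT0 d1)).
  rewrite -[f (u (T x)) (v (T x)) - _]opprB E2 -mulrN opprB (mulrC k) -mulrA.
  apply: le_trans (ler_wpM2l B0 kV) _.
  by rewrite ler_wnM2r // subr_le0.
rewrite /F mulrDl; have -> : f (u (T x)) (v (T x)) - f (u x) (v x) =
  (f (u (T x)) (v x) - f (u x) (v x)) + (f (u (T x)) (v (T x)) - f (u (T x)) (v x)) by ring.
exact: lerD.
Qed.

(** Both bounds on F (T x) - F x are multiples of U x; dividing by it removes the unknown and leaves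
    a relation between partials and distance. *)
Lemma minimum_estimate x k A B : 0 <= k -> k < mu -> dot x e < lam -> U x < 0 ->
  (forall y, dot y e < lam -> U x <= U y) -> k * U x <= V x -> 0 <= B ->
  (forall s t, 0 < s <= u x -> 0 < t <= v x -> partial1 f s t <= A /\ partial2 f s t <= B) ->
  2 * C * reflection_const n alpha 1 <= (A + k * B) * (lam - dot x e) `^ alpha.
Proof.
move=> k0 kmu xl U0 mU kV B0 AB.
have xN := minimum_upper_half kmu xl U0 mU kV.
have h1 := maximum_principle (hs_alpha HS) (hs_theta HS) (hs_theta_alpha HS) norm_u
  (hs_mfun HS) (hs_u HS) (hs_eq HS) continuous_F e1 e_last xl xN (ltW U0) mU.
have h2 := le_trans (nonlinearity_difference k0 U0 kV B0 AB) h1.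
have d0 : 0 < lam - dot x e by rewrite subr_gt0.
have dp : 0 < (lam - dot x e) `^ alpha by exact: powR_gt0.
rewrite (reflection_constE n alpha d0) in h2.
rewrite -ler_pdivrMr // -(ler_nM2r U0); apply: le_trans h2 _.
by rewrite le_eqVlt; apply/orP; left; apply/eqP; rewrite /C; ring.
Qed.

(* The strict maximum principle forces U = 0, and its weak form at x then gives
   f (u, v o T) <= f (u, v), whence V x = 0. *)
Lemma touching x : (forall y, dot y e < lam -> 0 <= U y) ->
  (forall y, dot y e < lam -> 0 <= V y) -> dot x e < lam -> 0 <= lastc x -> U x = 0 ->
  (forall y, dot y e < lam -> U y = 0) /\ V x = 0.
Proof.
move=> U0 V0 xl xN Ux.
have mU y : dot y e < lam -> U x <= U y by rewrite Ux; exact: U0.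
have Ux0 : U x <= 0 by rewrite Ux.
have uT : u (T x) = u x by apply/eqP; rewrite -subr_eq0 Ux.
have vv : v x <= v (T x) by rewrite -subr_ge0; exact: V0.
have [d /andP[d1 d2] E] := C1_quadrant_mvt2 (hs_f HS) (hs_v0 HS x) vv (hs_u0 HS x).
have dp : 0 < partial2 f (u x) d by apply: (hs_f2 HS) (hs_u0 HS x) (lt_le_trans (hs_v0 HS x) d1).
have FE : F (T x) - F x = partial2 f (u x) d * V x by rewrite -E /F uT.
split.
  move=> y yl; apply/eqP; rewrite eq_le U0 // andbT leNgt; apply/negP => Uy.
  have := strong_maximum_principle (hs_alpha HS) (hs_theta HS) (hs_theta_alpha HS) norm_u
    (hs_mfun HS) (hs_u HS) (hs_eq HS) continuous_F e1 e_last xl xN Ux0 mU yl.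
  rewrite {1}Ux => /(_ Uy); rewrite Ux mulr0 mul0r mulr0.
  rewrite -[f _ _ - _]/(F (T x) - F x) FE ltNge mulr_ge0 ?subr_ge0 // ltW //.
have := maximum_principle (hs_alpha HS) (hs_theta HS) (hs_theta_alpha HS) norm_u
  (hs_mfun HS) (hs_u HS) (hs_eq HS) continuous_F e1 e_last xl xN Ux0 mU.
rewrite Ux mulr0 mul0r mulr0 -[f _ _ - _]/(F (T x) - F x) FE pmulr_rle0 // => h1.
by apply/eqP; rewrite eq_le h1 V0.
Qed.

End direction.

(* The two cases of (A + k B) d^alpha >= const: bounded partials keep the
   minimum away from the plane, their decay keeps it in a bounded set. *)
Lemma minimum_location k Lam : 0 <= k -> k < mu -> exists N d0 : R, 0 < d0 /\
  forall (e : 'rV[R]_n.+1) lam x, dot e e = 1 -> lastc e = 0 -> lam <= Lam ->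
    dot x e < lam -> u (refl e lam x) - u x < 0 ->
    (forall y, dot y e < lam -> u (refl e lam x) - u x <= u (refl e lam y) - u y) ->
    k * (u (refl e lam x) - u x) <= v (refl e lam x) - v x ->
    [/\ 0 <= lastc x, enorm x <= N & d0 <= lam - dot x e].
Proof.
move=> k0 kmu.
have al0 : 0 < alpha by case/andP: (hs_alpha HS).
pose c := 2 * C * reflection_const n alpha 1.
have c0 : 0 < c by rewrite !mulr_gt0 // reflection_const1_gt0 // (hs_alpha HS).
have k1 : 0 < 1 + k by rewrite ltr_pwDl.
have [M0 M00 HM] := C1_quadrant_partials_bounded M M (hs_f HS).
(* The distance at which (1 + k) M0 d^alpha could first reach c; the added 1 covers M0 = 0. *)
pose d0 := (c / ((1 + k) * M0 + 1)) `^ alpha^-1.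
have kM : 0 < (1 + k) * M0 + 1 by rewrite ltr_wpDl // mulr_ge0 // ltW.
have d00 : 0 < d0 by rewrite powR_gt0 // divr_gt0.
have [N1 HN1] := hs_decay HS.
have [del del0 Hdel] := hs_small HS.
(* The margin in (vii) for this equation; both partials decay at least like |x|^(- alpha - ga). *)
pose ga := Num.min (a * p + b * q - a) (a * p + b * q - b) - alpha.
have ga0 : 0 < ga by rewrite subr_gt0 lt_min (hs_expa HS) (hs_expb HS).
have [N2 HN2] : exists N2 : R, forall s, 0 < s -> del * s `^ a <= 1 -> s <= N2.
  by apply: far_bound => //; exact: (hs_a HS).
have [N3 HN3] : exists N3 : R, forall s, 0 < s -> del * s `^ b <= 1 -> s <= N3.
  by apply: far_bound => //; exact: (hs_b HS).
have [N4 HN4] : exists N4 : R, forall s, 0 < s -> c * s `^ ga <= (1 + k) * 2 `^ alpha -> s <= N4.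
  by apply: far_bound => //; rewrite mulr_ge0 ?powR_ge0 // ltW.
pose N := Num.max (Num.max 1 `|Lam|) (Num.max (Num.max `|N1| `|N2|) (Num.max `|N3| `|N4|)).
exists N, d0; split => // e lam x e1 el lamL xl U0 mU kV.
have est A B := minimum_estimate e1 el k0 kmu xl U0 mU kV (A := A) (B := B).
have d1 : 0 < lam - dot x e by rewrite subr_gt0.
split; first exact: (minimum_upper_half e1 el kmu xl U0 mU kV).
  rewrite leNgt; apply/negP; rewrite !gt_max => /andP[/andP[x1 xL] /andP[/andP[xN1 xN2] /andP[xN3 xN4]]].
  have x0 : 0 < enorm x := lt_trans ltr01 x1.
  have [ua vb] := HN1 x (le_lt_trans (ler_norm _) xN1).
  have small (s N' : R) : (forall s', 0 < s' -> del * s' `^ s <= 1 -> s' <= N') ->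
      `|N'| < enorm x -> 1 / enorm x `^ s < del.
    move=> HN' xN'; rewrite ltNge; apply/negP; rewrite ler_pdivlMr ?powR_gt0 // => /(HN' _ x0).
    by rewrite leNgt (le_lt_trans (ler_norm _) xN').
  have ud : u x < del := le_lt_trans ua (small _ _ HN2 xN2).
  have vd : v x < del := le_lt_trans vb (small _ _ HN3 xN3).
  pose W := (enorm x `^ (alpha + ga))^-1.
  have W0 : 0 <= W by rewrite invr_ge0 powR_ge0.
  have decay i j : 0 <= i -> 0 <= j -> alpha + ga <= a * i + b * j -> forall s t : R,
      0 < s <= u x -> 0 < t <= v x -> s `^ i * t `^ j <= W.
    move=> i0 j0 ij s t /andP[s0 su] /andP[t0 tv].
    apply: (@le_trans _ _ ((1 / enorm x `^ a) `^ i * (1 / enorm x `^ b) `^ j)).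
      apply: ler_pM; rewrite ?powR_ge0 //; apply: ler_powRl; rewrite ?(ltW s0) ?(ltW t0) //.
        exact: le_trans ua.
      exact: le_trans vb.
    rewrite !div1r -!powRN -!powRrM -powRD; last by rewrite (gt_eqF x0) implybT.
    by rewrite /W -powRN; apply: ler_powR; [exact: ltW|rewrite !mulNr -opprD lerN2].
  have p10 : 0 <= p - 1 by rewrite subr_ge0 (hs_p HS).
  have q10 : 0 <= q - 1 by rewrite subr_ge0 (hs_q HS).
  have p0 : 0 <= p := le_trans ler01 (hs_p HS).
  have q0 : 0 <= q := le_trans ler01 (hs_q HS).
  have gaa : alpha + ga <= a * p + b * q - a by rewrite /ga addrC subrK ge_min lexx.
  have gab : alpha + ga <= a * p + b * q - b by rewrite /ga addrC subrK ge_min lexx orbT.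
  have h1 : alpha + ga <= a * (p - 1) + b * q.
    have -> : a * (p - 1) + b * q = a * p + b * q - a by ring.
    exact: gaa.
  have h2 : alpha + ga <= a * p + b * (q - 1).
    have -> : a * p + b * (q - 1) = a * p + b * q - b by ring.
    exact: gab.
  have AB (s t : R) : 0 < s <= u x -> 0 < t <= v x -> partial1 f s t <= W /\ partial2 f s t <= W.
    move=> sx tx.
    have sd : 0 < s < del by have /andP[-> su] := sx; exact: le_lt_trans ud.
    have td : 0 < t < del by have /andP[-> tv] := tx; exact: le_lt_trans vd.
    have [g1 g2] := Hdel s t sd td.
    by split; [apply: le_trans g1 _|apply: le_trans g2 _]; exact: decay.
  have := est W W W0 AB.
  (* Beyond |Lam| the plane is at most |x| to the right of the origin, so the distance grows no
     faster than |x| and the margin decides. *)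
  have dx : lam - dot x e <= 2 * enorm x.
    have := dot_unit_le e1 x; have := ler_norm Lam; rewrite ler_norml.
    by move=> g1 /andP[g2 _]; move: g1 g2 lamL xL; lra.
  have dp : (lam - dot x e) `^ alpha <= (2 * enorm x) `^ alpha.
    by apply: ler_powRl => //; exact: ltW.
  move=> g; have : c <= (W + k * W) * (2 * enorm x) `^ alpha.
    apply: le_trans g _; apply: ler_wpM2l => //; by rewrite addr_ge0 // mulr_ge0.
  have -> : (W + k * W) * (2 * enorm x) `^ alpha = (1 + k) * 2 `^ alpha / enorm x `^ ga.
    rewrite /W powRM ?enorm_ge0 // powRD; last by rewrite (gt_eqF x0) implybT.
    have X : enorm x `^ alpha != 0 by rewrite gt_eqF // powR_gt0.
    have Y : enorm x `^ ga != 0 by rewrite gt_eqF // powR_gt0.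
    move: X Y; move: (enorm x `^ alpha) (enorm x `^ ga) (2 `^ alpha) => X Y Z X0 Y0.
    by field; rewrite X0 Y0.
  rewrite ler_pdivlMr ?powR_gt0 // => /(HN4 _ x0).
  by rewrite leNgt (le_lt_trans (ler_norm _) xN4).
have AB (s t : R) : 0 < s <= u x -> 0 < t <= v x -> partial1 f s t <= M0 /\ partial2 f s t <= M0.
  move=> /andP[s0 su] /andP[t0 tv]; apply: HM.
    by rewrite s0 (le_trans su) ?(hs_uM HS).
  by rewrite t0 (le_trans tv) ?(hs_vM HS).
have := est M0 M0 M00 AB; rewrite -/c => g.
have g' : c / ((1 + k) * M0 + 1) <= (lam - dot x e) `^ alpha.
  rewrite ler_pdivrMr //; apply: le_trans g _.
  rewrite mulrC; apply: ler_wpM2l; first exact: powR_ge0.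
  by rewrite mulrDl mul1r lerDl.
have ia : 0 <= alpha^-1 by rewrite invr_ge0 ltW.
have := ler_powRl ia (ltW (divr_gt0 c0 kM)) g'.
by rewrite -powRrM mulfV ?gt_eqF // powRr1 // ltW.
Qed.

End half_system_theory.

(** * Compactness and attained minima *)

Section euclidean_topology.
Variables (R : realType) (n : nat).
Implicit Types (F : 'rV[R]_n -> R).

Definition econtinuous F := forall x eta, 0 < eta -> exists2 d, 0 < d &
  forall y, enorm (y - x) < d -> `|F y - F x| < eta.

Lemma econtinuousW F : econtinuous F -> continuous F.
Proof.
move=> cF x A /nbhs_ballP[eta /= eta0 HA]; have [d d0 Hd] := cF x eta eta0.
have d1 : 0 < d / n.+1%:R by rewrite divr_gt0.
apply/nbhs_ballP; exists (d / n.+1%:R) => // y; rewrite -ball_normE /= => xy.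
apply: HA; rewrite /ball /=.
rewrite distrC; apply: Hd.
apply: (le_lt_trans (enorm_le_mx_norm _)).
apply: (@le_lt_trans _ _ (n.+1%:R * `|y - x|)); first by rewrite ler_wpM2r // ler_nat.
by rewrite mulrC -ltr_pdivlMr // distrC.
Qed.

Lemma econtinuous_lipschitz F (L : R) : 0 <= L ->
  (forall x y, `|F x - F y| <= L * enorm (x - y)) -> econtinuous F.
Proof.
move=> L0 HL x eta eta0; exists (eta / (L + 1)); first by rewrite divr_gt0 // ltr_wpDl.
move=> y; rewrite ltr_pdivlMr ?ltr_wpDl // => h; apply: le_lt_trans (HL y x) _.
by apply: le_lt_trans h; rewrite mulrC ler_wpM2l ?enorm_ge0 // lerDl.
Qed.

Lemma econtinuousB F G : econtinuous F -> econtinuous G -> econtinuous (fun x => F x - G x).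
Proof.
move=> cF cG x eta eta0; have e2 : 0 < eta / 2 by rewrite divr_gt0.
have [d1 d10 H1] := cF x _ e2; have [d2 d20 H2] := cG x _ e2.
exists (Num.min d1 d2) => [|y]; first by rewrite lt_min d10.
rewrite lt_min => /andP[/H1 h1 /H2 h2].
have -> : F y - G y - (F x - G x) = (F y - F x) - (G y - G x) by ring.
by rewrite (le_lt_trans (ler_normB _ _)) // (splitr eta) ltrD.
Qed.

Lemma econtinuous_enorm : econtinuous (@enorm R n).
Proof.
apply: (econtinuous_lipschitz ler01) => x y; rewrite mul1r ler_norml ler_enormB andbT.
by rewrite lerNl opprB enormB ler_enormB.
Qed.

Lemma econtinuous_dot e : econtinuous (fun x => dot x e).
Proof.
apply: (econtinuous_lipschitz (enorm_ge0 e)) => x y.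
by rewrite -dotNl -dotDl mulrC normr_dot_le.
Qed.

Lemma closed_sublevel F c : econtinuous F -> closed [set x | F x <= c].
Proof.
move=> cF; apply: (@preimage_closed _ _ F [set t | t <= c]); last exact: closed_le.
by move=> x _; exact: econtinuousW.
Qed.

Lemma compact_enorm (A : set 'rV[R]_n) (N : R) : closed A ->
  (forall x, A x -> enorm x <= N) -> compact A.
Proof.
move=> cA AN; apply: bounded_closed_compact => //.
exists N; split; first exact: num_real.
move=> m Nm x Ax /=; apply: le_trans (mx_norm_le_enorm _) _.
exact: le_trans (AN x Ax) (ltW Nm).
Qed.

Lemma compact_min F (A : set 'rV[R]_n) : A !=set0 -> compact A -> econtinuous F ->
  exists2 c, A c & forall x, A x -> F c <= F x.
Proof.
move=> A0 cA cF; have [|c cA' Hc] := compact_EVT_min A0 cA (f := F).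
  by apply: continuous_subspaceT => x; exact: econtinuousW.
by exists c; [rewrite inE in cA'|move=> x Ax; apply: Hc; rewrite inE].
Qed.

Lemma compact_positive_min F (A : set 'rV[R]_n) : compact A -> econtinuous F ->
  (forall x, A x -> 0 < F x) -> exists2 m, 0 < m & forall x, A x -> m <= F x.
Proof.
move=> cA cF F0; have [A0|A0] := pselect (A !=set0).
  by have [c Ac Hc] := compact_min A0 cA cF; exists (F c) => //; exact: F0.
by exists 1 => // x Ax; exfalso; apply: A0; exists x.
Qed.

Lemma econtinuous_refl F e lam : dot e e = 1 -> econtinuous F ->
  econtinuous (fun x => F (refl e lam x) - F x).
Proof.
move=> e1 cF; apply: (econtinuousB _ cF) => x eta eta0.
have [d d0 Hd] := cF (refl e lam x) eta eta0; exists d => // y yx.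
by apply: Hd; rewrite (enorm_reflB e1).
Qed.

Lemma reflB_lam e lam lam' (x : 'rV[R]_n) : dot e e = 1 ->
  enorm (refl e lam x - refl e lam' x) = 2 * `|lam - lam'|.
Proof.
move=> e1; have -> : refl e lam x - refl e lam' x = (2 * (lam - lam')) *: e.
  by rewrite /refl; apply/rowP => i; rewrite !mxE; ring.
by rewrite enormZ (enorm_unit e1) mulr1 normrM ger0_norm.
Qed.

Definition vanishing F := forall eta, 0 < eta -> exists N : R, forall x, N < enorm x -> F x < eta.

(** Far out u y is below the depth of the given negative value, and u > 0 at the image bounds the
    difference from below by - u y; the minimum over a large ball is therefore global. It is off the
    plane, where the difference is 0. *)
Lemma negative_minimum (u : 'rV[R]_n -> R) e lam y0 : dot e e = 1 ->
  econtinuous u -> (forall x, 0 < u x) -> vanishing u ->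
  dot y0 e < lam -> u (refl e lam y0) - u y0 < 0 ->
  exists x, [/\ dot x e < lam, u (refl e lam x) - u x < 0 &
    forall y, dot y e < lam -> u (refl e lam x) - u x <= u (refl e lam y) - u y].
Proof.
move=> e1 cu u0 vu y0l U0.
have [N HN] := vu (u y0 - u (refl e lam y0)) ltac:(by rewrite subr_gt0 -subr_lt0).
pose r := Num.max N (enorm y0).
pose A : set 'rV[R]_n := [set x | dot x e <= lam] `&` [set x | enorm x <= r].
have cA : compact A.
  apply: (@compact_enorm _ r); last by move=> x [].
  by apply: closedI; apply: closed_sublevel; [exact: econtinuous_dot|exact: econtinuous_enorm].
have Ay0 : A y0 by split; [exact: ltW|rewrite /= /r le_max lexx orbT].
have cU := econtinuous_refl lam e1 cu.
have [c [cl _] Hc] := compact_min (ex_intro _ y0 Ay0) cA cU.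
have Uc : u (refl e lam c) - u c < 0 := le_lt_trans (Hc y0 Ay0) U0.
exists c; split => //.
  move: cl; rewrite /= le_eqVlt => /predU1P[ce|//].
  by move: Uc; rewrite (refl_fixed ce) subrr ltxx.
move=> y yl; have [yr|yr] := leP (enorm y) r; first by apply: Hc; split => //; exact: ltW.
have /HN h : N < enorm y by apply: le_lt_trans yr; rewrite /r le_max lexx.
by have := Hc y0 Ay0; have := u0 (refl e lam y); move: h; lra.
Qed.

End euclidean_topology.

Lemma decay_vanishing (R : realType) n (u : 'rV[R]_n -> R) (c N : R) : 0 < c ->
  (forall x, N < enorm x -> u x <= 1 / enorm x `^ c) -> vanishing u.
Proof.
move=> c0 uc eta eta0; have [N' HN] := far_bound eta0 ler01 c0.
exists (Num.max 0 (Num.max N N')) => x; rewrite !gt_max => /and3P[x0 x1 x2].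
apply: le_lt_trans (uc x x1) _.
rewrite ltNge; apply/negP; rewrite ler_pdivlMr ?powR_gt0 // => /(HN _ x0).
by rewrite leNgt x2.
Qed.

Lemma half_system_vanishing (R : realType) n (alpha theta mu M a b p q : R) f h u v :
  @half_system R n alpha theta mu M a b p q f h u v -> vanishing u.
Proof.
move=> HS; have [N HN] := hs_decay HS.
by apply: (decay_vanishing (hs_a HS)) => x /HN[].
Qed.

(** * The moving plane procedure in a fixed direction *)

Section moving_planes.
Variables (R : realType) (n : nat) (alpha theta mu nu M a b p q r s : R).
Variables (f g h l : R -> R -> R) (u v : 'rV[R]_n.+1 -> R).
Hypothesis HU : half_system alpha theta mu M a b p q f h u v.
Hypothesis HV : half_system alpha theta nu M b a s r
  (fun y z => g z y) (fun y z => l z y) v u.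
Hypothesis munu : 1 < mu * nu.
Variable e : 'rV[R]_n.+1.
Hypothesis e1 : dot e e = 1.
Hypothesis e_last : lastc e = 0.

Notation T := (refl e).
Notation U lam y := (u (T lam y) - u y).
Notation V lam y := (v (T lam y) - v y).

Let cu : econtinuous u := holder_continuous (hs_theta HU) (hs_u HU).
Let cv : econtinuous v := holder_continuous (hs_theta HV) (hs_u HV).
Let vu : vanishing u := half_system_vanishing HU.
Let vv : vanishing v := half_system_vanishing HV.

Definition ordered lam := forall y, dot y e < lam -> 0 <= U lam y /\ 0 <= V lam y.

(* 1/nu < k < mu, so that a minimum of U dominating V up to the factor k, or of V
   dominating U up to 1/k, is excluded in the lower half space. *)
Lemma weight_exists : exists k : R, [/\ 0 < k, k < mu & k^-1 < nu].
Proof.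
have mu0 := hs_mu HU; have nu0 := hs_mu HV.
have nm : nu^-1 < mu by rewrite -(ltr_pM2r nu0) mulVf ?gt_eqF.
exists ((nu^-1 + mu) / 2); have [m1 m2] := midf_lt nm.
have m0 : 0 < (nu^-1 + mu) / 2 by apply: lt_trans m1; rewrite invr_gt0.
by split => //; rewrite -[ltRHS]invrK ltf_pV2 ?posrE ?invr_gt0.
Qed.

(** Failure of the ordering is always witnessed in a fixed bounded set, away from the plane. This
    one statement both starts the procedure and lets it pass the supremum. *)
Lemma bad_point (Lam : R) : exists N d0 : R, 0 < d0 /\ forall lam, lam <= Lam ->
  ~ ordered lam -> exists x, [/\ dot x e < lam, 0 <= lastc x, enorm x <= N,
    d0 <= lam - dot x e & U lam x < 0 \/ V lam x < 0].
Proof.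
have [k [k0 kmu knu]] := weight_exists.
have [N1 [d1 [d10 H1]]] := minimum_location HU Lam (ltW k0) kmu.
have ki0 : 0 <= k^-1 by rewrite invr_ge0 ltW.
have [N2 [d2 [d20 H2]]] := minimum_location HV Lam ki0 knu.
exists (Num.max N1 N2), (Num.min d1 d2); split; first by rewrite lt_min d10.
move=> lam lamL nP.
have caseU x : dot x e < lam -> U lam x < 0 ->
    (forall y, dot y e < lam -> U lam x <= U lam y) -> k * U lam x <= V lam x ->
    exists x, [/\ dot x e < lam, 0 <= lastc x, enorm x <= Num.max N1 N2,
      Num.min d1 d2 <= lam - dot x e & U lam x < 0 \/ V lam x < 0].
  move=> xl U0 mU kV; have [xN xn xd] := H1 e lam x e1 e_last lamL xl U0 mU kV.
  by exists x; split => //; [rewrite le_max xn|rewrite ge_min xd|left].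
have caseV x : dot x e < lam -> V lam x < 0 ->
    (forall y, dot y e < lam -> V lam x <= V lam y) -> k^-1 * V lam x <= U lam x ->
    exists x, [/\ dot x e < lam, 0 <= lastc x, enorm x <= Num.max N1 N2,
      Num.min d1 d2 <= lam - dot x e & U lam x < 0 \/ V lam x < 0].
  move=> xl V0 mV kU; have [xN xn xd] := H2 e lam x e1 e_last lamL xl V0 mV kU.
  by exists x; split => //; [rewrite le_max xn orbT|rewrite ge_min xd orbT|right].
have [[y0 [y0l Uy0]]|nU] := pselect (exists y0, dot y0 e < lam /\ U lam y0 < 0).
  have [x [xl U0 mU]] := negative_minimum e1 cu (hs_u0 HU) vu y0l Uy0.
  have [kV|kV] := leP (k * U lam x) (V lam x); first exact: (caseU x).
  have Vx0 : V lam x < 0 by apply: lt_trans kV _; rewrite pmulr_rlt0.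
  (* At the minimum z of V one has V z <= V x < k U x <= k U z, so the reversed domination holds. *)
  have [z [zl V0 mV]] := negative_minimum e1 cv (hs_u0 HV) vv xl Vx0.
  apply: (caseV z) => //; apply: le_trans (mU z zl).
  rewrite -(ler_pM2l k0) mulrA divff ?gt_eqF // mul1r.
  by apply: le_trans (mV x xl) _; exact: ltW.
have U0 y : dot y e < lam -> 0 <= U lam y.
  by move=> yl; rewrite leNgt; apply/negP => Uy; apply: nU; exists y.
have [[y0 [y0l Vy0]]|nV] := pselect (exists y0, dot y0 e < lam /\ V lam y0 < 0).
  have [x [xl V0 mV]] := negative_minimum e1 cv (hs_u0 HV) vv y0l Vy0.
  apply: (caseV x) => //; apply: le_trans (U0 x xl).
  by rewrite mulr_ge0_le0 // ltW.
exfalso; apply: nP => y yl; split; first exact: U0.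
by rewrite leNgt; apply/negP => Vy; apply: nV; exists y.
Qed.

Lemma ordered_far : exists L : R, forall lam, lam <= L -> ordered lam.
Proof.
have [N [d0 [d00 H]]] := bad_point 0.
exists (- (`|N| + 1)) => lam lamN; apply: contrapT => nP.
have l0 : lam <= 0 by apply: le_trans lamN _; rewrite oppr_le0 addr_ge0.
have [x [xl _ xN _ _]] := H lam l0 nP.
have := le_trans (dot_unit_le e1 x) xN; rewrite ler_norml => /andP[h1 _].
by have := ler_norm N; move: lamN xl h1; lra.
Qed.

Definition ordered_below : set R := [set lam | forall lam', lam' <= lam -> ordered lam'].

(** Ordering at the origin would say u (2 lam e) >= u 0, against decay. *)
Lemma ordered_below_bounded : exists N : R, forall lam, ordered_below lam -> lam <= N.
Proof.
have [N HN] := vu (hs_u0 HU 0).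
exists (Num.max 0 N) => lam Hlam; rewrite leNgt gt_max; apply/negP => /andP[l0 lN].
have z0 : dot (0 : 'rV[R]_n.+1) e < lam by rewrite dot0l.
have [+ _] := Hlam lam (lexx _) 0 z0; rewrite subr_ge0 leNgt => /negP; apply.
apply: HN; rewrite /refl dot0l subr0 add0r enormZ (enorm_unit e1) mulr1.
rewrite ger0_norm ?mulr_ge0 // ?(ltW l0) //; move: l0 lN; lra.
Qed.

Let lam0 := sup ordered_below.

Let has_sup_below : has_sup ordered_below.
Proof.
have [L HL] := ordered_far; have [N HN] := ordered_below_bounded.
split; first by exists L => lam'; exact: HL.
by exists N => lam; exact: HN.
Qed.

Let ordered_lt lam : lam < lam0 -> ordered lam.
Proof.
move=> ll; have d0 : 0 < lam0 - lam by rewrite subr_gt0.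
have [z zS] := sup_adherent d0 has_sup_below.
by rewrite opprB addrCA subrr addr0 => /ltW; exact: zS.
Qed.

Let limit_ge0 (w : 'rV[R]_n.+1 -> R) y : econtinuous w -> dot y e < lam0 ->
  (forall lam, dot y e < lam -> lam < lam0 -> 0 <= w (T lam y) - w y) ->
  0 <= w (T lam0 y) - w y.
Proof.
move=> cw yl H; rewrite -[leLHS](subrr (w y)) lerD2r; apply/ler_addgt0Pr => eta eta0.
have [d d0 Hd] := cw (T lam0 y) eta eta0.
pose t := Num.min (d / 4) ((lam0 - dot y e) / 2).
have t0 : 0 < t by rewrite lt_min !divr_gt0 // subr_gt0.
have [td tl] : t <= d / 4 /\ t <= (lam0 - dot y e) / 2 by rewrite !ge_min !lexx orbT.
have := H (lam0 - t) ltac:(by move: tl yl; lra) ltac:(by rewrite gtrBl).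
have : enorm (T (lam0 - t) y - T lam0 y) < d.
  rewrite (reflB_lam _ _ _ e1) addrAC subrr add0r normrN gtr0_norm //; move: td d0; lra.
by move=> /Hd; rewrite ltr_norml => /andP[_ h1]; rewrite subr_ge0; move: h1; lra.
Qed.

Let ordered_lam0 : ordered lam0.
Proof.
move=> y yl; split.
  by apply: (limit_ge0 cu yl) => lam ll /ordered_lt /(_ y ll)[].
by apply: (limit_ge0 cv yl) => lam ll /ordered_lt /(_ y ll)[].
Qed.

Let no_progress t : 0 < t -> ~ (forall lam, lam0 < lam -> lam < lam0 + t -> ordered lam).
Proof.
move=> t0 H.
have : ordered_below (lam0 + t / 2).
  move=> lam lamt; have [ll|ll|->] := ltgtP lam lam0; [exact: ordered_lt| |exact: ordered_lam0].
  by apply: H => //; apply: le_lt_trans lamt _; rewrite ltrD2l ltr_pdivrMr // ltr_pMr // ltr1n.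
move=> /(sup_upper_bound has_sup_below); rewrite -/lam0 leNgt ltrDl divr_gt0 //.
Qed.

(** On a compact set the positive difference has a positive minimum, and moving the plane by t moves
    every reflected point by 2 t; the local Lipschitz bound does the rest. *)
Let persistence (w : 'rV[R]_n.+1 -> R) (A : set 'rV[R]_n.+1) N : 0 < theta ->
  C1_loc_holder theta w -> compact A -> (forall x, A x -> enorm x <= N) ->
  (forall x, A x -> 0 < w (T lam0 x) - w x) ->
  exists2 t, 0 < t & forall lam x, lam0 < lam -> lam < lam0 + t -> A x ->
    0 < w (T lam x) - w x.
Proof.
move=> t0 Hw cA AN Aw; have cw := holder_continuous t0 Hw.
have [m m0 Hm] := compact_positive_min cA (econtinuous_refl lam0 e1 cw) Aw.
(* This ball contains the images of A in all planes within distance 1 of the critical one. *)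
have [L L0 HL] := holder_lipschitz t0 Hw (N + 2 * (`|lam0| + 1 + N)).
exists (Num.min 1 (m / (2 * L + 1))).
  by rewrite lt_min ltr01 divr_gt0 // ltr_wpDl // mulr_ge0.
move=> lam x l1; rewrite -ltrBlDl lt_min => /andP[l2 l3] Ax.
have bnd lam' : `|lam'| <= `|lam0| + 1 -> enorm (T lam' x) <= N + 2 * (`|lam0| + 1 + N).
  move=> hl; rewrite /refl (le_trans (enormD _ _)) // lerD ?AN // enormZ (enorm_unit e1) mulr1.
  rewrite normrM ger0_norm // ler_pM2l // (le_trans (ler_normB _ _)) // lerD //.
  exact: le_trans (dot_unit_le e1 x) (AN x Ax).
have n1 : `|lam| <= `|lam0| + 1.
  rewrite -[lam](subrK lam0) addrC (le_trans (ler_normD _ _)) // lerD2l.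
  by rewrite gtr0_norm ?subr_gt0 // ltW.
have n2 : `|lam0| <= `|lam0| + 1 by rewrite lerDl.
have h4 : 0 < lam - lam0 by rewrite subr_gt0.
have := HL _ _ (bnd _ n1) (bnd _ n2); rewrite (reflB_lam _ _ _ e1).
rewrite (gtr0_norm h4) ler_norml => /andP[h1 _].
have L1 : 0 < 2 * L + 1 by rewrite ltr_wpDl // mulr_ge0.
move: l3; rewrite (ltr_pdivlMr _ _ L1) => h2.
have h3 := Hm x Ax.
move: (lam - lam0) h1 h2 h3 h4 => z h1 h2 h3 h4; lra.
Qed.

Lemma symmetric_below :
  (forall y, dot y e < lam0 -> U lam0 y = 0) /\ (forall y, dot y e < lam0 -> V lam0 y = 0).
Proof.
apply: contrapT => nsym.
have U0 y : dot y e < lam0 -> 0 <= U lam0 y by move=> /ordered_lam0[].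
have V0 y : dot y e < lam0 -> 0 <= V lam0 y by move=> /ordered_lam0[].
have Upos x : dot x e < lam0 -> 0 <= lastc x -> 0 < U lam0 x.
  move=> xl xN; rewrite lt_def U0 // andbT; apply/eqP => Ux; apply: nsym.
  have [Uy Vx] := touching HU e1 e_last U0 V0 xl xN Ux.
  by have [Vy _] := touching HV e1 e_last V0 U0 xl xN Vx.
have Vpos x : dot x e < lam0 -> 0 <= lastc x -> 0 < V lam0 x.
  move=> xl xN; rewrite lt_def V0 // andbT; apply/eqP => Vx; apply: nsym.
  have [Vy Ux] := touching HV e1 e_last V0 U0 xl xN Vx.
  by have [Uy _] := touching HU e1 e_last U0 V0 xl xN Ux.
have [N [d0 [d00 H]]] := bad_point (lam0 + 1).
(* For lam < lam0 + d0 / 2 a bad point is at least d0 below its own plane, hence d0 / 2 below the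
   critical one; this compact set catches it. *)
pose A : set 'rV[R]_n.+1 := [set x | enorm x <= N] `&`
  ([set x | dot x e <= lam0 - d0 / 2] `&` [set x | - lastc x <= 0]).
have cA : compact A.
  apply: (@compact_enorm _ _ _ N) => [|x []//].
  apply: closedI; first by apply: closed_sublevel; exact: econtinuous_enorm.
  apply: closedI; first by apply: closed_sublevel; exact: econtinuous_dot.
  apply: (closed_sublevel (F := fun x => - lastc x)).
  apply: (econtinuous_lipschitz ler01) => x y; rewrite mul1r -opprD normrN.
  by have := coord_le_enorm (x - y) ord_max; rewrite !mxE.
have AN x : A x -> enorm x <= N by case.
have Al x : A x -> dot x e < lam0 /\ 0 <= lastc x.
  by move=> [_ [/= h1 h2]]; split; [move: h1 d00; lra|rewrite -oppr_le0].
have AU x : A x -> 0 < U lam0 x by move=> /Al[]; exact: Upos.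
have AV x : A x -> 0 < V lam0 x by move=> /Al[]; exact: Vpos.
have [t1 t10 H1] := persistence (hs_theta HU) (hs_u HU) cA AN AU.
have [t2 t20 H2] := persistence (hs_theta HU) (hs_v HU) cA AN AV.
apply: (@no_progress (Num.min (Num.min t1 t2) (Num.min 1 (d0 / 2)))).
  by rewrite !lt_min t10 t20 ltr01 divr_gt0.
move=> lam l1; rewrite -ltrBlDl !lt_min => /andP[/andP[lt1 lt2] /andP[l2 l3]].
apply: contrapT => nP.
have lamL : lam <= lam0 + 1 by move: l2; lra.
have [x [xl xN xn xd UV]] := H lam lamL nP.
have Ax : A x by split => //; split => /=; [move: xd l3; lra|rewrite oppr_le0].
rewrite ltrBlDl in lt1; rewrite ltrBlDl in lt2.
case: UV => [Ux|Vx].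
  by have := H1 lam x l1 lt1 Ax; rewrite ltNge (ltW Ux).
by have := H2 lam x l1 lt2 Ax; rewrite ltNge (ltW Vx).
Qed.

Let extend (w : 'rV[R]_n.+1 -> R) : (forall y, dot y e < lam0 -> w (T lam0 y) - w y = 0) ->
  forall y, w (T lam0 y) = w y.
Proof.
move=> H y; have [yl|yl|yl] := ltgtP (dot y e) lam0; last by rewrite (refl_fixed yl).
  by apply/eqP; rewrite -subr_eq0 H.
have Tl : dot (T lam0 y) e < lam0 by rewrite (dot_refl e1); move: yl; lra.
by apply/esym/eqP; rewrite -subr_eq0 -[X in w X - _](reflK e1 lam0 y) H.
Qed.

Lemma moving_plane : exists lam, forall y, u (T lam y) = u y /\ v (T lam y) = v y.
Proof.
have [HUs HVs] := symmetric_below.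
by exists lam0 => y; split; exact: extend.
Qed.

End moving_planes.

(** * Axial symmetry *)

Section common_centre.
Variables (R : realType) (n : nat).
Variable u : 'rV[R]_n.+1 -> R.
Hypothesis u0 : forall x, 0 < u x.
Hypothesis vu : vanishing u.

(** Otherwise the positive value u 0 would recur at all multiples of z, against decay. *)
Lemma not_periodic (z : 'rV[R]_n.+1) : (forall y, u (y + z) = u y) -> z = 0.
Proof.
move=> per; apply: contrapT => /eqP z0.
have zn := enorm_gt0 z0.
have perk k : u (k%:R *: z) = u 0.
  elim: k => [|k IH]; first by rewrite scale0r.
  by rewrite -natr1 scalerDl scale1r per.
have [N HN] := vu (u0 0).
pose k := (Num.truncn (`|N| / enorm z)).+1.
have kN : N < enorm (k%:R *: z).
  rewrite enormZ ger0_norm // (le_lt_trans (ler_norm N)) // -ltr_pdivrMr //.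
  exact: truncnS_gt.
by have := HN _ kN; rewrite perk ltxx.
Qed.

(* flip c n is the point reflection of the horizontal variable through c; the
   partial flips serve its decomposition into coordinate reflections. *)
Definition flip (c : 'rV[R]_n.+1) (m : nat) (y : 'rV[R]_n.+1) : 'rV[R]_n.+1 :=
  \row_j (if (j < m)%N then 2 * c ord0 j - y ord0 j else y ord0 j).

Lemma dot_flip c y (e : 'rV[R]_n.+1) : lastc e = 0 ->
  dot (flip c n y) e = 2 * dot c e - dot y e.
Proof.
move=> e0; rewrite /dot mulr_sumr -sumrB; apply: eq_bigr => j _; rewrite mxE.
case: ltnP => [_|nj]; first by ring.
have -> : j = ord_max by apply: val_inj; apply/eqP; rewrite eqn_leq nj -ltnS ltn_ord.
by rewrite [e _ _]e0 !mulr0 subr0.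
Qed.

Lemma flip_flip c y (e : 'rV[R]_n.+1) (k : R) : lastc e = 0 ->
  flip c n (flip c n y + k *: e) = y - k *: e.
Proof.
move=> e0; apply/rowP => j; rewrite !mxE; case: ltnP => [_|nj]; first by ring.
have -> : j = ord_max by apply: val_inj; apply/eqP; rewrite eqn_leq nj -ltnS ltn_ord.
by rewrite [e _ _]e0 !mulr0 subr0 addr0.
Qed.

Lemma flip_invariant (c : 'rV[R]_n.+1) : (forall (i : 'I_n) y,
    u (refl (delta_mx ord0 (lift ord_max i)) (c ord0 (lift ord_max i)) y) = u y) ->
  forall m y, (m <= n)%N -> u (flip c m y) = u y.
Proof.
move=> H m y; elim: m => [_|m IH mn].
  by congr u; apply/rowP => j; rewrite mxE ltn0.
rewrite -(IH (ltnW mn)) -(H (Ordinal mn)); congr u; apply/rowP => j.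
have lm : lift ord_max (Ordinal mn) = m :> nat by rewrite lift_max.
have dE x : dot x (delta_mx ord0 (lift ord_max (Ordinal mn))) = x ord0 (lift ord_max (Ordinal mn)).
  rewrite /dot (bigD1 (lift ord_max (Ordinal mn))) //= mxE !eqxx mulr1 big1 ?addr0 // => i im.
  by rewrite mxE (negbTE im) andbF mulr0.
rewrite /refl dE !mxE lm ltnSn eqxx /=.
have [->|jm] := eqVneq j (lift ord_max (Ordinal mn)).
  by rewrite lm ltnSn ltnn /=; ring.
rewrite mulr0 addr0 ltnS leq_eqVlt.
by have -> : (j == m :> nat) = false by apply: contra_neqF jm => /eqP jm; apply: val_inj; exact: etrans jm (esym lm).
Qed.

(** The square of the composition of the point reflection with the plane reflection is a translation
    by a multiple of 4 (lam - c.e) e, so u would be periodic if the plane missed c. *)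
Lemma plane_through_centre c (e : 'rV[R]_n.+1) lam : dot e e = 1 -> lastc e = 0 ->
  (forall y, u (flip c n y) = u y) -> (forall y, u (refl e lam y) = u y) ->
  lam = dot c e.
Proof.
move=> e1 e0 Hc He.
have : (4 * (lam - dot c e)) *: e = 0.
  apply: not_periodic => y.
  rewrite -[RHS]Hc -[RHS]He -[RHS]Hc -[RHS]He; congr u.
  rewrite {2}/refl flip_flip // dot_flip // /refl !(dotDl, dotNl, dotZl) e1.
  by apply/rowP => j; rewrite !mxE; ring.
move=> /(congr1 (fun z => dot z e)); rewrite dotZl e1 dot0l mulr1 => /eqP.
by rewrite mulf_eq0 pnatr_eq0 /= subr_eq0 => /eqP.
Qed.

End common_centre.

Lemma enorm_xbar (R : realType) n (x : 'rV[R]_n.+1) :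
  enorm x ^+ 2 = enorm (xbar x) ^+ 2 + lastc x ^+ 2.
Proof.
rewrite !enorm_sqr /dot big_ord_recr /= expr2; congr (_ + _).
apply: eq_bigr => i _; rewrite !mxE.
by have -> : lift ord_max i = widen_ord (leqnSn n) i by apply: val_inj; exact: lift_max.
Qed.

(** The perpendicular bisector of x and y passes through every point equidistant from them. *)
Lemma reflection_between (R : realType) n (c x y : 'rV[R]_n) : x != y ->
  enorm (x - c) = enorm (y - c) ->
  let e := (enorm (x - y))^-1 *: (x - y) in dot e e = 1 /\ refl e (dot c e) x = y.
Proof.
move=> xy h; have z0 : 0 < enorm (x - y) by rewrite enorm_gt0 // subr_eq0.
have zz : enorm (x - y) ^- 2 * dot (x - y) (x - y) = 1.
  by rewrite -enorm_sqr mulVf // expf_neq0 // gt_eqF.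
move=> e; split.
  by rewrite /e dotZl dotZr mulrA -expr2 exprVn.
have hz : 2 * dot (x - c) (x - y) = dot (x - y) (x - y).
  have := congr1 (fun t => t ^+ 2) h; rewrite !enorm_sqr !(dotDl, dotDr, dotNl, dotNr).
  by rewrite (dotC c x) (dotC c y) (dotC y x); lra.
have -> : refl e (dot c e) x = x - (2 * dot (x - c) e) *: e.
  by rewrite /refl dotDl dotNl; apply/rowP => i; rewrite !mxE; ring.
have -> : (2 * dot (x - c) e) *: e = x - y.
  rewrite /e dotZr scalerA [X in X *: _](_ : _ = 1) ?scale1r // -[RHS]zz -hz -exprVn.
  by ring.
by rewrite opprB addrCA subrr addr0.
Qed.

(** Needed to read the second equation as a half system with the unknowns exchanged. *)
Lemma C1_quadrant_swap (R : realType) (f : R -> R -> R) :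
  C1_quadrant f -> C1_quadrant (fun s t => f t s).
Proof.
pose Q : set (R * R) := [set z : R * R | 0 <= z.1 /\ 0 <= z.2].
have sw (F : R * R -> R) : {within Q, continuous F} ->
    {within Q, continuous (fun z => F (z.2, z.1))}.
  move=> /subspace_continuousP cF; apply/subspace_continuousP => -[s t] [/= s0 t0].
  have := cF (t, s) (conj t0 s0); apply: cvg_trans.
  move=> A /= [B [B1 B2] BA].
  exists (B.2, B.1) => // -[s' t'] [/= h1 h2] [/= s'0 t'0].
  by apply: (BA (t', s')).
move=> [cf [df [f1 [f2 [c1 c2 fE]]]]]; split; first exact: (sw (fun z => f z.1 z.2)).
split; first by move=> s t s0 t0; exact: (conj (df t s t0 s0).2 (df t s t0 s0).1).
exists (fun z => f2 (z.2, z.1)), (fun z => f1 (z.2, z.1)); split; [exact: sw|exact: sw|].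
by move=> s t s0 t0; exact: (conj (fE t s t0 s0).2 (fE t s t0 s0).1).
Qed.

Lemma vanishing_bounded (R : realType) n (u : 'rV[R]_n -> R) : econtinuous u ->
  vanishing u -> exists M, forall x, u x <= M.
Proof.
move=> cu vu; have [N HN] := vu 1 ltr01.
pose A : set 'rV[R]_n := [set x | enorm x <= `|N|].
have cA : compact A.
  by apply: (@compact_enorm _ _ _ `|N|) => //; apply: closed_sublevel; exact: econtinuous_enorm.
have cu' : econtinuous (fun x => 0 - u x).
  apply: econtinuousB cu => x eta eta0; exists 1 => // y _; by rewrite subrr normr0.
have A0 : A !=set0 by exists 0; rewrite /A /= enorm0.
have [c _ Hc] := compact_min A0 cA cu'.
exists (Num.max 1 (u c)) => x; rewrite le_max.
have [xN|xN] := leP (enorm x) `|N|.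
  by have := Hc x xN; rewrite !sub0r lerN2 => ->; rewrite orbT.
by rewrite ltW // HN // (le_lt_trans (ler_norm N)).
Qed.

(* The ambient space is R^(n.+1). *)
Theorem theorem2 (R : realType) (n : nat) (hn : (2 <= n.+1)%N)
  (alpha : R) (halpha : 0 < alpha < 2)
  (f g h l : R -> R -> R)
  (hf : C1_quadrant f) (hg : C1_quadrant g)
  (hh : C1_quadrant h) (hl : C1_quadrant l)
  (u v : 'rV[R]_n.+1 -> R)
  (theta : R) (htheta : Num.max 0 (alpha - 1) < theta)
  (hu : L_space alpha u /\ C1_loc_holder theta u)
  (hv : L_space alpha v /\ C1_loc_holder theta v)
  (hupos : forall x, 0 < u x) (hvpos : forall x, 0 < v x)
  (equ : forall x, 0 < lastc x -> frac_laplacian_eq alpha u x (f (u x) (v x)))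
  (eqv : forall x, 0 < lastc x -> frac_laplacian_eq alpha v x (g (u x) (v x)))
  (bcu : forall x, lastc x < 0 ->
     nonlocal_normal alpha u x = (h (u x) (v x))%:E)
  (bcv : forall x, lastc x < 0 ->
     nonlocal_normal alpha v x = (l (u x) (v x))%:E)
  (a b p q r s : R) (ha : 0 < a) (hb : 0 < b)
  (hp : 1 <= p) (hq : 1 <= q) (hr : 1 <= r) (hs : 1 <= s)
  (hi : exists M : R, forall x, M < enorm x ->
     u x <= 1 / enorm x `^ a /\ v x <= 1 / enorm x `^ b)
  (hii : near_origin (fun y z =>
     partial1 f y z <= y `^ (p - 1) * z `^ q /\
     partial2 g y z <= y `^ r * z `^ (s - 1)))
  (hiii : near_origin (fun y z =>
     partial2 f y z <= y `^ p * z `^ (q - 1) /\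
     partial1 g y z <= y `^ (r - 1) * z `^ s))
  (hiv : forall y z : R, 0 < y -> 0 < z ->
     0 < partial2 f y z /\ 0 < partial1 g y z)
  (hv' : forall y z : R, 0 < y -> 0 < z ->
     [/\ partial1 h y z < 0, partial2 l y z < 0,
         0 < partial2 h y z & 0 < partial1 l y z])
  (hvi : exists mu nu : R, [/\ 0 < mu, 0 < nu, 1 < mu * nu &
     forall y z : R, 0 < y -> 0 < z ->
       mu * partial2 h y z <= - partial1 h y z /\
       nu * partial1 l y z <= - partial2 l y z])
  (hvii : alpha < Num.min
     (Num.min (a * p + b * q - a) (a * p + b * q - b))
     (Num.min (a * r + b * s - a) (a * r + b * s - b))) :
  exists x0 : 'rV[R]_n, forall x y : 'rV[R]_n.+1,
    enorm (xbar x - x0) = enorm (xbar y - x0) -> lastc x = lastc y ->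
    u x = u y /\ v x = v y.
Proof.
have [t0 ta] : 0 < theta /\ alpha - 1 < theta by move: htheta; rewrite gt_max => /andP.
have [mu [nu [mu0 nu0 munu hmn]]] := hvi.
have [Nd decay] := hi.
have mfu : mfun_on u by have [[]] := hu.
have mfv : mfun_on v by have [[]] := hv.
have Hu := hu.2; have Hv := hv.2.
have vu : vanishing u by apply: (decay_vanishing ha) => x /decay[].
have vv : vanishing v by apply: (decay_vanishing hb) => x /decay[].
have [M1 HM1] := vanishing_bounded (holder_continuous t0 Hu) vu.
have [M2 HM2] := vanishing_bounded (holder_continuous t0 Hv) vv.
pose M := Num.max M1 M2.
have uM x : u x <= M by rewrite /M le_max HM1.
have vM x : v x <= M by rewrite /M le_max HM2 orbT.
move: hvii; rewrite !lt_min => /andP[/andP[pq1 pq2] /andP[rs1 rs2]].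
have [d1 d10 hd1] := hii; have [d2 d20 hd2] := hiii.
have HU : half_system alpha theta mu M a b p q f h u v.
  split => //.
  - exists (Num.min d1 d2) => [|y z]; first by rewrite lt_min d10.
    rewrite !lt_min => /and3P[y0 y1 y2] /and3P[z0 z1 z2].
    have [h1 _] := hd1 y z ltac:(by rewrite y0) ltac:(by rewrite z0).
    by have [h2 _] := hd2 y z ltac:(by rewrite y0) ltac:(by rewrite z0).
  - by move=> y z y0 z0; have [] := hiv y z y0 z0.
  - by move=> y z y0 z0; have [] := hv' y z y0 z0.
  - by move=> y z y0 z0; have [] := hmn y z y0 z0.
have HV : half_system alpha theta nu M b a s r
    (fun y z => g z y) (fun y z => l z y) v u.
  split => //.
  - exact: C1_quadrant_swap.
  - exact: C1_quadrant_swap.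
  - by exists Nd => x /decay[].
  - exists (Num.min d1 d2) => [|y z]; first by rewrite lt_min d10.
    rewrite !lt_min => /and3P[y0 y1 y2] /and3P[z0 z1 z2].
    have [_ h1] := hd1 z y ltac:(by rewrite z0) ltac:(by rewrite y0).
    have [_ h2] := hd2 z y ltac:(by rewrite z0) ltac:(by rewrite y0).
    by split; rewrite mulrC.
  - by rewrite (addrC (b * s)).
  - by rewrite (addrC (b * s)).
  - by move=> y z y0 z0; have [] := hiv z y z0 y0.
  - by move=> y z y0 z0; have [] := hv' z y z0 y0.
  - by move=> y z y0 z0; have [] := hmn z y z0 y0.
pose E (i : 'I_n) : 'rV[R]_n.+1 := delta_mx ord0 (lift ord_max i).
have dE x i : dot x (E i) = x ord0 (lift ord_max i).
  rewrite /dot (bigD1 (lift ord_max i)) //= mxE !eqxx mulr1 big1 ?addr0 // => j jm.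
  by rewrite mxE (negbTE jm) andbF mulr0.
have EE i : dot (E i) (E i) = 1 by rewrite dE mxE !eqxx.
have El i : lastc (E i) = 0 by rewrite /lastc mxE (negbTE (neq_lift _ _)).
have [lam Hlam] := choice (fun i => moving_plane HU HV munu (EE i) (El i)).
(* The coordinate planes fix the horizontal part of the centre; its last coordinate is arbitrary,
   being orthogonal to every horizontal direction. *)
pose c : 'rV[R]_n.+1 := \row_j (if unlift ord_max j is Some i then lam i else 0).
have cE i : c ord0 (lift ord_max i) = lam i by rewrite mxE liftK.
exists (xbar c) => x y xy xyN.
have [->|nxy] := eqVneq x y; first by split.
have cN : lastc c = 0 by rewrite /lastc mxE unlift_none.
have xbB z : xbar z - xbar c = xbar (z - c) by apply/rowP => i; rewrite !mxE.
have dxy : enorm (x - c) = enorm (y - c).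
  apply/eqP; rewrite -(@eqrXn2 _ 2) ?enorm_ge0 // !enorm_xbar -!xbB xy.
  by rewrite (_ : lastc (x - c) = lastc (y - c)) // /lastc !mxE [x _ _]xyN.
have [e1 exy] := reflection_between nxy dxy.
set e := _ *: _ in e1 exy.
have e0 : lastc e = 0 by rewrite /e /lastc !mxE [x _ _]xyN subrr mulr0.
(* Points at equal height are exchanged by a horizontal reflection through c. The procedure in that
   direction yields some plane, and passing through c identifies it with the bisector. *)
have [la Hla] := moving_plane HU HV munu e1 e0.
have fu z : u (flip c n z) = u z.
  by apply: flip_invariant => // i w; rewrite cE; have [] := Hlam i w.
have laE : la = dot c e.
  by apply: (plane_through_centre hupos vu e1 e0 fu) => w; have [] := Hla w.
by have [h1 h2] := Hla x; rewrite -exy -laE.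
Qed.
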